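(* Let $(M,L)$ be a Finsler manifold admitting a concurrent $\pi$-vector field $\overline{\zeta}$, and let $(M,\widetilde{L})$ be the Finsler manifold obtained from it by the energy $\beta$-change $\widetilde{L}^{2}=L^{2}+B^{2}$, where $B:=g(\overline{\zeta},\overline{\eta})$. Put $p^{2}:=g(\overline{\zeta},\overline{\zeta})$. Then the curvature tensors of the associated Cartan connections $\nabla$ and $\widetilde{\nabla}$ are related, for all vector fields $X,Y$ on $\mathcal{T}M$ and all $\overline{Z}\in\mathfrak{X}(\pi(M))$, by $$\widetilde{\mathbf{K}}(X,Y)\overline{Z}=\mathbf{K}(X,Y)\overline{Z}+\frac{g(\mathbf{T}(X,Y),\overline{Z})}{1+p^2}\,\overline{\zeta}+H(\rho X,\rho Y)\overline{Z},$$ where $H$ is the $\pi$-tensor field defined by $$H(\rho X,\rho Y)\overline{Z}=\mathfrak{U}_{X,Y}\left\{\frac{g(\rho X,\overline{Z})}{1+p^2}\,\rho Y+\frac{g(\rho Y,\overline{Z})\,g(\rho X,\overline{\zeta})}{(1+p^2)^2}\,\overline{\zeta}\right\}.$$ In particular, for all $\overline{X},\overline{Y},\overline{Z}\in\mathfrak{X}(\pi(M))$: (a) $\widetilde{S}(\overline{X},\overline{Y})\overline{Z}=S(\overline{X},\overline{Y})\overline{Z}$; (b) $\widetilde{P}(\overline{X},\overline{Y})\overline{Z}=P(\overline{X},\overline{Y})\overline{Z}-\dfrac{g(T(\overline{Y},\overline{X}),\overline{Z})}{1+p^2}\,\overline{\zeta}$; (c) $\widetilde{R}(\overline{X},\o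verline{Y})\overline{Z}=R(\overline{X},\overline{Y})\overline{Z}+H(\overline{X},\overline{Y})\overline{Z}$.
   Context: $M$ is a real paracompact smooth manifold of finite dimension $n$; all objects are $C^\infty$. $\pi:\mathcal{T}M\to M$ is the bundle of nonzero tangent vectors, $\pi^{-1}(TM)\to\mathcal{T}M$ the pullback of $TM$ by $\pi$. Sections of $\pi^{-1}(TM)$ are called $\pi$-vector fields, are written with bars, and form the module $\mathfrak{X}(\pi(M))$; tensor fields on $\pi^{-1}(TM)$ are called $\pi$-tensor fields. The fundamental $\pi$-vector field is $\overline{\eta}(u)=(u,u)$. $\rho:T(\mathcal{T}M)\to\pi^{-1}(TM)$ is $\rho=(\pi_{\mathcal{T}M},d\pi)$, and $\gamma:\pi^{-1}(TM)\to T(\mathcal{T}M)$ is the vertical lift $\gamma(u,v)=j_u(v)$, with $j_u:T_{\pi(u)}M\to T_u(T_{\pi(u)}M)$ the natural isomorphism. $(M,L)$ is a Finsler manifold with Finsler metric $g$ on $\pi^{-1}(TM)$ (locally $g_{ij}=\frac12\partial^2L^2/\partial y^i\partial y^j$). For a linear connection $D$ on $\pi^{-1}(TM)$ its connection map is $K(X)=D_X\overline{\eta}$; $D$ is regular if $T_u(\mathcal{T}M)=V_u(\mathcal{T}M)\oplus\ker K_u$ for all $u$ ($V$ the vertical bundle), and then its horizontal map is $\beta:=(\rho|_{\ker K})^{-1}$. The torsion is $\mathbf{T}(X,Y)=D_X\rho Y-D_Y\rho X-\rho[X,Y]$, with $Q(\overline{X},\overline{Y})=\mathbf{T}(\beta\overline{X},\beta\overline{Y})$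 and $(h)hv$-torsion $T(\overline{X},\overline{Y})=\mathbf{T}(\gamma\overline{X},\beta\overline{Y})$. The curvature is $\mathbf{K}(X,Y)\rho Z=-D_XD_Y\rho Z+D_YD_X\rho Z+D_{[X,Y]}\rho Z$, with $R(\overline{X},\overline{Y})\overline{Z}=\mathbf{K}(\beta\overline{X},\beta\overline{Y})\overline{Z}$, $P(\overline{X},\overline{Y})\overline{Z}=\mathbf{K}(\beta\overline{X},\gamma\overline{Y})\overline{Z}$, $S(\overline{X},\overline{Y})\overline{Z}=\mathbf{K}(\gamma\overline{X},\gamma\overline{Y})\overline{Z}$. The Cartan connection $\nabla$ is the unique regular connection on $\pi^{-1}(TM)$ with $\nabla g=0$, $Q=0$ and $g(T(\overline{X},\overline{Y}),\overline{Z})=g(T(\overline{X},\overline{Z}),\overline{Y})$. A $\pi$-vector field $\overline{\zeta}$ is concurrent if $\nabla_{\beta\overline{X}}\overline{\zeta}=-\overline{X}$ and $\nabla_{\gamma\overline{X}}\overline{\zeta}=0$ for all $\overline{X}$. Untilded $\mathbf{T},T,\mathbf{K},R,P,S$ are those of the Cartan connection $\nabla$ of $L$; tilded ones are those of the Cartan connection $\widetilde{\nabla}$ of $\widetilde{L}$ (with its own horizontal map $\widetilde{\beta}$). $\mathfrak{U}_{X,Y}\{A(X,Y)\}:=A(X,Y)-A(Y,X)$. *)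

(* Defs.v *)
From HB Require Import structures.
From mathcomp Require Import all_boot all_order all_algebra.
From mathcomp Require Import boolp classical_sets functions cardinality reals.
From mathcomp Require Import topology tvs normedtype derive.

Set Implicit Arguments.
Unset Strict Implicit.
Unset Printing Implicit Defensive.

Import Order.TTheory GRing.Theory Num.Theory.
Import numFieldNormedType.Exports.

Local Open Scope classical_set_scope.
Local Open Scope ring_scope.

(* C^0: continuous; C^(k+1): Frechet differentiable with every directional
   derivative C^k (in finite dimension: the differential is C^k).  The
   definition is meant for an open set A. *)
Fixpoint Ck_on (R : realType) (V W : normedModType R) (k : nat) (A : set V)
    (f : V -> W) : Prop :=
  if k is k'.+1 then
    (forall x, A x -> differentiable f x) /\
    (forall v, Ck_on k' A (fun x => 'D_v f x))
  else forall x, A x -> {for x, continuous f}.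

Definition smooth_on (R : realType) (V W : normedModType R) (A : set V)
    (f : V -> W) : Prop := forall k, Ck_on k A f.

Definition smooth_near (R : realType) (V W : normedModType R) (x : V)
    (f : V -> W) : Prop := exists A : set V, [/\ open A, A x & smooth_on A f].

Definition paracompact (T : topologicalType) : Prop :=
  forall C : set (set T),
    (forall U, C U -> open U) -> (forall p, exists2 U, C U & U p) ->
    exists D : set (set T),
      [/\ (forall V, D V -> open V),
          (forall p, exists2 V, D V & V p),
          (forall V, D V -> exists2 U, C U & V `<=` U) &
          (forall p : T, exists2 N, nbhs p N &
             finite_set [set V | D V /\ V `&` N !=set0])].

(* A smooth manifold of dimension n: a Hausdorff paracompact space with a
   smooth atlas.  [chart_at p] is a preferred chart around p; it is only used
   to represent tangent vectors at p by their coordinates.  [chart c] and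
   [chart_inv c] are total functions, meaningful on the domain of c and on its
   image respectively. *)
Record manifold (R : realType) (n : nat) := Manifold {
  mpoint :> topologicalType ;
  chart_index : Type ;
  chart_dom : chart_index -> set mpoint ;
  chart : chart_index -> mpoint -> 'rV[R]_n ;
  chart_inv : chart_index -> 'rV[R]_n -> mpoint ;
  chart_at : mpoint -> chart_index ;
  manifold_hausdorff : hausdorff_space mpoint ;
  manifold_paracompact : paracompact mpoint ;
  chart_dom_open : forall c, open (chart_dom c) ;
  chart_img_open : forall c, open (chart c @` chart_dom c) ;
  chartK : forall c p, chart_dom c p -> chart_inv c (chart c p) = p ;
  chart_continuous : forall c p, chart_dom c p -> {for p, continuous (chart c)} ;
  chart_inv_continuous : forall c x, (chart c @` chart_dom c) x ->
    {for x, continuous (chart_inv c)} ;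
  chart_at_dom : forall p, chart_dom (chart_at p) p ;
  chart_compat : forall c d,
    smooth_on (chart c @` (chart_dom c `&` chart_dom d))
              (chart d \o chart_inv c) }.

Section Bundles.
Context {R : realType} {n : nat} {M : manifold R n}.

(* The tangent space T_p M is R^n, through the preferred chart at p; the
   total space TM is thus M * R^n as a set (its charts are [tchart] below, so
   it is not a product bundle).  A point u of TM is a pair (p, y).  Since
   T_p M depends on [chart_at p], sections are smooth when their coordinate
   representatives in the charts of TM are, not as maps into R^n. *)
Definition TM : Type := (M * 'rV[R]_n)%type.

Definition slit (u : TM) : Prop := u.2 != 0.

(* coordinates in the chart c of a tangent vector at p *)
Definition tcoord (c : chart_index M) (p : M) (v : 'rV[R]_n) : 'rV[R]_n :=
  'd (chart c \o chart_inv (chart_at p)) (chart (chart_at p) p) v.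

(* the chart of TM induced by c, over the domain of c, and its inverse *)
Definition tchart (c : chart_index M) (u : TM) : 'rV[R]_n * 'rV[R]_n :=
  (chart c u.1, tcoord c u.1 u.2).

Definition tchart_inv (c : chart_index M) (z : 'rV[R]_n * 'rV[R]_n) : TM :=
  let p := chart_inv c z.1 in
  (p, 'd (chart (chart_at p) \o chart_inv c) (z.1) z.2).

(* T_u(TM) is R^n * R^n, through the chart of TM induced by the preferred
   chart at the base point of u. *)
Definition TTM : Type := ('rV[R]_n * 'rV[R]_n)%type.

Definition tchart_at (u : TM) : chart_index M := chart_at u.1.

Definition zat (u : TM) : 'rV[R]_n * 'rV[R]_n := tchart (tchart_at u) u.

(* coordinates in the chart c of TM of a vector tangent to TM at u *)
Definition ttcoord (c : chart_index M) (u : TM) (w : TTM) : TTM :=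
  'd (tchart c \o tchart_inv (tchart_at u)) (zat u) w.

(* Functions on TM, pi-vector fields (sections u |-> X u in T_(pi u) M) and
   vector fields on TM (sections u |-> X u in T_u TM), with their local
   representatives. *)
Definition funTM : Type := TM -> R^o.
Definition pifield : Type := TM -> 'rV[R]_n.
Definition field : Type := TM -> TTM.

Definition fun_rep (f : funTM) (c : chart_index M)
  (z : 'rV[R]_n * 'rV[R]_n) : R^o := f (tchart_inv c z).

Definition pifield_rep (X : pifield) (c : chart_index M)
    (z : 'rV[R]_n * 'rV[R]_n) : 'rV[R]_n :=
  let u := tchart_inv c z in tcoord c u.1 (X u).

Definition field_rep (X : field) (c : chart_index M)
    (z : 'rV[R]_n * 'rV[R]_n) : 'rV[R]_n * 'rV[R]_n :=
  let u := tchart_inv c z in ttcoord c u (X u).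

Definition fun_near (u : TM) (f : funTM) : Prop :=
  forall c, chart_dom c u.1 -> smooth_near (tchart c u) (fun_rep f c).

Definition pifield_near (u : TM) (X : pifield) : Prop :=
  forall c, chart_dom c u.1 -> smooth_near (tchart c u) (pifield_rep X c).

Definition field_near (u : TM) (X : field) : Prop :=
  forall c, chart_dom c u.1 -> smooth_near (tchart c u) (field_rep X c).

Definition smooth_fun (f : funTM) : Prop := forall u, slit u -> fun_near u f.
Definition smooth_pifield (X : pifield) : Prop :=
  forall u, slit u -> pifield_near u X.
Definition smooth_field (X : field) : Prop :=
  forall u, slit u -> field_near u X.

(* derivative of f along w in T_u(TM) *)
Definition dfun (u : TM) (w : TTM) (f : funTM) : R :=
  'd (fun_rep f (tchart_at u)) (zat u) w.

(* [X, Y]^i = X^j d_j Y^i - Y^j d_j X^i, computed in the preferred chart *)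
Definition bracket (X Y : field) : field := fun u =>
  let c := tchart_at u in
  'd (field_rep Y c) (zat u) (X u) - 'd (field_rep X c) (zat u) (Y u).

(* rho = (pi, d pi) *)
Definition rho (u : TM) (w : TTM) : 'rV[R]_n :=
  let c := tchart_at u in
  'd (fun z : 'rV[R]_n * 'rV[R]_n => chart c (tchart_inv c z).1) (zat u) w.

(* j_u : T_(pi u) M -> T_u(T_(pi u) M), as the differential at u of the
   inclusion of the fibre *)
Definition gam (u : TM) (v : 'rV[R]_n) : TTM :=
  'd (fun y : 'rV[R]_n => tchart (tchart_at u) (u.1, y)) (u.2) v.

Definition eta : pifield := fun u => u.2.

Definition rhof (X : field) : pifield := fun u => rho u (X u).
Definition gamf (X : pifield) : field := fun u => gam u (X u).

(* A linear connection on pi^{-1}(TM) over the slit bundle, as a covariant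
   derivative D u w Y of a pi-vector field Y, smooth near u, along a vector w
   tangent to TM at u.  That D u w Y depends only on the germ of Y at u
   follows from the Leibniz rule, applied to functions equal to 1 near u. *)
Definition connection : Type := TM -> TTM -> pifield -> 'rV[R]_n.

Record linear_connection (D : connection) : Prop := LinearConnection {
  conn_linear : forall u a w w' Y, slit u -> pifield_near u Y ->
    D u (a *: w + w') Y = a *: D u w Y + D u w' Y ;
  conn_add : forall u w Y Y', slit u -> pifield_near u Y -> pifield_near u Y' ->
    D u w (fun u' => Y u' + Y' u') = D u w Y + D u w Y' ;
  conn_leibniz : forall u w (f : funTM) Y,
    slit u -> fun_near u f -> pifield_near u Y ->
    D u w (fun u' => (f u' : R) *: Y u') = dfun u w f *: Y u + f u *: D u w Y ;
  conn_smooth : forall u X Y, slit u -> field_near u X -> pifield_near u Y ->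
    pifield_near u (fun u' => D u' (X u') Y) }.

Definition conn_map (D : connection) (u : TM) (w : TTM) : 'rV[R]_n :=
  D u w eta.

(* T_u(TM) is the direct sum of the vertical space ker rho_u and ker K_u *)
Definition regular (D : connection) : Prop := forall u, slit u ->
  (forall w, exists v h,
     [/\ w = v + h, rho u v = 0 & conn_map D u h = 0]) /\
  (forall w, rho u w = 0 -> conn_map D u w = 0 -> w = 0).

(* the horizontal map, (rho | ker K)^-1 *)
Definition hmap (D : connection) (u : TM) (v : 'rV[R]_n) : TTM :=
  xget 0 [set w | conn_map D u w = 0 /\ rho u w = v].

Definition hmapf (D : connection) (X : pifield) : field :=
  fun u => hmap D u (X u).

Definition torsion (D : connection) (X Y : field) : pifield := fun u =>
  D u (X u) (rhof Y) - D u (Y u) (rhof X) - rho u (bracket X Y u).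

Definition torsionQ (D : connection) (X Y : pifield) : pifield :=
  torsion D (hmapf D X) (hmapf D Y).

Definition torsionT (D : connection) (X Y : pifield) : pifield :=
  torsion D (gamf X) (hmapf D Y).

Definition curvature (D : connection) (X Y : field) (Z : pifield) : pifield :=
  fun u =>
    - D u (X u) (fun u' => D u' (Y u') Z)
    + D u (Y u) (fun u' => D u' (X u') Z)
    + D u (bracket X Y u) Z.

Definition curvatureR (D : connection) (X Y Z : pifield) : pifield :=
  curvature D (hmapf D X) (hmapf D Y) Z.

Definition curvatureP (D : connection) (X Y Z : pifield) : pifield :=
  curvature D (hmapf D X) (gamf Y) Z.

Definition curvatureS (D : connection) (X Y Z : pifield) : pifield :=
  curvature D (gamf X) (gamf Y) Z.

(* g_ij = 1/2 d^2 L^2 / dy^i dy^j, in the coordinates of T_p M given by the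
   preferred chart at p *)
Definition metric_coef (L : funTM) (u : TM) (i j : 'I_n) : R :=
  2^-1 * 'D_(delta_mx 0 i : 'rV[R]_n)
           (fun y => 'D_(delta_mx 0 j : 'rV[R]_n)
              (fun y' : 'rV[R]_n => (L (u.1, y') ^+ 2 : R^o)) y) u.2.

Definition metric (L : funTM) (u : TM) (v w : 'rV[R]_n) : R :=
  \sum_(i < n) \sum_(j < n) metric_coef L u i j * v 0 i * w 0 j.

(* Only the values of L on nonzero vectors matter. *)
Record finsler (L : funTM) : Prop := Finsler {
  finsler_smooth : smooth_fun L ;
  finsler_pos : forall u, slit u -> 0 < L u ;
  finsler_homog : forall u (t : R), slit u -> 0 < t ->
    L (u.1, t *: u.2) = t * L u ;
  finsler_posdef : forall u v, slit u -> v != 0 -> 0 < metric L u v v }.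

Record cartan (L : funTM) (D : connection) : Prop := Cartan {
  cartan_linear : linear_connection D ;
  cartan_regular : regular D ;
  cartan_metric : forall u w Y Z,
    slit u -> pifield_near u Y -> pifield_near u Z ->
    dfun u w (fun u' => metric L u' (Y u') (Z u')) =
    metric L u (D u w Y) (Z u) + metric L u (Y u) (D u w Z) ;
  cartan_Q : forall u X Y,
    slit u -> pifield_near u X -> pifield_near u Y -> torsionQ D X Y u = 0 ;
  cartan_T : forall u X Y Z, slit u ->
    pifield_near u X -> pifield_near u Y -> pifield_near u Z ->
    metric L u (torsionT D X Y u) (Z u) =
    metric L u (torsionT D X Z u) (Y u) }.

Definition concurrent (D : connection) (zeta : pifield) : Prop :=
  [/\ smooth_pifield zeta,
      (forall u v, slit u -> D u (hmap D u v) zeta = - v) &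
      (forall u v, slit u -> D u (gam u v) zeta = 0)].

Definition energy_change (L : funTM) (zeta : pifield) : funTM := fun u =>
  Num.sqrt (L u ^+ 2 + metric L u (zeta u) (eta u) ^+ 2).

Definition skew (A : 'rV[R]_n -> 'rV[R]_n -> 'rV[R]_n) (x y : 'rV[R]_n) :=
  A x y - A y x.

Definition tensorH (L : funTM) (zeta : pifield) (u : TM)
    (x y z : 'rV[R]_n) : 'rV[R]_n :=
  let g := metric L u in
  let p2 := g (zeta u) (zeta u) in
  skew (fun x y =>
    (g x z / (1 + p2)) *: y
    + (g y z * g x (zeta u) / (1 + p2) ^+ 2) *: zeta u) x y.

End Bundles.

Arguments TM {R n} M.
Arguments funTM {R n} M.
Arguments pifield {R n} M.
Arguments field {R n} M.
Arguments connection {R n} M.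

(* Main.v *)
From HB Require Import structures.
Require Import Defs.
From mathcomp Require Import all_boot all_order all_algebra.
From mathcomp Require Import boolp classical_sets functions cardinality reals.
From mathcomp Require Import topology tvs normedtype landau derive.
From mathcomp Require Import ring lra.

Set Implicit Arguments.
Unset Strict Implicit.
Unset Printing Implicit Defensive.
Import Order.TTheory GRing.Theory Num.Theory.
Import numFieldNormedType.Exports.
Local Open Scope classical_set_scope.
Local Open Scope ring_scope.

(** Write [g] for the Finsler metric, [p2] for [g(zeta, zeta)] and [T] for the
    (h)hv-torsion.  Everything rests on one fact: a concurrent field satisfies
    [T(_, zeta) = 0].  Indeed [p2] has no vertical derivative, and its horizontal
    derivatives are [-2 g(_, zeta)]; exchanging a vertical and a horizontal
    derivative of [p2] shows that the covector [g(_, zeta)] has no vertical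
    derivative, which says precisely that [T(_, zeta)] vanishes
    ([vertical_lower_zeta]).

    Consequently [B = g(zeta, eta)] is linear along the fibres, so that the
    metric of the changed energy is [g + g(zeta, _) g(zeta, _)]
    ([energy_hessian]).  For this metric the connection
    [nabla_W Y - g(rho W, Y) / (1 + p2) zeta] is metric, because
    [nabla_W zeta = - rho W], and it has the same torsion as [nabla], because the
    correction is symmetric in [rho W] and [Y].  It is therefore the Cartan
    connection [nablat], by uniqueness ([changed_connection]).  Uniqueness is an
    algebraic statement about the difference [A] of two connections
    ([cartan_rigidity]): [A] is skew for the metric, and its antisymmetric part
    is expressed through [T] and the values of [A] on [eta]; the Koszul trick
    solves for [A], and since [T(_, eta) = 0] inserting [eta] twice gives [A = 0].

    The relation between the curvatures follows by differentiating the formula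
    for [nablat] ([changed_curvature]).  For the parts (b) and (c) it remains to
    compare the two horizontal maps.  They differ by vertical multiples of [zeta],
    so that what is needed is that the curvature of [nabla] vanishes as soon as
    one of its directions is the vertical lift of [zeta] ([curvature_zeta]).  The
    reason is that the fibrewise translation by [zeta] preserves [g] and moves
    [eta] by a multiple of [zeta], which changes the horizontal vectors by vertical
    ones but keeps their torsion zero; so it preserves the Cartan connection.  The
    infinitesimal form of this argument is again an instance of
    [cartan_rigidity], applied to the curvature operator.

    All of this is carried out in the coordinates of one chart, where a connection
    is given by coefficients [G z w a], depending on a point [z] of the tangent
    bundle, a direction [w] and a vector [a] ([connection_chart]).  Torsion and
    curvature become algebraic in the fields ([torsion_chart], [curvature_at]),
    and the axioms of a Cartan connection become identities between functions of
    [z] that can be differentiated ([cartan_coefficients_chart]). *)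

(** * Differential calculus of smooth maps *)

(** A finite basis with continuous coordinates.  It reduces the derivative of a
    linear map applied to a moving vector, and hence the chain rule at all
    orders, to finite sums of products with scalar functions. *)
Record frame (R : realType) (W : normedModType R) := Frame {
  frame_index : finType ;
  frame_vec : frame_index -> W ;
  frame_coef : frame_index -> {linear W -> R^o} ;
  frame_continuous : forall i, continuous (frame_coef i) ;
  frameE : forall w, w = \sum_i frame_coef i w *: frame_vec i }.

Arguments frame_vec {R W} f i.
Arguments frame_coef {R W} f i.
Arguments frame_continuous {R W} f i.
Arguments frameE {R W} f w.

Section Calculus.
Context {R : realType}.
Implicit Types U V W : normedModType R.

(** The differential is chosen by a description operator; that it depends on the
    germ only is read off the first-order expansion, which determines it. *)
Lemma near_eq_diff V W (f g : V -> W) (x : V) :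
  (\near x, f x = g x) -> differentiable f x ->
  differentiable g x /\ 'd g x = 'd f x :> (V -> W).
Proof.
move=> fg df.
have fgx : f x = g x by exact: (nbhs_singleton fg).
suff H : g \o shift x = cst (g x) + 'd f x +o_ 0 id.
  have E : 'd g x = 'd f x :> (V -> W).
    by apply: diff_unique H; exact: diff_continuous.
  split => //; apply/diff_locallyP; rewrite E; split => //.
  exact: diff_continuous.
have /eqaddoP H := diff_locally df.
apply/eqaddoP => e e0; have := H e e0.
have : \forall h \near 0, f (h + x) = g (h + x).
  by have := fg; rewrite (near_shift 0) /=; apply: filterS => h; rewrite /= subr0.
apply: filterS2 => h E.
rewrite -[(f \o _ - _) h]/(f (h + x) - (f x + 'd f x h)).
by rewrite -[(g \o _ - _) h]/(g (h + x) - (g x + 'd f x h)) E fgx.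
Qed.

Lemma near_eq_differentiable V W (f g : V -> W) (x : V) :
  (\near x, f x = g x) -> differentiable f x -> differentiable g x.
Proof. by move=> fg /(near_eq_diff fg)[]. Qed.

Lemma near_eq_d V W (f g : V -> W) (x : V) :
  (\near x, f x = g x) -> differentiable f x -> 'd g x = 'd f x :> (V -> W).
Proof. by move=> fg /(near_eq_diff fg)[]. Qed.

Lemma open_near_eq V W (A : set V) (f g : V -> W) : open A ->
  (forall x, A x -> f x = g x) -> forall x, A x -> \near x, f x = g x.
Proof.
move=> oA fg x Ax; have := open_nbhs_nbhs (conj oA Ax).
by apply: filterS => y /fg.
Qed.

Lemma differentiable_id V (x : V) : differentiable (fun y : V => y) x.
Proof. exact: (@ex_diff _ _ _ _ _ id id). Qed.

Lemma derive_comp U V W (f : V -> W) (g : U -> V) x v :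
  differentiable g x -> differentiable f (g x) ->
  'D_v (fun y => f (g y)) x = 'D_('D_v g x) f (g x).
Proof.
move=> dg df; have dfg : differentiable (f \o g) x by exact: differentiable_comp.
by change ('D_v (f \o g) x = 'D_('D_v g x) f (g x)); rewrite !deriveE// diff_comp.
Qed.

Lemma differentiable_scale_fun V W (k : V -> R^o) (f : V -> W) x :
  differentiable k x -> differentiable f x ->
  differentiable (fun y => k y *: f y) x /\
  'd (fun y => k y *: f y) x = (fun v => 'd k x v *: f x + k x *: 'd f x v) :> (V -> W).
Proof.
move=> dk df.
have scAC (a b : R) (c : W) : a *: (b *: c) = b *: (a *: c) by rewrite !scalerA mulrC.
have bil : bilinear_for *:%R *:%R (fun (a : R^o) (w : W) => a *: w).
  split=> [w a b c|w a b c]; first by rewrite scalerDl -scalerA.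
  by rewrite scalerDr; congr (_ + _); exact: scAC.
pose sM := bilinear_isBilinear.Build R R^o W W *:%R *:%R (fun (a : R^o) (w : W) => a *: w) bil.
pose sc : {bilinear R^o -> W -> W} := HB.pack (fun (a : R^o) (w : W) => a *: w) sM.
have cs p : {for p, continuous (fun q : R^o * W => sc q.1 q.2)}.
  exact: scale_continuous.
have E : (fun y => k y *: f y) = (fun q : R^o * W => sc q.1 q.2) \o (fun y => (k y, f y)) by [].
have dp : differentiable (fun y => (k y, f y)) x by exact: differentiable_pair.
have ds p : differentiable (fun q : R^o * W => sc q.1 q.2) p.
  exact: differentiable_bilin.
split; first by rewrite E; exact: differentiable_comp.
rewrite E diff_comp // diff_bilin // diff_pair //.
by apply/funext => v /=; rewrite addrC.
Qed.

Lemma derive_scale V W (k : V -> R^o) (f : V -> W) x v :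
  differentiable k x -> differentiable f x ->
  'D_v (fun y => k y *: f y) x = 'D_v k x *: f x + k x *: 'D_v f x.
Proof.
by move=> dk df; have [d e] := differentiable_scale_fun dk df; rewrite !deriveE// e.
Qed.

Lemma differentiable_scale V W (k : V -> R^o) (f : V -> W) x :
  differentiable k x -> differentiable f x ->
  differentiable (fun y => k y *: f y) x.
Proof. by move=> dk df; have [] := differentiable_scale_fun dk df. Qed.

Lemma differentiable_add V W (f g : V -> W) x :
  differentiable f x -> differentiable g x -> differentiable (fun y => f y + g y) x.
Proof. by move=> df dg; exact: differentiableD. Qed.

Lemma derive_add V W (f g : V -> W) x v :
  differentiable f x -> differentiable g x ->
  'D_v (fun y => f y + g y) x = 'D_v f x + 'D_v g x.
Proof. by move=> df dg; apply: deriveD; exact: diff_derivable. Qed.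

Lemma differentiable_bigsum V W (I : Type) (s : seq I) (f : I -> V -> W) x :
  (forall i, differentiable (f i) x) -> differentiable (fun y => \sum_(i <- s) f i y) x.
Proof.
move=> df; elim: s => [|i s IH].
  by under eq_fun do rewrite big_nil; exact: differentiable_cst.
by under eq_fun do rewrite big_cons; exact: differentiable_add.
Qed.

Lemma derive_bigsum V W (I : Type) (s : seq I) (f : I -> V -> W) x v :
  (forall i, differentiable (f i) x) ->
  'D_v (fun y => \sum_(i <- s) f i y) x = \sum_(i <- s) 'D_v (f i) x.
Proof.
move=> df; elim: s => [|i s IH].
  by under eq_fun do rewrite big_nil; rewrite big_nil derive_cst.
under eq_fun do rewrite big_cons; rewrite derive_add ?big_cons ?IH//.
exact: differentiable_bigsum.
Qed.

Lemma derive_linear V W (f : {linear V -> W}) x v : continuous f -> 'D_v f x = f v.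
Proof.
by move=> cf; rewrite deriveE ?diff_lin//; exact: linear_differentiable.
Qed.

Lemma derive_linear_comp U V W (l : {linear V -> W}) (f : U -> V) x v : continuous l ->
  differentiable f x -> 'D_v (fun y => l (f y)) x = l ('D_v f x).
Proof.
move=> cl df; rewrite derive_comp//; first by rewrite derive_linear.
exact: linear_differentiable.
Qed.

Lemma Ck_sub V W k (A B : set V) (f : V -> W) : B `<=` A -> Ck_on k A f -> Ck_on k B f.
Proof.
elim: k f => [|k IH] f BA /=; first by move=> fA x /BA /fA.
by move=> [fA fk]; split=> [x /BA /fA //|v]; apply: IH.
Qed.

Lemma Ck_local V W k (A : set V) (f : V -> W) :
  (forall x, A x -> exists B, [/\ open B, B x & Ck_on k B f]) -> Ck_on k A f.
Proof.
elim: k f => [|k IH] f H /=; first by move=> x /H[B [_ Bx]]; exact.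
split=> [x /H[B [_ Bx [+ _]]]|v]; first exact.
by apply: IH => x /H[B [oB Bx [_ HB]]]; exists B; split => //; exact: HB.
Qed.

Lemma Ck_eq V W k (A : set V) (f g : V -> W) : open A ->
  (forall x, A x -> f x = g x) -> Ck_on k A f -> Ck_on k A g.
Proof.
move=> oA; elim: k f g => [|k IH] f g fg /=.
  move=> fc x Ax; have E := open_near_eq oA fg Ax.
  have H : f @ x --> f x by exact: fc.
  rewrite /prop_for /continuous_at -(fg x Ax).
  by apply: cvg_trans H; apply: near_eq_cvg; apply: filterS E => y ->.
move=> [df fk]; split=> [x Ax|v].
  by apply: near_eq_differentiable (df _ Ax); exact: open_near_eq Ax.
apply: IH (fk v) => x Ax; apply: near_eq_derive.
exact: open_near_eq Ax.
Qed.

Lemma Ck_pred V W k (A : set V) (f : V -> W) : Ck_on k.+1 A f -> Ck_on k A f.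
Proof.
elim: k f => [|k IH] f.
  by move=> [df _] x Ax; exact/differentiable_continuous/df.
by move=> [df fk]; split => // v; apply: IH.
Qed.

Lemma Ck_const V W k (A : set V) (w : W) : Ck_on k A (fun _ => w).
Proof.
elim: k w => [|k IH] w /=; first by move=> x _; exact: cvg_cst.
split=> [x _|v]; first exact: differentiable_cst.
by under eq_fun do rewrite derive_cst.
Qed.

Lemma Ck_linear V W k (A : set V) (f : {linear V -> W}) : continuous f -> Ck_on k A f.
Proof.
move=> cf; case: k => [|k]; first by move=> x _; exact: cf.
split=> [x _|v]; first exact: linear_differentiable.
under eq_fun do rewrite derive_linear//.
exact: Ck_const.
Qed.

Lemma Ck_add V W k (A : set V) (f g : V -> W) : open A ->
  Ck_on k A f -> Ck_on k A g -> Ck_on k A (fun x => f x + g x).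
Proof.
move=> oA; elim: k f g => [|k IH] f g.
  by move=> fA gA x Ax; apply: cvgD; [exact: fA|exact: gA].
move=> [df fk] [dg gk]; split=> [x Ax|v].
  by apply: differentiable_add; [exact: df|exact: dg].
apply: Ck_eq (IH _ _ (fk v) (gk v)) => // x Ax.
by rewrite derive_add//; [exact: df|exact: dg].
Qed.

Lemma Ck_scale V W k (A : set V) (f : V -> R^o) (g : V -> W) : open A ->
  Ck_on k A f -> Ck_on k A g -> Ck_on k A (fun x => f x *: g x).
Proof.
move=> oA; elim: k f g => [|k IH] f g fA gA.
  by move=> x Ax; apply: cvgZ; [exact: fA|exact: gA].
have f1 := Ck_pred fA; have g1 := Ck_pred gA.
case: fA => [df fk]; case: gA => [dg gk]; split=> [x Ax|v].
  by apply: differentiable_scale; [exact: df|exact: dg].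
apply: Ck_eq (Ck_add oA (IH _ _ (fk v) g1) (IH _ _ f1 (gk v))) => // x Ax.
by rewrite derive_scale//; [exact: df|exact: dg].
Qed.

Lemma Ck_bigsum V W k (A : set V) (I : Type) (s : seq I) (f : I -> V -> W) : open A ->
  (forall i, Ck_on k A (f i)) -> Ck_on k A (fun x => \sum_(i <- s) f i x).
Proof.
move=> oA H; elim: s => [|i s IH].
  by under eq_fun do rewrite big_nil; exact: Ck_const.
by under eq_fun do rewrite big_cons; exact: Ck_add.
Qed.

Lemma Ck_linear_comp U V W k (A : set U) (l : {linear V -> W}) (f : U -> V) : open A ->
  continuous l -> Ck_on k A f -> Ck_on k A (fun x => l (f x)).
Proof.
move=> oA cl; elim: k f => [|k IH] f.
  move=> fA x Ax; apply: (@continuous_comp _ _ _ f l); first exact: fA.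
  exact: cl.
move=> [df fk]; split=> [x Ax|v].
  apply: (@differentiable_comp _ _ _ _ f l); first exact: df.
  exact: linear_differentiable.
apply: Ck_eq (IH _ (fk v)) => // x Ax.
by rewrite derive_linear_comp//; exact: df.
Qed.

Lemma derive_linear_dir V W (f : V -> W) x : differentiable f x -> 
  linear (fun v => 'D_v f x).
Proof. by move=> df a u v; rewrite !deriveE// linearP. Qed.

Lemma derive_frame (V W : normedModType R) (F : frame V) (f : V -> W) x v : differentiable f x ->
  'D_v f x = \sum_i frame_coef F i v *: 'D_(frame_vec F i) f x.
Proof.
move=> df; rewrite deriveE// {1}(frameE F v) linear_sum.
by apply: eq_bigr => i _; rewrite linearZ deriveE.
Qed.

(** Over a frame, the derivative of [f \o g] along [v] is the sum of the
    derivatives of [f] along the frame vectors, taken at [g x], with coefficients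
    those of the derivative of [g]; the induction on the order applies to each
    factor. *)
Lemma Ck_comp U V W k (F : frame V) (A : set U) (B : set V) (f : V -> W) (g : U -> V) :
  open A -> (forall x, A x -> B (g x)) -> Ck_on k B f -> Ck_on k A g ->
  Ck_on k A (fun x => f (g x)).
Proof.
move=> oA AB; elim: k f g AB => [|k IH] f g AB fB gA.
  by move=> x Ax; apply: (@continuous_comp _ _ _ g f); [exact: gA|exact/fB/AB].
have f1 := Ck_pred fB; have g1 := Ck_pred gA.
case: fB => [df fk]; case: gA => [dg gk]; split=> [x Ax|v].
  by apply: (@differentiable_comp _ _ _ _ g f); [exact: dg|exact/df/AB].
have H : Ck_on k A (fun x => \sum_i frame_coef F i ('D_v g x) *: 'D_(frame_vec F i) f (g x)).
  apply: Ck_bigsum => // i; apply: Ck_scale => //.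
    exact: (Ck_linear_comp oA (frame_continuous F i) (gk v)).
  exact: IH AB (fk _) g1.
apply: Ck_eq H => // x Ax; rewrite (derive_comp _ (dg _ Ax) (df _ (AB _ Ax))).
by rewrite -derive_frame//; exact/df/AB.
Qed.

Lemma smooth_on_sub V W (A B : set V) (f : V -> W) :
  B `<=` A -> smooth_on A f -> smooth_on B f.
Proof. by move=> BA fA k; exact: Ck_sub (fA k). Qed.

Lemma smooth_on_local V W (A : set V) (f : V -> W) :
  (forall x, A x -> smooth_near x f) -> smooth_on A f.
Proof.
by move=> H k; apply: Ck_local => x /H[B [oB Bx fB]]; exists B; split.
Qed.

Lemma smooth_on_eq V W (A : set V) (f g : V -> W) : open A ->
  (forall x, A x -> f x = g x) -> smooth_on A f -> smooth_on A g.
Proof. by move=> oA fg fA k; exact: Ck_eq (fA k). Qed.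

Lemma smooth_on_differentiable V W (A : set V) (f : V -> W) x :
  smooth_on A f -> A x -> differentiable f x.
Proof. by move=> /(_ 1%N) [+ _]; exact. Qed.

Lemma smooth_on_continuous V W (A : set V) (f : V -> W) x :
  smooth_on A f -> A x -> f y @[y --> x] --> f x.
Proof. by move=> /(_ 0%N) fA Ax; exact: fA. Qed.

Lemma smooth_on_derive V W (A : set V) (f : V -> W) v :
  smooth_on A f -> smooth_on A (fun x => 'D_v f x).
Proof. by move=> fA k; have [_ fk] := fA k.+1; exact: fk. Qed.

Lemma smooth_on_const V W (A : set V) (w : W) : smooth_on A (fun _ => w).
Proof. by move=> k; exact: Ck_const. Qed.

Lemma smooth_on_linear V W (A : set V) (f : {linear V -> W}) :
  continuous f -> smooth_on A f.
Proof. by move=> cf k; exact: Ck_linear. Qed.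

Lemma smooth_on_add V W (A : set V) (f g : V -> W) : open A ->
  smooth_on A f -> smooth_on A g -> smooth_on A (fun x => f x + g x).
Proof. by move=> oA fA gA k; exact: Ck_add. Qed.

Lemma smooth_on_scale V W (A : set V) (f : V -> R^o) (g : V -> W) : open A ->
  smooth_on A f -> smooth_on A g -> smooth_on A (fun x => f x *: g x).
Proof. by move=> oA fA gA k; exact: Ck_scale. Qed.

Lemma smooth_on_opp V W (A : set V) (f : V -> W) : open A ->
  smooth_on A f -> smooth_on A (fun x => - f x).
Proof.
move=> oA fA; under eq_fun do rewrite -scaleN1r.
by apply: (smooth_on_scale oA _ fA); exact: smooth_on_const.
Qed.

Lemma smooth_on_bigsum V W (A : set V) (I : Type) (s : seq I) (f : I -> V -> W) : open A ->
  (forall i, smooth_on A (f i)) -> smooth_on A (fun x => \sum_(i <- s) f i x).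
Proof. by move=> oA H k; apply: Ck_bigsum => // i; exact: H. Qed.

Lemma smooth_on_bigprod V (A : set V) (I : Type) (s : seq I) (f : I -> V -> R^o) : open A ->
  (forall i, smooth_on A (f i)) -> smooth_on A (fun x => \prod_(i <- s) f i x : R^o).
Proof.
move=> oA H; elim: s => [|i s IH].
  by under eq_fun do rewrite big_nil; exact: smooth_on_const.
by under eq_fun do rewrite big_cons; exact: smooth_on_scale.
Qed.

Lemma smooth_on_linear_comp U V W (A : set U) (l : {linear V -> W}) (f : U -> V) :
  open A -> continuous l -> smooth_on A f -> smooth_on A (fun x => l (f x)).
Proof. by move=> oA cl fA k; exact: Ck_linear_comp. Qed.

Lemma smooth_on_comp U V W (F : frame V) (A : set U) (B : set V) (f : V -> W) (g : U -> V) :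
  open A -> (forall x, A x -> B (g x)) -> smooth_on B f -> smooth_on A g ->
  smooth_on A (fun x => f (g x)).
Proof. by move=> oA AB fB gA k; apply: Ck_comp (fB k) (gA k). Qed.

(** The derivative of [1 / f] is a product of powers of [1 / f] and of the
    derivative of [f], so the induction on the order closes on itself. *)
Lemma smooth_on_inv V (A : set V) (f : V -> R^o) : open A ->
  (forall x, A x -> f x != 0) -> smooth_on A f -> smooth_on A (fun x => (f x)^-1 : R^o).
Proof.
move=> oA f0 fA; elim => [|k IH].
  move=> x Ax; apply: (@cvgV _ _ _ _ f); first exact: f0.
  by have := fA 0%N; exact.
have df x : A x -> differentiable f x by exact: smooth_on_differentiable.
split=> [x Ax|v].
  by apply: (@differentiableV _ _ f); [exact: df|exact: f0].
have H : Ck_on k A (fun x => (- ((f x)^-1 * (f x)^-1)) *: ('D_v f x : R^o)).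
  apply: Ck_scale => //; last exact: smooth_on_derive.
  under eq_fun do rewrite -scaleN1r.
  by apply: Ck_scale => //; [exact: Ck_const|exact: Ck_scale].
apply: Ck_eq H => // x Ax; rewrite (deriveV (f0 _ Ax)).
  by rewrite -exprVn expr2.
exact/diff_derivable/df.
Qed.

Lemma smooth_on_coef V W (F : frame W) (A : set V) (f : V -> W) : open A ->
  (forall i, smooth_on A (fun x => frame_coef F i (f x))) -> smooth_on A f.
Proof.
move=> oA H; apply: (@smooth_on_eq _ _ _
    (fun x => \sum_i frame_coef F i (f x) *: frame_vec F i)) => //.
  by move=> x _; rewrite -frameE.
apply: smooth_on_bigsum => // i; apply: smooth_on_scale => //.
exact: smooth_on_const.
Qed.

(** Chain rules, changes of charts and Christoffel terms all have this shape: a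
    linear map depending smoothly on the point, applied to a moving vector. *)
Lemma smooth_on_eval U V W (F : frame V) (A : set U) (l : U -> V -> W) (f : U -> V) :
  open A -> (forall x, A x -> linear (l x)) -> (forall v, smooth_on A (l ^~ v)) ->
  smooth_on A f -> smooth_on A (fun x => l x (f x)).
Proof.
move=> oA ll lA fA.
apply: (@smooth_on_eq _ _ _ (fun x => \sum_i frame_coef F i (f x) *: l x (frame_vec F i))) => //.
  move=> x Ax; pose h : {linear V -> W} := HB.pack (l x) (GRing.isLinear.Build _ _ _ _ _ (ll x Ax)).
  rewrite {2}(frameE F (f x)) -[l x]/(h : _ -> _) linear_sum.
  by apply: eq_bigr => i _; rewrite linearZ.
apply: smooth_on_bigsum => // i; apply: smooth_on_scale => //.
exact: smooth_on_linear_comp oA (@frame_continuous _ _ F i) fA.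
Qed.

Lemma derive_eval_pair U V W (F : frame V) (l : U -> V -> W) (f : U -> V) x v :
  (\near x, linear (l x)) -> (forall w, differentiable (l ^~ w) x) -> differentiable f x ->
  differentiable (fun x => l x (f x)) x /\
  'D_v (fun x => l x (f x)) x = 'D_v (l ^~ (f x)) x + l x ('D_v f x).
Proof.
move=> ll dl df.
pose h y := \sum_i frame_coef F i (f y) *: l y (frame_vec F i).
have lE y : linear (l y) -> forall w, l y w = \sum_i frame_coef F i w *: l y (frame_vec F i).
  move=> ly w; pose g : {linear V -> W} := HB.pack (l y) (GRing.isLinear.Build _ _ _ _ _ ly).
  rewrite {1}(frameE F w) -[l y]/(g : _ -> _) linear_sum.
  by apply: eq_bigr => i _; rewrite linearZ.
have E : \near x, h x = l x (f x) by apply: filterS ll => y ly; rewrite (lE _ ly).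
have dc i : differentiable (fun y => frame_coef F i (f y)) x.
  apply: (@differentiable_comp _ _ _ _ f); first by [].
  by apply: linear_differentiable; exact: frame_continuous.
have dt i : differentiable (fun y => frame_coef F i (f y) *: l y (frame_vec F i)) x.
  by apply: differentiable_scale; [exact: dc|exact: dl].
have dh : differentiable h x by apply: differentiable_bigsum.
split; first exact: near_eq_differentiable E dh.
rewrite -(near_eq_derive _ E) /h derive_bigsum//.
under eq_bigr => i _ do rewrite derive_scale//.
rewrite big_split /= addrC; congr (_ + _); last first.
  rewrite [RHS]lE; last exact: nbhs_singleton ll.
  by apply: eq_bigr => i _; rewrite derive_linear_comp//; exact: frame_continuous.
pose h2 y := \sum_i frame_coef F i (f x) *: l y (frame_vec F i).
have E2 : \forall y \near x, h2 y = l y (f x).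
  by apply: filterS ll => y ly; rewrite (lE _ ly).
rewrite -(near_eq_derive _ E2) /h2 derive_bigsum//; last first.
  by move=> i; apply: differentiable_scale => //; exact: differentiable_cst.
apply: eq_bigr => i _.
rewrite (derive_scale _ (@differentiable_cst _ _ _ (frame_coef F i (f x) : R^o) x) (dl _)).
by rewrite derive_cst scale0r add0r.
Qed.

Lemma differentiable_eval U V W (F : frame V) (l : U -> V -> W) (f : U -> V) x :
  (\near x, linear (l x)) -> (forall w, differentiable (l ^~ w) x) -> differentiable f x ->
  differentiable (fun x => l x (f x)) x.
Proof. by move=> ll dl df; have [] := derive_eval_pair F 0 ll dl df. Qed.

Lemma derive_eval U V W (F : frame V) (l : U -> V -> W) (f : U -> V) x v :
  (\near x, linear (l x)) -> (forall w, differentiable (l ^~ w) x) -> differentiable f x ->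
  'D_v (fun x => l x (f x)) x = 'D_v (l ^~ (f x)) x + l x ('D_v f x).
Proof. by move=> ll dl df; have [] := derive_eval_pair F v ll dl df. Qed.

Lemma derive_pair U V W (f : U -> V) (g : U -> W) x v :
  differentiable f x -> differentiable g x ->
  'D_v (fun y => (f y, g y)) x = ('D_v f x, 'D_v g x).
Proof.
by move=> df dg; rewrite !deriveE// ?diff_pair//; exact: differentiable_pair.
Qed.

Lemma smooth_on_pair U V W (A : set U) (f : U -> V) (g : U -> W) : open A ->
  smooth_on A f -> smooth_on A g -> smooth_on A (fun x => (f x, g x)).
Proof.
move=> oA + + k; elim: k f g => [|k IH] f g fA gA.
  by move=> x Ax; apply: cvg_pair; exact: smooth_on_continuous Ax.
have df x : A x -> differentiable f x by exact: smooth_on_differentiable.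
have dg x : A x -> differentiable g x by exact: smooth_on_differentiable.
split=> [x Ax|v].
  by apply: differentiable_pair; [exact: df|exact: dg].
apply: Ck_eq (IH _ _ (smooth_on_derive v fA) (smooth_on_derive v gA)) => // x Ax.
by rewrite (derive_pair _ (df _ Ax) (dg _ Ax)).
Qed.

Lemma fst_linear_continuous V W : continuous (fst : {linear (V * W)%type -> V}).
Proof. by move=> x; exact: cvg_fst. Qed.

Lemma snd_linear_continuous V W : continuous (snd : {linear (V * W)%type -> W}).
Proof. by move=> x; exact: cvg_snd. Qed.

Lemma smooth_on_fst U V W (A : set U) (f : U -> V * W) : open A ->
  smooth_on A f -> smooth_on A (fun x => (f x).1).
Proof. by move=> oA fA; exact: smooth_on_linear_comp oA (@fst_linear_continuous V W) fA. Qed.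

Definition coord_linear n (i : 'I_n) (v : 'rV[R]_n) : R^o := v 0 i.

Lemma coord_linear_is_linear n (i : 'I_n) : linear (coord_linear i).
Proof. by move=> a u v; rewrite /coord_linear !mxE. Qed.

HB.instance Definition _ n (i : 'I_n) :=
  GRing.isLinear.Build R 'rV[R]_n R^o _ (coord_linear i) (coord_linear_is_linear i).

Lemma coord_linear_continuous n (i : 'I_n) : continuous (coord_linear i).
Proof. exact: coord_continuous. Qed.

Definition frame_rV n : frame 'rV[R]_n.
Proof.
apply: (@Frame _ _ _ (fun i : 'I_n => delta_mx 0 i) (fun i => coord_linear i)).
  by move=> i; exact: coord_linear_continuous.
by move=> w; exact: row_sum_delta.
Defined.

Definition pair_coef V W (F : frame V) (G : frame W) (i : frame_index F + frame_index G)
  (p : V * W) : R^o :=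
  match i with inl i => frame_coef F i p.1 | inr j => frame_coef G j p.2 end.

Lemma pair_coef_is_linear V W (F : frame V) (G : frame W) i : linear (@pair_coef V W F G i).
Proof. by case: i => i a u v /=; exact: linearP. Qed.

HB.instance Definition _ V W (F : frame V) (G : frame W) i :=
  GRing.isLinear.Build R (V * W)%type R^o _ (@pair_coef V W F G i) (@pair_coef_is_linear V W F G i).

Definition frame_pair V W (F : frame V) (G : frame W) : frame (V * W)%type.
Proof.
apply: (@Frame _ _ _ (fun i : frame_index F + frame_index G =>
  match i with inl i => (frame_vec F i, 0) | inr j => (0, frame_vec G j) end)
  (fun i => pair_coef i)).
  case=> i x /=.
    apply: (@continuous_comp _ _ _ fst (frame_coef F i)); first exact: cvg_fst.
    exact: frame_continuous.
  apply: (@continuous_comp _ _ _ snd (frame_coef G i)); first exact: cvg_snd.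
  exact: frame_continuous.
move=> [v w]; rewrite big_sumType /=.
rewrite {1}(frameE F v) {1}(frameE G w).
apply/eqP; rewrite xpair_eqE; apply/andP; split; apply/eqP.
  rewrite [RHS](raddfD fst) !raddf_sum /= [X in _ + X]big1 ?addr0//.
  by move=> i _; rewrite scaler0.
rewrite [RHS](raddfD snd) !raddf_sum /= [X in X + _]big1 ?add0r//.
by move=> i _; rewrite scaler0.
Defined.

Lemma is_derive_line V (f : V -> R^o) (x v : V) (s : R) :
  differentiable f (x + s *: v) ->
  is_derive s 1 (fun t : R => f (x + t *: v)) ('D_v f (x + s *: v)).
Proof.
move=> df.
have dl : differentiable (fun t : R^o => x + t *: v) s.
  apply: differentiable_add; first exact: differentiable_cst.
  by apply: differentiable_scale; [exact: differentiable_id|exact: differentiable_cst].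
have dfl : differentiable (fun t : R^o => f (x + t *: v)) s.
  exact: (@differentiable_comp _ _ _ _ (fun t : R^o => x + t *: v) f).
apply: DeriveDef; first exact: diff_derivable.
rewrite (derive_comp _ dl df); congr ('D__ f _).
have dc : differentiable (fun _ : R^o => x) s by exact: differentiable_cst.
have dv : differentiable (fun _ : R^o => v) s by exact: differentiable_cst.
have di := @differentiable_id R^o s.
rewrite (derive_add _ dc (differentiable_scale di dv)) derive_cst add0r.
by rewrite (derive_scale _ di dv) derive_cst scaler0 addr0 derive_id scale1r.
Qed.

Lemma mean_value_on_segment (F F' : R -> R) (h : R) : 0 < h ->
  (forall s : R, 0 <= s <= h -> is_derive s 1 F (F' s)) ->
  exists2 s : R, 0 <= s <= h & F h - F 0 = F' s * h.
Proof.
move=> h0 dF.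
have H1 : forall s : R, s \in `]0, h[ -> is_derive s 1 F (F' s).
  by move=> s /subset_itv_oo_cc; rewrite in_itv /= => sh; exact: dF.
have H2 : {within `[0, h], continuous F}.
  apply: derivable_within_continuous => s; rewrite in_itv /= => sh.
  by have [] := dF s sh.
have [s + Fs] := @MVT R F F' 0 h h0 H1 H2.
rewrite in_itv /= => /andP[s0 sh]; exists s; first by rewrite !ltW.
by rewrite Fs subr0.
Qed.

(** The mean value theorem in the direction [v], then in the direction [w], turns
    a second difference into a mixed second derivative at an intermediate point. *)
Lemma second_difference_mvt V (A : set V) (f : V -> R^o) (x v w : V) (h : R) :
  smooth_on A f -> 0 < h ->
  (forall s t : R, 0 <= s <= h -> 0 <= t <= h -> A (x + s *: v + t *: w)) ->
  exists s t : R, [/\ 0 <= s <= h, 0 <= t <= h &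
    f (x + h *: v + h *: w) - f (x + h *: w) - (f (x + h *: v) - f x) =
    'D_w (fun y => 'D_v f y) (x + s *: v + t *: w) * h * h].
Proof.
move=> fA h0 hA.
have hh : 0 <= h <= h by rewrite lexx ltW.
have h00 : 0 <= (0 : R) <= h by rewrite lexx ltW.
pose F (s : R) : R := f (x + h *: w + s *: v) - f (x + s *: v).
pose F' (s : R) : R := 'D_v f (x + h *: w + s *: v) - 'D_v f (x + s *: v).
have dF (s : R) : 0 <= s <= h -> is_derive (s : R^o) 1 (F : R^o -> R^o) (F' s).
  move=> sh; apply: is_deriveB; apply: is_derive_line.
    by apply: smooth_on_differentiable fA _; rewrite addrAC; exact: hA.
  by apply: smooth_on_differentiable fA _; rewrite -[X in A X]addr0 -(scale0r w); exact: hA.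
have [s sh Fs] := @mean_value_on_segment F F' h h0 dF.
pose G (t : R) : R := 'D_v f (x + s *: v + t *: w).
pose G' (t : R) : R := 'D_w (fun y => 'D_v f y) (x + s *: v + t *: w).
have dG (t : R) : 0 <= t <= h -> is_derive (t : R^o) 1 (G : R^o -> R^o) (G' t).
  move=> th; apply: (@is_derive_line _ (fun y => 'D_v f y : R^o)).
  by apply: smooth_on_differentiable (smooth_on_derive v fA) _; exact: hA.
have [t th Gt] := @mean_value_on_segment G G' h h0 dG.
exists s, t; split => //.
move: Fs Gt; rewrite /F /G /F' /G' !scale0r !addr0 => Fs Gt.
rewrite -Gt (addrAC x (s *: v)) -Fs (addrAC x (h *: v)).
by rewrite !opprB !addrA; lra.
Qed.

Lemma near_continuous_pair V (A : set V) (p q : V -> R) (x : V) (e : R) :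
  open A -> A x -> (p : V -> R^o) y @[y --> x] --> (p x : R^o) ->
  (q : V -> R^o) y @[y --> x] --> (q x : R^o) -> 0 < e ->
  exists2 r : R, 0 < r & forall y, `|x - y| < r ->
    [/\ A y, `|p x - p y| < e & `|q x - q y| < e].
Proof.
move=> oA Ax cp cq e0.
have /cvgrPdist_lt /(_ _ e0) np := cp.
have /cvgrPdist_lt /(_ _ e0) nq := cq.
have nA : \forall y \near x, A y by exact: open_nbhs_nbhs.
have /nbhs_ballP[r r0 rB] : \forall y \near x,
    [/\ A y, `|p x - p y| < e & `|q x - q y| < e].
  by apply: filterS3 nA np nq => y Ay py qy; split.
by exists r => // y xy; apply: rB; rewrite -ball_normE.
Qed.

(** Schwarz: a second difference is symmetric in its two increments, so the two
    mixed derivatives agree at two points of a small parallelogram, and both are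
    continuous. *)
Lemma derive_swap_scalar V (A : set V) (f : V -> R^o) (x v w : V) :
  open A -> smooth_on A f -> A x ->
  'D_w (fun y => 'D_v f y) x = 'D_v (fun y => 'D_w f y) x.
Proof.
move=> oA fA Ax.
pose p (y : V) : R := 'D_w (fun y => 'D_v f y) y.
pose q (y : V) : R := 'D_v (fun y => 'D_w f y) y.
have cp : (p : V -> R^o) y @[y --> x] --> (p x : R^o).
  exact: smooth_on_continuous (smooth_on_derive w (smooth_on_derive v fA)) Ax.
have cq : (q : V -> R^o) y @[y --> x] --> (q x : R^o).
  exact: smooth_on_continuous (smooth_on_derive v (smooth_on_derive w fA)) Ax.
apply/eqP; rewrite -subr_eq0 -normr_le0; apply/ler_addgt0Pl => e e0; rewrite addr0.
have e2 : 0 < e / 2 by rewrite divr_gt0.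
have [r r0 rB] := near_continuous_pair oA Ax cp cq e2.
(* small enough for the parallelogram with sides h v and h w to stay in the ball *)
pose h := r / 2 / (`|v| + `|w| + 1).
have K0 : 0 < `|v| + `|w| + 1 by rewrite ltr_wpDl// addr_ge0.
have h0 : 0 < h by rewrite !divr_gt0.
have hB s t a b : 0 <= s <= h -> 0 <= t <= h -> (a = v /\ b = w) \/ (a = w /\ b = v) ->
    `|x - (x + s *: a + t *: b)| < r.
  move=> /andP[s0 sh] /andP[t0 th] ab; rewrite -addrA opprD addrA subrr add0r normrN.
  apply: (@le_lt_trans _ _ (h * (`|v| + `|w| + 1))); last first.
    by rewrite /h divfK ?gt_eqF// ltr_pdivrMr// ltr_pMr// ltr1n.
  apply: le_trans (ler_normD _ _) _; rewrite !normrZ !ger0_norm//.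
  have H1 c : 0 <= c -> s * c <= h * c by move=> c0; exact: ler_wpM2r.
  have H2 c : 0 <= c -> t * c <= h * c by move=> c0; exact: ler_wpM2r.
  have := H1 _ (normr_ge0 v); have := H1 _ (normr_ge0 w).
  have := H2 _ (normr_ge0 v); have := H2 _ (normr_ge0 w).
  by case: ab => [[-> ->]|[-> ->]]; lra.
have [|s [t [sh th E1]]] := @second_difference_mvt V A f x v w h fA h0.
  by move=> s t sh th; have [] := rB _ (hB s t v w sh th (or_introl (conj erefl erefl))).
have [|s' [t' [sh' th' E2]]] := @second_difference_mvt V A f x w v h fA h0.
  by move=> s' t' sh' th'; have [] := rB _ (hB s' t' w v sh' th' (or_intror (conj erefl erefl))).
have [_ H1 _] := rB _ (hB s t v w sh th (or_introl (conj erefl erefl))).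
have [_ _ H2] := rB _ (hB s' t' w v sh' th' (or_intror (conj erefl erefl))).
have tri (a b c : R) : `|a - b| < e / 2 -> `|c - b| < e / 2 -> `|a - c| <= e.
  move=> ab cb; rewrite (splitr e) -(subrK b a) -addrA.
  by apply: le_trans (ler_normD _ _) _; rewrite lerD ?ltW// distrC.
have subCA (a b c d : R) : a - b - (c - d) = a - c - (b - d) by clear; ring.
have pq : p (x + s *: v + t *: w) = q (x + s' *: w + t' *: v).
  apply: (@mulIf _ h); first by rewrite gt_eqF.
  apply: (@mulIf _ h); first by rewrite gt_eqF.
  rewrite -[LHS]E1 -[RHS]E2 (addrAC x (h *: w)).
  exact: subCA.
rewrite -pq in H2; exact: tri H1 H2.
Qed.

Lemma smooth_near_eq U W x (f g : U -> W) :
  (\forall y \near x, f y = g y) -> smooth_near x f -> smooth_near x g.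
Proof.
move=> fg [A [oA Ax sA]]; pose B := interior [set y | f y = g y].
have oB : open B by exact: open_interior.
have Bx : B x by [].
have BE y : B y -> f y = g y by move=> /interior_subset.
have oAB := openI oA oB.
exists (A `&` B); split => //.
apply: (smooth_on_eq oAB (fun y ABy => BE y ABy.2)).
by apply: smooth_on_sub sA => y [].
Qed.

Lemma smooth_near_eval U W W' (F : frame W)
    (A : set U) (l : U -> W -> W') (f : U -> W) x :
  open A -> A x -> (forall y, A y -> linear (l y)) -> (forall v, smooth_on A (l ^~ v)) ->
  smooth_near x f -> smooth_near x (fun y => l y (f y)).
Proof.
move=> oA Ax ll lA [B [oB Bx sB]]; exists (A `&` B); split => //; first exact: openI.
apply: (smooth_on_eval F (openI oA oB)) => [y [Ay _]|v|]; first exact: ll.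
  by apply: smooth_on_sub (lA v) => y [].
by apply: smooth_on_sub sB => y [].
Qed.

Lemma smooth_near_const U W (x : U) (a : W) : smooth_near x (fun _ => a).
Proof. by exists setT; split => //; [exact: openT|exact: smooth_on_const]. Qed.

Lemma smooth_near_differentiable U W (x : U) (f : U -> W) :
  smooth_near x f -> differentiable f x.
Proof. by move=> [A [oA Ax sA]]; exact: smooth_on_differentiable sA Ax. Qed.

Lemma smooth_near_add U W (x : U) (f g : U -> W) :
  smooth_near x f -> smooth_near x g -> smooth_near x (fun y => f y + g y).
Proof.
move=> [A [oA Ax sA]] [B [oB Bx sB]]; have oAB := openI oA oB.
exists (A `&` B); split => //; apply: smooth_on_add => //.
  by apply: smooth_on_sub sA => y [].
by apply: smooth_on_sub sB => y [].
Qed.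

Lemma smooth_near_scale U W (x : U) (f : U -> R^o) (g : U -> W) :
  smooth_near x f -> smooth_near x g -> smooth_near x (fun y => f y *: g y).
Proof.
move=> [A [oA Ax sA]] [B [oB Bx sB]]; have oAB := openI oA oB.
exists (A `&` B); split => //; apply: smooth_on_scale => //.
  by apply: smooth_on_sub sA => y [].
by apply: smooth_on_sub sB => y [].
Qed.

Lemma d_fst U W W' (f : U -> W * W') (g : U -> W) x v :
  differentiable f x -> (\forall y \near x, (f y).1 = g y) -> ('d f x v).1 = 'd g x v.
Proof.
move=> df fg.
have d1 : differentiable (fun y => (f y).1) x.
  apply: (@differentiable_comp _ _ _ _ f (fst : W * W' -> W)) => //.
  by apply: linear_differentiable; exact: fst_linear_continuous.
rewrite (near_eq_d fg d1) -!deriveE//.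
by rewrite (derive_linear_comp _ (@fst_linear_continuous W W') df).
Qed.

End Calculus.

Lemma derive_dirZ (R : realType) (V W : normedModType R) (f : V -> W) x k v :
  differentiable f x -> 'D_(k *: v) f x = k *: 'D_v f x.
Proof. by move=> df; rewrite !deriveE// linearZ. Qed.

Lemma derive_dirD (R : realType) (V W : normedModType R) (f : V -> W) x v w :
  differentiable f x -> 'D_(v + w) f x = 'D_v f x + 'D_w f x.
Proof. by move=> df; rewrite !deriveE// linearD. Qed.

Lemma derive_constZ (R : realType) (V W : normedModType R) (f : V -> W) x v (k : R) :
  differentiable f x -> 'D_v (fun y => k *: f y) x = k *: 'D_v f x.
Proof. by move=> df; apply: deriveZ; exact: diff_derivable. Qed.

Lemma smooth_on_mul (R : realType) (V : normedModType R) (A : set V) (f g : V -> R) :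
  open A -> smooth_on A (f : V -> R^o) -> smooth_on A (g : V -> R^o) ->
  smooth_on A (fun x => f x * g x : R^o).
Proof. exact: smooth_on_scale. Qed.

Lemma open_eq_derive (R : realType) (V W : normedModType R) (A : set V)
    (f g : V -> W) (x v : V) :
  open A -> A x -> (forall y, A y -> f y = g y) -> 'D_v f x = 'D_v g x.
Proof.
by move=> oA Ax fg; apply: near_eq_derive; exact: open_near_eq fg _ Ax.
Qed.

Lemma derive_inv (R : realType) (V : normedModType R) (f : V -> R^o) (x v : V) :
  f x != 0 -> differentiable f x ->
  'D_v (fun y => (f y)^-1 : R^o) x = - (('D_v f x : R) / (f x : R) ^+ 2).
Proof.
move=> fx df; rewrite (deriveV fx (diff_derivable (v := v) df)) scaleNr.
by rewrite -[_ *: _]/(_ * _) mulrC.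
Qed.

Lemma frame_ext (R : realType) (W : normedModType R) (F : frame W) (a b : W) :
  (forall i, frame_coef F i a = frame_coef F i b) -> a = b.
Proof.
by move=> H; rewrite (frameE F a) (frameE F b); apply: eq_bigr => i _; rewrite H.
Qed.

Lemma derive_swap (R : realType) (V W : normedModType R) (F : frame W)
    (A : set V) (f : V -> W) (x v w : V) :
  open A -> smooth_on A f -> A x ->
  'D_w (fun y => 'D_v f y) x = 'D_v (fun y => 'D_w f y) x.
Proof.
move=> oA fA Ax.
have co (g : V -> W) u i : smooth_on A g -> forall y, A y ->
    'D_u (fun y => frame_coef F i (g y)) y = frame_coef F i ('D_u g y).
  move=> gA y Ay; apply: derive_linear_comp; first exact: frame_continuous.
  exact: smooth_on_differentiable gA Ay.
have cu u : smooth_on A (fun y => 'D_u f y) by exact: smooth_on_derive.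
have E i u u' : frame_coef F i ('D_u' (fun y => 'D_u f y) x) =
    'D_u' (fun y => 'D_u (fun y => frame_coef F i (f y)) y) x.
  rewrite -(co _ u' i (cu u) x Ax); apply: near_eq_derive.
  by apply: (open_near_eq oA) Ax => y Ay; rewrite (co _ u i fA y Ay).
apply: (frame_ext (F := F)) => i; rewrite (E i v w) (E i w v).
apply: derive_swap_scalar Ax => //.
by apply: smooth_on_linear_comp fA => //; exact: frame_continuous.
Qed.

(** * Linear algebra of metric connections *)

Section Rigidity.
Context {R : realType} {V : lmodType R}.
Variables (g : V -> V -> R).
Hypothesis g_linear : forall a, linear (g a : V -> R^o).
Hypothesis g_sym : forall a b, g a b = g b a.
Hypothesis g_pos : forall a, a != 0 -> 0 < g a a.

Lemma formD a b c : g a (b + c) = g a b + g a c.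
Proof. by have := g_linear a 1 b c; rewrite !scale1r. Qed.

Lemma form0 a : g a 0 = 0.
Proof. by apply: (@addrI _ (g a 0)); rewrite -formD !addr0. Qed.

Lemma formZ k a b : g a (k *: b) = k * g a b.
Proof. by have := g_linear a k b 0; rewrite form0 !addr0. Qed.

Lemma formN a b : g a (- b) = - g a b.
Proof. by rewrite -scaleN1r formZ mulN1r. Qed.

Lemma formB a b c : g a (b - c) = g a b - g a c.
Proof. by rewrite formD formN. Qed.

Lemma form_nondegenerate a : (forall b, g b a = 0) -> a = 0.
Proof.
move=> H; apply/eqP; case: (eqVneq a 0) => // a0.
by have := g_pos a0; rewrite H ltxx.
Qed.

Lemma form_inj a b : (forall c, g c a = g c b) -> a = b.
Proof.
by move=> H; apply/subr0_eq/form_nondegenerate => c; rewrite formB H subrr.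
Qed.

(** The uniqueness of the Cartan connection, in the form of linear algebra: [B] is
    the difference of two metric connections along horizontal vectors, [C] the
    (h)hv-torsion and [y] the tangent vector at which one works.  The right-hand
    side of the torsion condition appears because the two connections do not have
    the same horizontal vectors: these differ by [B x y]. *)
Lemma cartan_rigidity (C B : V -> V -> V) (y : V) :
  (forall u v w, g w (C u v) = g w (C v u)) ->
  (forall u v w, g w (C u v) = g v (C u w)) ->
  (forall u, C u y = 0) ->
  (forall x a b, g b (B x a) = - g a (B x b)) ->
  (forall x x', B x x' - B x' x = C (B x y) x' - C (B x' y) x) ->
  forall x a, B x a = 0.
Proof.
move=> C12 C23 Cy Bskew Btors.
have C3 u a b : g b (C u a) = g u (C a b) by rewrite C12 C23.
have tors x x' z : g z (B x x') - g z (B x' x) = g (B x y) (C x' z) - g (B x' y) (C x z).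
  by rewrite -formB Btors formB (C3 _ x' z) (C3 _ x z).
(* three permuted torsion conditions, combined by skewness *)
have koszul x a z : g z (B x a) = g (B z y) (C x a) - g (B a y) (C x z).
  have := tors x a z; have := tors a z x; have := tors z x a.
  have := Bskew x a z; have := Bskew a z x; have := Bskew z x a.
  rewrite (C12 a z) (C12 z x) (C12 a x).
  by clear; lra.
have Byy : B y y = 0.
  by apply: form_nondegenerate => z; rewrite koszul (C12 y z) !Cy !form0 subrr.
have By x : B x y = 0.
  by apply: form_nondegenerate => z; rewrite koszul Cy form0 Byy g_sym form0 subrr.
by move=> x a; apply: form_nondegenerate => z; rewrite koszul !By !(g_sym 0) !form0 subrr.
Qed.

End Rigidity.

(** * Connections in a coordinate domain *)

Section LocalTheory.
Context {R : realType} {n : nat}.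
Local Notation V := 'rV[R]_n.
Local Notation Z := (V * V)%type.
Implicit Types (g : Z -> V -> V -> R) (G : Z -> Z -> V -> V) (X Y zeta : Z -> V).

(** The last two fields are what remains, on the first derivatives, of the fact
    that [g] is the vertical Hessian of a function homogeneous of degree two. *)
Record finsler_coefficients (O : set Z) g : Prop := FinslerCoefficients {
  fc_open : open O ;
  fc_linear : forall z a, O z -> linear (g z a : V -> R^o) ;
  fc_sym : forall z a b, O z -> g z a b = g z b a ;
  fc_pos : forall z a, O z -> a != 0 -> 0 < g z a a ;
  fc_smooth : forall a b, smooth_on O (fun z => g z a b : R^o) ;
  fc_hessian : forall z v a b, O z ->
    'D_(0, v) (fun z => g z a b : R^o) z = 'D_(0, a) (fun z => g z v b : R^o) z ;
  fc_homogeneous : forall z a b, O z -> 'D_(0, z.2) (fun z => g z a b : R^o) z = 0 }.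

(** A direction [(x, v)] is horizontal when the connection map vanishes on it, that
    is when [v + G z (x, v) z.2 = 0]; with this, [cc_vertical] and [cc_horizontal]
    are the two torsion axioms of a Cartan connection. *)
Record cartan_coefficients (O : set Z) g G : Prop := CartanCoefficients {
  cc_finsler :> finsler_coefficients O g ;
  cc_linear_dir : forall z a, O z -> linear (fun w => G z w a) ;
  cc_linear_arg : forall z w, O z -> linear (G z w) ;
  cc_smooth : forall w a, smooth_on O (fun z => G z w a) ;
  cc_metric : forall z w a b, O z ->
    'D_w (fun z => g z a b : R^o) z = g z (G z w a) b + g z a (G z w b) ;
  cc_vertical : forall z v a b, O z -> g z (G z (0, v) a) b = g z (G z (0, v) b) a ;
  cc_horizontal : forall z x v x' v', O z ->
    v + G z (x, v) z.2 = 0 -> v' + G z (x', v') z.2 = 0 ->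
    G z (x, v) x' = G z (x', v') x }.

Definition frameZ : frame Z := frame_pair (frame_rV n) (frame_rV n).

Section OneConnection.
Variables (O : set Z) (g : Z -> V -> V -> R) (G : Z -> Z -> V -> V).
Hypothesis H : cartan_coefficients O g G.
Let oO := fc_open H.

Lemma gD z a b c : O z -> g z a (b + c) = g z a b + g z a c.
Proof. by move=> Oz; apply: formD => a'; exact: (fc_linear H). Qed.
Lemma g0r z a : O z -> g z a 0 = 0.
Proof. by move=> Oz; apply: form0 => a'; exact: (fc_linear H). Qed.
Lemma gZ z k a b : O z -> g z a (k *: b) = k * g z a b.
Proof. by move=> Oz; apply: formZ => a'; exact: (fc_linear H). Qed.
Lemma gN z a b : O z -> g z a (- b) = - g z a b.
Proof. by move=> Oz; apply: formN => a'; exact: (fc_linear H). Qed.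
Lemma gC z a b : O z -> g z a b = g z b a.
Proof. by move=> Oz; exact: (fc_sym H). Qed.
Lemma g_inj z a b : O z -> (forall c, g z c a = g z c b) -> a = b.
Proof.
move=> Oz; apply: form_inj => [c|c c0]; first exact: (fc_linear H).
exact: (fc_pos H).
Qed.

Lemma GD1 z w w' a : O z -> G z (w + w') a = G z w a + G z w' a.
Proof. by move=> Oz; have := cc_linear_dir H a Oz 1 w w'; rewrite !scale1r. Qed.
Lemma G01 z a : O z -> G z 0 a = 0.
Proof. by move=> Oz; apply: (@addrI _ (G z 0 a)); rewrite -GD1// !addr0. Qed.
Lemma GZ1 z k w a : O z -> G z (k *: w) a = k *: G z w a.
Proof. by move=> Oz; have := cc_linear_dir H a Oz k w 0; rewrite !addr0 G01// addr0. Qed.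
Lemma GD2 z w a b : O z -> G z w (a + b) = G z w a + G z w b.
Proof. by move=> Oz; have := cc_linear_arg H w Oz 1 a b; rewrite !scale1r. Qed.
Lemma G02 z w : O z -> G z w 0 = 0.
Proof. by move=> Oz; apply: (@addrI _ (G z w 0)); rewrite -GD2// !addr0. Qed.
Lemma GZ2 z w k a : O z -> G z w (k *: a) = k *: G z w a.
Proof. by move=> Oz; have := cc_linear_arg H w Oz k a 0; rewrite !addr0 G02// addr0. Qed.
Lemma GN2 z w a : O z -> G z w (- a) = - G z w a.
Proof. by move=> Oz; rewrite -scaleN1r GZ2// scaleN1r. Qed.

Lemma G_split z x v a : O z -> G z (x, v) a = G z (x, 0) a + G z (0, v) a.
Proof. by move=> Oz; rewrite -GD1//; congr (G z _ a); congr pair; rewrite ?addr0 ?add0r. Qed.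

Lemma GvD z u v a : O z -> G z (0, u + v) a = G z (0, u) a + G z (0, v) a.
Proof. by move=> Oz; rewrite -GD1//; congr (G z _ a); congr pair; rewrite addr0. Qed.

Lemma GvZ z k v a : O z -> G z (0, k *: v) a = k *: G z (0, v) a.
Proof. by move=> Oz; rewrite -GZ1//; congr (G z _ a); congr pair; rewrite scaler0. Qed.

Lemma GvN z v a : O z -> G z (0, - v) a = - G z (0, v) a.
Proof. by move=> Oz; rewrite -scaleN1r GvZ// scaleN1r. Qed.

(** Metricity and the symmetry of the (h)hv-torsion determine the vertical
    coefficients: they are half the vertical derivative of the metric. *)
Lemma vertical_metric z v a b : O z ->
  'D_(0, v) (fun z => g z a b : R^o) z = 2 * g z b (G z (0, v) a).
Proof.
move=> Oz; rewrite (cc_metric H)// (gC _ _ Oz) [X in _ + X](gC _ _ Oz) -(cc_vertical H)//.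
by rewrite (gC _ b) //; lra.
Qed.

Lemma vertical_sym z u v : O z -> G z (0, u) v = G z (0, v) u.
Proof.
move=> Oz; apply: (g_inj Oz) => c.
by have := fc_hessian H u v c Oz; rewrite !vertical_metric//; lra.
Qed.

Lemma vertical_total z u v c : O z -> g z c (G z (0, u) v) = g z v (G z (0, u) c).
Proof. by move=> Oz; rewrite (gC c _ Oz) (cc_vertical H)// (gC v). Qed.

(** By total symmetry this is the derivative of the metric along the ray, which
    vanishes by homogeneity.  It makes the connection map the identity on vertical
    vectors. *)
Lemma vertical_eta z u : O z -> G z (0, u) z.2 = 0.
Proof.
move=> Oz; rewrite vertical_sym//; apply: (g_inj Oz) => c.
by have := fc_homogeneous H u c Oz; rewrite vertical_metric// g0r//; lra.
Qed.

Lemma horizontal_lift z x b : O z ->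
  G z (x, - G z (x, 0) z.2) b = G z (x, 0) b - G z (0, G z (x, 0) z.2) b.
Proof. by move=> Oz; rewrite G_split// GvN. Qed.

Lemma horizontal_lift_conn_map z x : O z ->
  - G z (x, 0) z.2 + G z (x, - G z (x, 0) z.2) z.2 = 0.
Proof. by move=> Oz; rewrite horizontal_lift// vertical_eta// subr0 addNr. Qed.

(** The vanishing of the horizontal torsion, written with the coefficients along
    the coordinate directions [(x, 0)] instead of the horizontal ones. *)
Lemma horizontal_torsion z x x' : O z ->
  G z (x, 0) x' - G z (x', 0) x =
  G z (0, G z (x, 0) z.2) x' - G z (0, G z (x', 0) z.2) x.
Proof.
move=> Oz; have E := horizontal_lift_conn_map.
have := cc_horizontal H Oz (E _ x Oz) (E _ x' Oz); rewrite !horizontal_lift// => /eqP.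
rewrite subr_eq => /eqP ->.
by rewrite addrC !addrA addNr add0r addrC.
Qed.

Lemma form_eval_linear z b : O z -> linear (fun a => g z a b : R^o).
Proof.
move=> Oz k a a'; rewrite (gC _ b)// (gC a b)// (gC a' b)//.
exact: (fc_linear H).
Qed.

Lemma derive_form z w X Y : O z -> differentiable X z -> differentiable Y z ->
  'D_w (fun z => g z (X z) (Y z) : R^o) z =
  g z ('D_w X z + G z w (X z)) (Y z) + g z (X z) ('D_w Y z + G z w (Y z)).
Proof.
move=> Oz dX dY.
have nO : \near z, O z by exact: open_nbhs_nbhs.
have d1 b : \near z, linear (fun a => g z a b : R^o).
  by apply: filterS nO => z' /form_eval_linear.
have dg a b : differentiable (fun z => g z a b : R^o) z.
  exact: smooth_on_differentiable (fc_smooth H a b) Oz.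
have d2 b : differentiable (fun z => g z (X z) b : R^o) z.
  by apply: (differentiable_eval (frame_rV n) (d1 b) _ dX) => a; exact: dg.
have d3 : \near z, linear (g z (X z) : V -> R^o).
  by apply: filterS nO => z' Oz'; exact: (fc_linear H).
rewrite (derive_eval (frame_rV n) w d3 d2 dY).
rewrite (derive_eval (frame_rV n) w (d1 _) (fun a => dg a _) dX) (cc_metric H)//.
rewrite (gC ('D_w X z + _))// !gD// (gC (Y z))// (gC (Y z))//.
by lra.
Qed.

Variable zeta : Z -> V.
Hypothesis zeta_smooth : smooth_on O zeta.
Hypothesis zeta_concurrent : forall z w, O z ->
  'D_w zeta z = - w.1 - G z w (zeta z).

Lemma zeta_differentiable z : O z -> differentiable zeta z.
Proof. exact: smooth_on_differentiable. Qed.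

Lemma derive_square_zeta z w : O z ->
  'D_w (fun z => g z (zeta z) (zeta z) : R^o) z = - (2 * g z w.1 (zeta z)).
Proof.
move=> Oz; have dz := zeta_differentiable Oz.
rewrite (derive_form w Oz dz dz) zeta_concurrent// addrNK -[w.1]opprK gN// opprK.
by rewrite (gC (- w.1))// gN// (gC (zeta z))//; lra.
Qed.

Lemma smooth_form X Y : smooth_on O X -> smooth_on O Y ->
  smooth_on O (fun z => g z (X z) (Y z) : R^o).
Proof.
move=> sX sY; apply: (@smooth_on_eval _ _ _ _ (frame_rV n) O (fun z b => g z (X z) b : R^o)) => //.
  by move=> z Oz; exact: (fc_linear H).
move=> b; apply: (@smooth_on_eval _ _ _ _ (frame_rV n) O (fun z a => g z a b : R^o)) => //.
  by move=> z; exact: form_eval_linear.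
by move=> a; exact: (fc_smooth H).
Qed.

Lemma derive_lower_zeta z w b : O z ->
  'D_w (fun z => g z b (zeta z) : R^o) z = g z (G z w b) (zeta z) - g z w.1 b.
Proof.
move=> Oz; rewrite (derive_form w Oz (differentiable_cst b z) (zeta_differentiable Oz)).
by rewrite derive_cst add0r zeta_concurrent// subrK gN// (gC b).
Qed.

(** Here the concurrence condition is used twice: the square of [zeta] has no
    vertical derivative and its derivative along [(b, 0)] is [-2 g(b, zeta)], so
    the vertical derivative of [g(b, zeta)] vanishes by exchange of derivatives. *)
Lemma vertical_lower_zeta z u b : O z -> g z (G z (0, u) b) (zeta z) = 0.
Proof.
move=> Oz; pose p2 z := g z (zeta z) (zeta z) : R^o.
have sp : smooth_on O p2 by exact: smooth_form.
have E : 'D_(0, u) (fun z => 'D_(b, 0) p2 z) z = 0.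
  rewrite (derive_swap_scalar (b, 0) (0, u) oO sp Oz).
  rewrite -[RHS](derive_cst (0 : R^o) z (b, 0)).
  apply: (open_eq_derive _ oO Oz) => z' Oz'.
  by rewrite derive_square_zeta//= (gC 0)// g0r// mulr0 oppr0.
have : 'D_(0, u) (fun z => - 2 *: (g z b (zeta z) : R^o)) z = 0.
  rewrite -[RHS]E; apply: (open_eq_derive _ oO Oz) => z' Oz'.
  by rewrite derive_square_zeta//= -mulNr.
have dl : differentiable (fun z => g z b (zeta z) : R^o) z.
  by apply: smooth_on_differentiable Oz; apply: smooth_form => //; exact: smooth_on_const.
rewrite (derive_scale _ (differentiable_cst _ _) dl) derive_cst scale0r add0r.
rewrite derive_lower_zeta//= (gC 0)// g0r// subr0 => /eqP.
by rewrite scaler_eq0 oppr_eq0 pnatr_eq0 /= => /eqP.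
Qed.

Lemma vertical_zeta z u : O z -> G z (0, u) (zeta z) = 0.
Proof.
move=> Oz; apply: (g_inj Oz) => b.
by rewrite g0r// vertical_total// gC// vertical_lower_zeta.
Qed.

Lemma vertical_zeta_dir z b : O z -> G z (0, zeta z) b = 0.
Proof. by move=> Oz; rewrite vertical_sym// vertical_zeta. Qed.

Lemma square_zeta_ge0 z : O z -> 0 <= g z (zeta z) (zeta z).
Proof.
move=> Oz; case: (eqVneq (zeta z) 0) => [->|z0]; first by rewrite g0r.
exact: ltW (fc_pos H Oz z0).
Qed.

End OneConnection.

(** The curvature operator in coordinates.  The curvature is a tensor, so the two
    directions and the argument may be taken constant in the chart. *)
Definition curvature_coef (G : Z -> Z -> V -> V) (z a b : Z) (c : V) : V :=
  - 'D_a (fun z => G z b c) z + 'D_b (fun z => G z a c) z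
  - G z a (G z b c) + G z b (G z a c).

Section VerticalZeta.
Variables (O : set Z) (g : Z -> V -> V -> R) (G : Z -> Z -> V -> V) (zeta : Z -> V).
Hypothesis H : cartan_coefficients O g G.
Hypothesis zeta_smooth : smooth_on O zeta.
Hypothesis zeta_concurrent : forall z w, O z ->
  'D_w zeta z = - w.1 - G z w (zeta z).
Let oO := fc_open H.

Lemma G_differentiable z w c : O z -> differentiable (fun z => G z w c) z.
Proof. exact: smooth_on_differentiable (cc_smooth H _ _). Qed.

Section AtPoint.
Variable z0 : Z.
Hypothesis Oz0 : O z0.
Let V0 : Z := (0, zeta z0).
Let DG w c := 'D_V0 (fun z => G z w c) z0.
Let C v c := G z0 (0, v) c.

Lemma vertical_pair_linear z a : O z -> linear (fun u => G z (0, u) a).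
Proof. by move=> Oz k u v; rewrite (GvD H)// (GvZ H). Qed.

(** Derivative, along [w], of the identity that the coefficients vanish in the
    direction [(0, zeta)]: it trades the derivative of the coefficients for that of
    [zeta]. *)
Lemma vertical_zeta_frozen w c :
  'D_w (fun z => G z V0 c) z0 = C (w.1 + G z0 w (zeta z0)) c.
Proof.
have nl : \near z0, linear (fun u => G z0 (0, u) c).
  by apply: filterS (open_nbhs_nbhs (conj oO Oz0)) => z Oz; exact: vertical_pair_linear.
have dv u : differentiable (fun z => G z (0, u) c) z0 by exact: G_differentiable.
have := derive_eval (frame_rV n) w nl dv (zeta_differentiable zeta_smooth Oz0).
rewrite (@open_eq_derive _ _ _ O _ (fun=> 0))//; last first.
  by move=> z Oz; rewrite (vertical_zeta_dir H zeta_smooth zeta_concurrent).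
rewrite derive_cst zeta_concurrent// (GvD H)// !(GvN H)// => /esym/eqP.
by rewrite -opprD subr_eq0 -(GvD H)// => /eqP.
Qed.

(** The metricity identity in the direction [w], differentiated along [(0, zeta)];
    on the left of it the order of the two derivatives is exchanged. *)
Lemma metric_second w a b :
  g z0 (DG w a) b + g z0 a (DG w b) = 2 * g z0 b (C (w.1 + G z0 w (zeta z0)) a).
Proof.
have dGa u c : differentiable (fun z => G z u c) z0 by exact: G_differentiable.
have dc c : differentiable (fun _ : Z => c : V) z0 by exact: differentiable_cst.
have sg : smooth_on O (fun z => g z a b : R^o) by exact: (fc_smooth H).
have VZ c := vertical_zeta_dir H zeta_smooth zeta_concurrent c Oz0.
have := derive_swap_scalar w V0 oO sg Oz0.
rewrite [RHS](@open_eq_derive _ _ _ O _ (fun z => (2 : R^o) *: (g z b (G z V0 a) : R^o)))//;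
    last first.
  by move=> z Oz; rewrite (vertical_metric H).
rewrite [LHS](@open_eq_derive _ _ _ O _ (fun z => (g z (G z w a) b : R^o) +
    (g z a (G z w b) : R^o)))//; last first.
  by move=> z Oz; rewrite (cc_metric H).
have sG u c : smooth_on O (fun z => G z u c) by exact: (cc_smooth H).
have sc c : smooth_on O (fun _ : Z => c : V) by exact: smooth_on_const.
have d1 : differentiable (fun z => g z (G z w a) b : R^o) z0.
  by apply: smooth_on_differentiable Oz0; exact: (smooth_form H).
have d2 : differentiable (fun z => g z a (G z w b) : R^o) z0.
  by apply: smooth_on_differentiable Oz0; exact: (smooth_form H).
have d3 : differentiable (fun z => g z b (G z V0 a) : R^o) z0.
  by apply: smooth_on_differentiable Oz0; exact: (smooth_form H).
rewrite (derive_add _ d1 d2) (derive_scale _ (differentiable_cst _ _) d3) derive_cst scale0r add0r.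
rewrite !(derive_form H)// !derive_cst !VZ !addr0 !add0r (G02 H)// addr0 vertical_zeta_frozen.
by rewrite (gC H 0 (G z0 w b))// !(g0r H)// addr0 !add0r.
Qed.

(** The sum of the two terms of [metric_second] vanishes for vertical [w], and they
    are equal, because the (h)hv-torsion is symmetric at all points. *)
Lemma vertical_derivative_zeta v c : DG (0, v) c = 0.
Proof.
have dG u b : differentiable (fun z => G z u b) z0 by exact: G_differentiable.
have VZ b := vertical_zeta_dir H zeta_smooth zeta_concurrent b Oz0.
have S a b : g z0 (DG (0, v) a) b = g z0 (DG (0, v) b) a.
  have E : 'D_V0 (fun z => g z (G z (0, v) a) b : R^o) z0 =
           'D_V0 (fun z => g z (G z (0, v) b) a : R^o) z0.
    by apply: (open_eq_derive _ oO Oz0) => z Oz; rewrite (cc_vertical H).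
  have D u b' : 'D_V0 (fun z => g z (G z (0, v) u) b' : R^o) z0 = g z0 (DG (0, v) u) b'.
    rewrite (derive_form H _ Oz0 (dG _ _) (differentiable_cst _ _)) derive_cst !VZ.
    by rewrite !addr0 (g0r H)// addr0.
  by rewrite -!D.
apply: (g_inj H Oz0) => b; rewrite (g0r H)//.
have := metric_second (0, v) c b.
rewrite /C (vertical_zeta H zeta_smooth zeta_concurrent)// addr0 (G01 H)// (g0r H)//.
by rewrite (gC H c)// -(S c b) (gC H b)//; lra.
Qed.

(** Derivative of [horizontal_torsion] along [(0, zeta)].  The tangent vector
    [z.2] moves with speed [zeta], which gives the terms with
    [G z0 (x, 0) (zeta z0)]. *)
Lemma horizontal_derivative_torsion x x' :
  DG (x, 0) x' - DG (x', 0) x =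
  C (DG (x, 0) z0.2 + G z0 (x, 0) (zeta z0)) x' -
  C (DG (x', 0) z0.2 + G z0 (x', 0) (zeta z0)) x.
Proof.
have dG u b : differentiable (fun z => G z u b) z0 by exact: G_differentiable.
have nO : \near z0, O z0 by exact: (open_nbhs_nbhs (conj oO Oz0)).
have d2 : differentiable (snd : Z -> V) z0.
  by apply: linear_differentiable; exact: snd_linear_continuous.
have nl y : \near z0, linear (G z0 (y, 0)).
  by apply: filterS nO => z Oz; exact: (cc_linear_arg H).
have df y : differentiable (fun z => G z (y, 0) z.2) z0.
  exact: (differentiable_eval (frame_rV n) (nl y) (fun b => dG (y, 0) b) d2).
have Df y : 'D_V0 (fun z => G z (y, 0) z.2) z0 = DG (y, 0) z0.2 + G z0 (y, 0) (zeta z0).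
  rewrite (derive_eval (frame_rV n) _ (nl y) (fun b => dG (y, 0) b) d2).
  by rewrite derive_linear//; exact: snd_linear_continuous.
have nv b : \near z0, linear (fun u => G z0 (0, u) b).
  by apply: filterS nO => z Oz; exact: vertical_pair_linear.
have dh y b : differentiable (fun z => G z (0, G z (y, 0) z.2) b) z0.
  exact: (differentiable_eval (frame_rV n) (nv b) (fun u => dG (0, u) b) (df y)).
have Dh y b : 'D_V0 (fun z => G z (0, G z (y, 0) z.2) b) z0 =
    C (DG (y, 0) z0.2 + G z0 (y, 0) (zeta z0)) b.
  rewrite (derive_eval (frame_rV n) _ (nv b) (fun u => dG (0, u) b) (df y)) Df.
  by rewrite -/(DG _ _) vertical_derivative_zeta add0r.
have sub (f h : Z -> V) : differentiable f z0 -> differentiable h z0 ->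
    'D_V0 (fun z => f z - h z) z0 = 'D_V0 f z0 - 'D_V0 h z0.
  by move=> df' dh'; apply: deriveB; exact: diff_derivable.
rewrite /DG -(sub _ _ (dG _ _) (dG _ _)) -!Dh -(sub _ _ (dh _ _) (dh _ _)).
apply: (open_eq_derive _ oO Oz0) => z Oz; exact: (horizontal_torsion H).
Qed.

(** The operator [A w] of the curvature in the directions [(0, zeta)] and [w] is
    skew, vanishes for vertical [w] and satisfies the torsion condition of
    [cartan_rigidity], as the three previous lemmas show. *)
Lemma curvature_zeta w c : curvature_coef G z0 V0 w c = 0.
Proof.
have VZ b := vertical_zeta_dir H zeta_smooth zeta_concurrent b Oz0.
pose A w c := - DG w c + C (w.1 + G z0 w (zeta z0)) c.
have AE u b : curvature_coef G z0 V0 u b = A u b.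
  rewrite /curvature_coef vertical_zeta_frozen !VZ (G02 H)// subr0 addr0.
  by rewrite /A.
have Av u b : A (0, u) b = 0.
  rewrite /A vertical_derivative_zeta /= (vertical_zeta H zeta_smooth zeta_concurrent)//.
  by rewrite addr0 /C (G01 H)// oppr0 addr0.
have Ax x b : A (x, 0) b = 0.
  apply: (@cartan_rigidity _ _ (g z0) _ _ _ C (fun x b => A (x, 0) b) z0.2).
  - by move=> u; exact: (fc_linear H).
  - by move=> u v; exact: (fc_sym H).
  - by move=> u; exact: (fc_pos H).
  - by move=> u v d; rewrite /C (vertical_sym H).
  - by move=> u v d; rewrite /C (vertical_total H).
  - by move=> u; exact: (vertical_eta H).
  - move=> y u v; rewrite /A !(gD H)// !(gN H)//=.
    have := metric_second (y, 0) u v; rewrite (gC H (DG _ _) v)//=.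
    rewrite [g z0 u (C _ v)](vertical_total H)//; lra.
  - move=> y u; have := horizontal_derivative_torsion y u.
    have Ay v : A (v, 0) z0.2 = - DG (v, 0) z0.2.
      by rewrite /A /C (vertical_eta H)// addr0.
    rewrite !Ay /A /= /C !(GvD H)// !(GvN H)// (vertical_sym H u y)// => E.
    apply/rowP => i; have := congr1 (fun v : V => v 0 i) E.
    by rewrite !mxE; lra.
have AD u v b : A (u + v) b = A u b + A v b.
  rewrite /A /DG /C (@open_eq_derive _ _ _ O _ (fun z => G z u b + G z v b))//; last first.
    by move=> z Oz; rewrite (GD1 H).
  rewrite (derive_add _ (G_differentiable _ _ Oz0) (G_differentiable _ _ Oz0)).
  rewrite (GD1 H)//= addrACA (GvD H)//.
  by apply/rowP => i; rewrite !mxE; ring.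
rewrite AE; case: w => x v.
have -> : ((x, v) : Z) = (x, 0) + (0, v).
  by congr pair; rewrite ?addr0 ?add0r.
by rewrite AD Ax Av addr0.
Qed.

End AtPoint.
End VerticalZeta.

Section CurvatureShift.
Variables (O : set Z) (g : Z -> V -> V -> R) (G : Z -> Z -> V -> V) (zeta : Z -> V).
Hypothesis H : cartan_coefficients O g G.
Let oO := fc_open H.

Lemma curvature_coef_linear z a a' b c (k : R) : O z ->
  curvature_coef G z (a + k *: a') b c = curvature_coef G z a b c + k *: curvature_coef G z a' b c.
Proof.
move=> Oz; have dG w e : differentiable (fun z => G z w e) z.
  exact: smooth_on_differentiable (cc_smooth H _ _) Oz.
have D1 : 'D_(a + k *: a') (fun z => G z b c) z =
    'D_a (fun z => G z b c) z + k *: 'D_a' (fun z => G z b c) z.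
  by rewrite (derive_dirD _ _ (dG b c)) (derive_dirZ _ _ (dG b c)).
have D2 : 'D_b (fun z => G z (a + k *: a') c) z =
    'D_b (fun z => G z a c) z + k *: 'D_b (fun z => G z a' c) z.
  have E y : O y -> G y (a + k *: a') c = G y a c + k *: G y a' c.
    by move=> Oy; rewrite (GD1 H)// (GZ1 H).
  rewrite (open_eq_derive b oO Oz E).
  have dk : differentiable (fun y => k *: G y a' c) z by apply: differentiableZ; exact: dG.
  apply: (etrans (derive_add b (dG a c) dk)).
  exact: (congr1 (+%R _) (derive_constZ b k (dG a' c))).
rewrite /curvature_coef D1 D2 !(GD1 H)// !(GZ1 H)// (GD2 H)// (GZ2 H)//.
have aux (x1 x2 x3 x4 y1 y2 y3 y4 : V) : - (x1 + k *: x2) + (x3 + k *: x4) -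
    (y1 + k *: y2) + (y3 + k *: y4) = - x1 + x3 - y1 + y3 + k *: (- x2 + x4 - y2 + y4).
  by apply/rowP => i; rewrite !mxE; ring.
exact: aux.
Qed.

Lemma curvature_coef_anti z a b c : curvature_coef G z b a c = - curvature_coef G z a b c.
Proof.
have aux (x1 x2 y1 y2 : V) : - x1 + x2 - y1 + y2 = - (- x2 + x1 - y2 + y1).
  by apply/rowP => i; rewrite !mxE; ring.
exact: aux.
Qed.

Hypothesis zeta_smooth : smooth_on O zeta.
Hypothesis zeta_concurrent : forall z w, O z ->
  'D_w zeta z = - w.1 - G z w (zeta z).

(** The horizontal lifts of a vector for the two connections differ by a multiple of
    [(0, zeta)], to which the curvature is blind. *)
Lemma curvature_shift z a b c (s t : R) : O z ->
  curvature_coef G z (a + s *: ((0, zeta z) : Z)) (b + t *: ((0, zeta z) : Z)) c =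
  curvature_coef G z a b c.
Proof.
move=> Oz; have C0 w e := curvature_zeta H zeta_smooth zeta_concurrent Oz w e.
rewrite curvature_coef_linear// C0 scaler0 addr0 curvature_coef_anti.
by rewrite curvature_coef_linear// C0 scaler0 addr0 -curvature_coef_anti.
Qed.

End CurvatureShift.

Section Change.
Variables (O : set Z) (g gt : Z -> V -> V -> R) (G Gt : Z -> Z -> V -> V) (zeta : Z -> V).
Hypothesis H : cartan_coefficients O g G.
Hypothesis Ht : cartan_coefficients O gt Gt.
Hypothesis zeta_smooth : smooth_on O zeta.
Hypothesis zeta_concurrent : forall z w, O z ->
  'D_w zeta z = - w.1 - G z w (zeta z).
Hypothesis gtE : forall z a b, O z ->
  gt z a b = g z a b + g z a (zeta z) * g z b (zeta z).
Let oO := fc_open H.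

Lemma derive_changed_form z w a b : O z ->
  'D_w (fun z => gt z a b : R^o) z = g z (G z w a) b + g z a (G z w b) +
    (g z (G z w a) (zeta z) - g z w.1 a) * g z b (zeta z) +
    g z a (zeta z) * (g z (G z w b) (zeta z) - g z w.1 b).
Proof.
move=> Oz.
have dl c : differentiable (fun z => g z c (zeta z) : R^o) z.
  apply: smooth_on_differentiable Oz; apply: (smooth_form H) => //.
  exact: smooth_on_const.
have dg : differentiable (fun z => g z a b : R^o) z.
  exact: smooth_on_differentiable (fc_smooth H a b) Oz.
have E : \forall z \near z, (g z a b : R^o) + (g z a (zeta z) : R^o) *: (g z b (zeta z) : R^o) =
    gt z a b.
  by apply: (open_near_eq oO) Oz => z' Oz'; rewrite gtE.
rewrite -(near_eq_derive _ E) (derive_add _ dg (differentiable_scale (dl a) (dl b))).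
rewrite (derive_scale _ (dl a) (dl b)) (cc_metric H)//.
by rewrite !(derive_lower_zeta H zeta_smooth zeta_concurrent)// addrA.
Qed.

(** The additional term [g(_, zeta) g(_, zeta)] of the metric has no vertical
    derivative, so both connections have the same (h)hv-torsion. *)
Lemma changed_vertical z u a : O z -> Gt z (0, u) a = G z (0, u) a.
Proof.
move=> Oz; apply: (g_inj Ht Oz) => b.
have := vertical_metric Ht u a b Oz; rewrite derive_changed_form//=.
have V0 c := vertical_lower_zeta H zeta_smooth zeta_concurrent u c Oz.
rewrite [gt z b (G z (0, u) a)]gtE// !V0 (gC H 0 a)// (gC H 0 b)// !(g0r H)//.
rewrite (gC H (G z (0, u) a) b)// (vertical_total H u b a)// => E.
by move: E; rewrite !subr0 mul0r mulr0 !addr0; lra.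
Qed.

(** [B] is the difference between [Gt] and the announced value.  It is skew for the
    new metric by the two metricity identities, and the two torsion identities
    give the condition of [cartan_rigidity], as the correction is symmetric and
    [zeta] is annihilated by the (h)hv-torsion. *)
Lemma changed_connection z w a : O z ->
  Gt z w a = G z w a - (g z w.1 a / (1 + g z (zeta z) (zeta z))) *: zeta z.
Proof.
move=> Oz; set p2 := g z (zeta z) (zeta z).
have p0 : 1 + p2 != 0 by rewrite gt_eqF// ltr_wpDr// (square_zeta_ge0 H).
pose B x a := Gt z (x, 0) a - G z (x, 0) a + (g z x a / (1 + p2)) *: zeta z.
have V0 u c := vertical_lower_zeta H zeta_smooth zeta_concurrent u c Oz.
have gtC u v c : gt z c (G z (0, u) v) = g z c (G z (0, u) v).
  by rewrite gtE// V0 mulr0 addr0.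
have gtz c : gt z c (zeta z) = (1 + p2) * g z c (zeta z).
  by rewrite gtE// -/p2; ring.
have B0 : forall x a, B x a = 0.
  apply: (@cartan_rigidity _ _ (gt z) _ _ _ (fun u v => G z (0, u) v) B z.2).
  - by move=> c; exact: (fc_linear Ht).
  - by move=> c d; exact: (fc_sym Ht).
  - by move=> c; exact: (fc_pos Ht).
  - by move=> u v c; rewrite (vertical_sym H).
  - by move=> u v c; rewrite !gtC (vertical_total H).
  - by move=> u; exact: (vertical_eta H).
  - move=> x c d; rewrite /B !(gD Ht)// !(gN Ht)// !(gZ Ht)// !gtz.
    have := cc_metric Ht (x, 0) c d Oz; rewrite derive_changed_form//=.
    rewrite (gC Ht (Gt z (x, 0) c))// => E.
    rewrite [gt z d (G _ _ _)]gtE// [gt z c (G _ _ _)]gtE//.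
    rewrite (gC H d (G z (x, 0) c))// (gC H c (zeta z))// (gC H d (zeta z))//.
    rewrite (gC H c (zeta z)) ?(gC H d (zeta z)) // in E.
    have -> : gt z d (Gt z (x, 0) c) = g z (G z (x, 0) c) d + g z c (G z (x, 0) d) +
      (g z (G z (x, 0) c) (zeta z) - g z x c) * g z (zeta z) d +
      g z (zeta z) c * (g z (G z (x, 0) d) (zeta z) - g z x d) - gt z c (Gt z (x, 0) d).
      by rewrite E addrK.
    by field.
  - move=> x x'.
    have T := horizontal_torsion H x x' Oz.
    have := horizontal_torsion Ht x x' Oz.
    rewrite !changed_vertical//.
    have GtE y b : Gt z (y, 0) b = G z (y, 0) b + (B y b - (g z y b / (1 + p2)) *: zeta z).
      by apply/rowP => i; rewrite /B !mxE; ring.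
    have GC p q k b : G z (0, p + (q - k *: zeta z)) b = G z (0, p) b + G z (0, q) b.
      rewrite (GvD H p)// (GvD H q)// (GvN H (k *: _))// (GvZ H)//.
      by rewrite (vertical_zeta_dir H zeta_smooth zeta_concurrent)// scaler0 subr0.
    rewrite !GtE !GC (gC H x' x)// => E.
    apply/rowP => i; have := congr1 (fun v : V => v 0 i) E.
    by have := congr1 (fun v : V => v 0 i) T; rewrite !mxE; lra.
case: w => x u; rewrite (G_split Ht)// (G_split H _ u)// changed_vertical//=.
have := B0 x a; rewrite /B => /rowP E; apply/rowP => i; have := E i.
by rewrite !mxE; lra.
Qed.

Lemma derive_changed_connection z a b c : O z ->
  let p := 1 + g z (zeta z) (zeta z) in
  'D_a (fun z => Gt z b c) z = 'D_a (fun z => G z b c) z -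
    ((g z (G z a b.1) c + g z b.1 (G z a c)) / p +
     2 * g z b.1 c * g z a.1 (zeta z) / p ^+ 2) *: zeta z +
    (g z b.1 c / p) *: (a.1 + G z a (zeta z)).
Proof.
move=> Oz p.
have p_neq0 z' : O z' -> 1 + g z' (zeta z') (zeta z') != 0.
  by move=> Oz'; rewrite gt_eqF// ltr_wpDr// (square_zeta_ge0 H).
pose q z : R^o := 1 + g z (zeta z) (zeta z).
have sq : smooth_on O q.
  by apply: smooth_on_add => //; [exact: smooth_on_const|exact: (smooth_form H)].
have dq : differentiable q z := smooth_on_differentiable sq Oz.
have sqV : smooth_on O (fun z => (q z)^-1 : R^o) by exact: smooth_on_inv.
have dqV : differentiable (fun z => (q z)^-1 : R^o) z := smooth_on_differentiable sqV Oz.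
have dz := zeta_differentiable zeta_smooth Oz.
have dg : differentiable (fun z => g z b.1 c : R^o) z.
  exact: smooth_on_differentiable (fc_smooth H _ _) Oz.
have dG : differentiable (fun z => G z b c) z.
  exact: smooth_on_differentiable (cc_smooth H _ _) Oz.
have ds := differentiable_scale dg (differentiable_scale dqV dz).
have Dq : 'D_a q z = - (2 * g z a.1 (zeta z)).
  rewrite (derive_add _ (differentiable_cst _ _)) ?derive_cst ?add0r.
    exact: (derive_square_zeta H zeta_smooth zeta_concurrent).
  by apply: smooth_on_differentiable Oz; exact: (smooth_form H).
have DqV : 'D_a (fun z => (q z)^-1 : R^o) z = 2 * g z a.1 (zeta z) / p ^+ 2.
  have qz : q z != 0 by exact: p_neq0.
  by rewrite (derive_inv a qz dq) Dq mulNr opprK.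
rewrite (@open_eq_derive _ _ _ O _ (fun z => G z b c + (-1 : R^o) *:
    ((g z b.1 c : R^o) *: ((q z)^-1 *: zeta z))))//; last first.
  by move=> z' Oz'; rewrite changed_connection// scaleN1r scalerA.
rewrite (derive_add _ dG (differentiable_scale (differentiable_cst _ _) ds)).
rewrite (derive_scale _ (differentiable_cst _ _) ds) derive_cst scale0r add0r.
rewrite (derive_scale _ dg (differentiable_scale dqV dz)) (derive_scale _ dqV dz).
rewrite (cc_metric H)// zeta_concurrent// DqV -[q z]/p.
have p0 : p != 0 by exact: p_neq0.
have E (D u v w : V) (k l m : R) : D + (- 1) *: (k *: (p^-1 *: u) +
      l *: ((2 * m / p ^+ 2) *: u + p^-1 *: (- v - w))) =
    D - (k / p + 2 * l * m / p ^+ 2) *: u + (l / p) *: (v + w).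
  by apply/rowP => i; rewrite !mxE; field.
exact: E.
Qed.

Lemma changed_curvature z a b c : O z ->
  let p := 1 + g z (zeta z) (zeta z) in
  curvature_coef Gt z a b c = curvature_coef G z a b c +
    (g z (G z a b.1 - G z b a.1) c / p) *: zeta z +
    ((g z a.1 c / p) *: b.1 + (g z b.1 c * g z a.1 (zeta z) / p ^+ 2) *: zeta z -
     ((g z b.1 c / p) *: a.1 + (g z a.1 c * g z b.1 (zeta z) / p ^+ 2) *: zeta z)).
Proof.
move=> Oz p.
have p0 : p != 0 by rewrite gt_eqF// ltr_wpDr// (square_zeta_ge0 H).
rewrite /curvature_coef !derive_changed_connection// !changed_connection// -/p.
rewrite !(GD2 H)// !(GN2 H)// !(GZ2 H)// !(gD H)// !(gN H)// !(gZ H)//.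
rewrite (gC H (_ - _) c)// !(gD H)// !(gN H)//.
rewrite (gC H (G z a b.1) c)// (gC H (G z b a.1) c)//.
by apply/rowP => i; rewrite !mxE; field.
Qed.

End Change.

End LocalTheory.

(** * Smooth atlases *)

Section Atlas.
Context {R : realType} {W : normedModType R} (F : frame W).
Context {P I : Type} (dom : I -> set P) (ch : I -> P -> W) (inv : I -> W -> P).

Definition overlap (c d : I) : set W := ch c @` (dom c `&` dom d).
(** The change of coordinates of tangent vectors at [p], from the chart [c] to the
    chart [d].  The manifold and its tangent bundle are both treated as a set with
    an atlas. *)
Definition jac (c d : I) (p : P) (v : W) : W := 'd (ch d \o inv c) (ch c p) v.

Hypothesis invK : forall c p, dom c p -> inv c (ch c p) = p.
Hypothesis overlap_open : forall c d, open (overlap c d).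
Hypothesis transition_smooth : forall c d, smooth_on (overlap c d) (ch d \o inv c).

Lemma overlap_mem c d p : dom c p -> dom d p -> overlap c d (ch c p).
Proof. by move=> cp dp; exists p. Qed.

Lemma overlap_near c d p : dom c p -> dom d p -> \forall z \near ch c p, overlap c d z.
Proof.
by move=> cp dp; apply: open_nbhs_nbhs; split; [exact: overlap_open|exact: overlap_mem].
Qed.

Lemma transition_differentiable c d p : dom c p -> dom d p ->
  differentiable (ch d \o inv c) (ch c p).
Proof.
by move=> cp dp; apply: smooth_on_differentiable (transition_smooth c d) _; exact: overlap_mem.
Qed.

Lemma jac_linear c d p : linear (jac c d p).
Proof. exact: linearP. Qed.

Lemma jacD c d p v w : jac c d p (v + w) = jac c d p v + jac c d p w.
Proof. exact: linearD. Qed.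
Lemma jacZ c d p k v : jac c d p (k *: v) = k *: jac c d p v.
Proof. exact: linearZ. Qed.
(** Stated for functions on the set [P] rather than for their representatives: this
    is the form in which it applies to the charts themselves, to give the cocycle
    property of the Jacobians, and to functions. *)
Lemma d_transition (U : normedModType R) (f : P -> U) c d p w :
  dom c p -> dom d p -> differentiable (f \o inv d) (ch d p) ->
  differentiable (f \o inv c) (ch c p) /\
  'd (f \o inv c) (ch c p) w = 'd (f \o inv d) (ch d p) (jac c d p w).
Proof.
move=> cp dp df.
have dt := transition_differentiable cp dp.
have E : \forall z \near ch c p, ((f \o inv d) \o (ch d \o inv c)) z = (f \o inv c) z.
  apply: filterS (overlap_near cp dp) => _ [q [cq dq] <-] /=.
  by rewrite !invK.
have df' : differentiable (f \o inv d) ((ch d \o inv c) (ch c p)).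
  by rewrite /= invK.
have dcomp := differentiable_comp dt df'.
split; first exact: near_eq_differentiable E dcomp.
by rewrite (near_eq_d E dcomp) diff_comp//= invK.
Qed.

Lemma jac_comp c d e p v : dom c p -> dom d p -> dom e p ->
  jac d e p (jac c d p v) = jac c e p v.
Proof.
move=> cp dp ep; rewrite /jac.
by have [_ ->] := d_transition v cp dp (transition_differentiable dp ep).
Qed.

Lemma jac_id c p v : dom c p -> jac c c p v = v.
Proof.
move=> cp; rewrite /jac.
have E : \forall z \near ch c p, z = (ch c \o inv c) z.
  by apply: filterS (overlap_near cp cp) => _ [q [cq _] <-] /=; rewrite invK.
rewrite (near_eq_d E (differentiable_id _)).
by rewrite -deriveE ?derive_id//; exact: differentiable_id.
Qed.

Lemma jac_cancel c d p v : dom c p -> dom d p -> jac d c p (jac c d p v) = v.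
Proof. by move=> cp dp; rewrite jac_comp// jac_id. Qed.

Lemma smooth_near_transition (U : normedModType R) (f : P -> U) c d p :
  dom c p -> dom d p -> smooth_near (ch d p) (f \o inv d) ->
  smooth_near (ch c p) (f \o inv c).
Proof.
move=> cp dp [A [oA Ap sA]].
pose B := overlap c d `&` (ch d \o inv c) @^-1` A.
have oB : open B.
  rewrite openE => _ [[q [cq dq] <-]] /=; rewrite invK// => Aq.
  have ct : {for ch c q, continuous (ch d \o inv c)}.
    exact/differentiable_continuous/transition_differentiable.
  have nA : \forall z \near ch c q, A ((ch d \o inv c) z).
    by apply: ct => /=; rewrite invK//; exact: (open_nbhs_nbhs (conj oA Aq)).
  by apply: filterI (overlap_near cq dq) nA.
exists B; split => //; first by split; [exact: overlap_mem|rewrite /= invK].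
have sT : smooth_on B (ch d \o inv c) by apply: smooth_on_sub (transition_smooth c d) => z [].
have : smooth_on B ((f \o inv d) \o (ch d \o inv c)).
  by apply: (smooth_on_comp F oB _ sA sT) => z [].
apply: (smooth_on_eq oB) => _ [[q [cq dq] <-] _] /=; by rewrite !invK.
Qed.

Lemma smooth_near_jac c d p (v : W) : dom c p -> dom d p ->
  smooth_near (ch c p) (fun z => jac c d (inv c z) v).
Proof.
move=> cp dp; exists (overlap c d); split; [exact: overlap_open|exact: overlap_mem|].
apply: (smooth_on_eq (overlap_open c d) _ (smooth_on_derive v (transition_smooth c d))).
move=> _ [q [cq dq] <-]; rewrite invK// /jac deriveE//.
exact: transition_differentiable.
Qed.

End Atlas.

(** * Charts of the tangent bundle *)

Section Manifold.
Context {R : realType} {n : nat} {M : manifold R n}.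
Local Notation V := 'rV[R]_n.
Local Notation Z := (V * V)%type.
Local Notation dom := (@chart_dom R n M).
Local Notation ch := (@chart R n M).
Local Notation cinv := (@chart_inv R n M).
Local Notation tch := (@tchart R n M).
Local Notation tinv := (@tchart_inv R n M).
Implicit Types (c d : chart_index M) (p : M) (u : TM M).

Definition tchart_dom c : set (TM M) := [set u | dom c u.1].
Local Notation tdom := tchart_dom.
Local Notation J := (jac ch cinv).
Local Notation TJ := (jac tch tinv).

Lemma chart_overlap_open c d : open (overlap dom ch c d).
Proof.
rewrite openE => _ [p [cp dp] <-].
have oI := @chart_img_open _ _ M c; have cI := @chart_inv_continuous _ _ M c.
have Ip : (ch c @` dom c) (ch c p) by exists p.
have n1 : \forall x \near ch c p, (ch c @` dom c) x by exact: open_nbhs_nbhs.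
have n2 : \forall x \near ch c p, dom d (cinv c x).
  apply: (cI _ Ip); rewrite chartK//.
  exact: open_nbhs_nbhs (conj (@chart_dom_open _ _ M d) dp).
apply: filterS2 n1 n2 => _ [q cq <-]; rewrite chartK// => dq.
by exists q.
Qed.

Lemma chart_transition_smooth c d : smooth_on (overlap dom ch c d) (ch d \o cinv c).
Proof. exact: chart_compat. Qed.

Lemma tcoordE c p v : tcoord c p v = J (chart_at p) c p v.
Proof. by []. Qed.

Lemma ttcoordE c u w : ttcoord c u w = TJ (tchart_at u) c u w.
Proof. by []. Qed.

Lemma chart_at_mem p : dom (chart_at p) p.
Proof. exact: chart_at_dom. Qed.

Definition Jcomp := jac_comp (@chartK R n M) chart_overlap_open chart_transition_smooth.
Definition Jid := jac_id (@chartK R n M) chart_overlap_open.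
Definition Jcancel := jac_cancel (@chartK R n M) chart_overlap_open chart_transition_smooth.

Lemma tchart_invE c p (v : V) : dom c p -> tinv c (ch c p, v) = (p, J c (chart_at p) p v).
Proof. by move=> cp; rewrite /tchart_inv /= chartK. Qed.

Lemma tchartK c u : tdom c u -> tinv c (tch c u) = u.
Proof.
case: u => p y /= cp; rewrite /tchart /= tchart_invE// tcoordE Jcancel//.
exact: chart_at_mem.
Qed.

Lemma tchart_onto c d (z : Z) : overlap dom ch c d z.1 ->
  exists u, [/\ tdom c u, tdom d u & tch c u = z].
Proof.
case: z => x v /= [p [cp dp] <-]; exists (p, J c (chart_at p) p v); split => //.
by rewrite /tchart /= tcoordE Jcancel//; exact: chart_at_mem.
Qed.

Lemma tchart_overlapE c d : overlap tdom tch c d = [set z : Z | overlap dom ch c d z.1].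
Proof.
apply/seteqP; split => [_ [u [cu du] <-]|z /tchart_onto[u [cu du <-]]].
  by exists u.1.
by exists u.
Qed.

Lemma tchart_overlap_open c d : open (overlap tdom tch c d).
Proof.
rewrite tchart_overlapE.
apply: (@open_comp _ _ (fst : Z -> V) (overlap dom ch c d)); last exact: chart_overlap_open.
by move=> z _; exact: cvg_fst.
Qed.

(** A transition map of the tangent bundle is the tangent map of a transition map of
    the base. *)
Lemma tchart_transitionE c d (z : Z) : overlap dom ch c d z.1 ->
  (tch d \o tinv c) z = ((ch d \o cinv c) z.1, 'D_(z.2) (ch d \o cinv c) z.1).
Proof.
case: z => x v /= [p [cp dp] <-]; rewrite tchart_invE// /tchart /= chartK//.
rewrite tcoordE Jcomp//; last exact: chart_at_mem.
rewrite /jac deriveE//; apply: (transition_differentiable chart_transition_smooth) => //.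
Qed.

Lemma fst_smooth (A : set Z) : smooth_on A (fst : Z -> V).
Proof. by apply: smooth_on_linear; exact: fst_linear_continuous. Qed.

Lemma snd_smooth (A : set Z) : smooth_on A (snd : Z -> V).
Proof. by apply: smooth_on_linear; exact: snd_linear_continuous. Qed.

Lemma fst_differentiable (z : Z) : differentiable (fst : Z -> V) z.
Proof. exact: smooth_on_differentiable (fst_smooth setT) I. Qed.

Lemma snd_differentiable (z : Z) : differentiable (snd : Z -> V) z.
Proof. exact: smooth_on_differentiable (snd_smooth setT) I. Qed.

Lemma tchart_transition_smooth c d : smooth_on (overlap tdom tch c d) (tch d \o tinv c).
Proof.
have oT := @tchart_overlap_open c d; move: oT; rewrite tchart_overlapE => oT.
have sT := @chart_transition_smooth c d.
apply: (smooth_on_eq oT (fun z Tz => esym (tchart_transitionE Tz))).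
apply: smooth_on_pair => //.
  apply: (smooth_on_comp (frame_rV n) oT _ sT (@fst_smooth _)) => //.
apply: (@smooth_on_eval _ _ _ _ (frame_rV n) _ (fun (z : Z) v => 'D_v (ch d \o cinv c) z.1) snd oT).
- move=> z Tz; apply: derive_linear_dir; exact: smooth_on_differentiable sT Tz.
- move=> v; apply: (smooth_on_comp (frame_rV n) oT _ (smooth_on_derive v sT) (@fst_smooth _)) => //.
- exact: snd_smooth.
Qed.

Definition TJcomp := jac_comp tchartK tchart_overlap_open tchart_transition_smooth.
Definition TJid := jac_id tchartK tchart_overlap_open.
Definition TJcancel := jac_cancel tchartK tchart_overlap_open tchart_transition_smooth.

(** The second component contains a second derivative of the transition map, which
    disappears for vertical vectors: these transform like tangent vectors of the
    base. *)
Lemma TJE c d u w : tdom c u -> tdom d u ->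
  TJ c d u w = (J c d u.1 w.1,
    'D_(w.1) (fun x => 'D_((tch c u).2) (ch d \o cinv c) x) (ch c u.1) + J c d u.1 w.2).
Proof.
move=> cu du; have sT := @chart_transition_smooth c d.
have ov : overlap dom ch c d (tch c u).1 by exact: overlap_mem.
have nO : \forall z \near tch c u, overlap tdom tch c d z.
  exact: (overlap_near tchart_overlap_open).
have dT x : overlap dom ch c d x -> differentiable (ch d \o cinv c) x.
  exact: smooth_on_differentiable.
have dD v x : overlap dom ch c d x -> differentiable ('D_v (ch d \o cinv c)) x.
  by apply: smooth_on_differentiable; exact: smooth_on_derive.
have d1 : differentiable (fun z : Z => (ch d \o cinv c) z.1) (tch c u).
  apply: (@differentiable_comp _ _ _ _ (fst : Z -> V) (ch d \o cinv c)).
    exact: fst_differentiable.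
  exact: dT.
have nl : \forall z \near tch c u, linear (fun v => 'D_v (ch d \o cinv c) (z : Z).1).
  apply: filterS nO; rewrite tchart_overlapE => z Tz; apply: derive_linear_dir.
  exact: dT.
have d2 v : differentiable (fun z : Z => 'D_v (ch d \o cinv c) z.1) (tch c u).
  apply: (@differentiable_comp _ _ _ _ (fst : Z -> V) ('D_v (ch d \o cinv c))).
    exact: fst_differentiable.
  exact: dD.
have d3 := differentiable_eval (frame_rV n) nl d2 (snd_differentiable _).
rewrite {1}/jac -deriveE; last exact: (transition_differentiable tchart_transition_smooth).
transitivity ('D_w (fun z : Z => ((ch d \o cinv c) z.1, 'D_(z.2) (ch d \o cinv c) z.1)) (tch c u)).
  apply: near_eq_derive; apply: filterS nO; rewrite tchart_overlapE => z Tz.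
  exact: tchart_transitionE.
have E v : 'D_v (ch d \o cinv c) (ch c u.1) = J c d u.1 v by rewrite deriveE//; exact: dT.
rewrite (derive_pair _ d1 d3) (derive_eval (frame_rV n) _ nl d2 (snd_differentiable _)).
rewrite (derive_comp _ (fst_differentiable _) (dT _ ov)) derive_linear ?E; last first.
  exact: fst_linear_continuous.
rewrite (derive_comp _ (fst_differentiable _) (dD _ _ ov)) !derive_linear ?E//.
  exact: snd_linear_continuous.
exact: fst_linear_continuous.
Qed.

Lemma image_near c u : tdom c u -> \forall z \near tch c u, overlap tdom tch c c z.
Proof. by move=> cu; exact: (overlap_near tchart_overlap_open). Qed.

Lemma rhoE u w : rho u w = w.1.
Proof.
have cu : tdom (tchart_at u) u by exact: chart_at_mem.
have E : \forall z \near zat u, (z : Z).1 = ch (tchart_at u) (tinv (tchart_at u) z).1.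
  by apply: filterS (image_near cu) => _ [q [cq _] <-]; rewrite tchartK.
rewrite /rho (near_eq_d E (fst_differentiable _)) diff_lin//.
exact: fst_linear_continuous.
Qed.

Lemma gamE u v : gam u v = (0, v).
Proof.
have cp := chart_at_mem u.1.
rewrite /gam (_ : (fun y => _) = (fun y : V => (ch (tchart_at u) u.1, y))); last first.
  by apply/funext => y; rewrite /tchart /= tcoordE Jid.
have dc := differentiable_cst (ch (tchart_at u) u.1 : V) u.2.
have di := differentiable_id u.2.
rewrite -deriveE; last exact: differentiable_pair.
by rewrite (derive_pair _ dc di) derive_cst derive_id.
Qed.

Lemma ttcoord_fst c u w : tdom c u -> (ttcoord c u w).1 = tcoord c u.1 (rho u w).
Proof. by move=> cu; rewrite rhoE ttcoordE TJE//; exact: chart_at_mem. Qed.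

Lemma ttcoord_gam c u v : tdom c u -> ttcoord c u (gam u v) = (0, tcoord c u.1 v).
Proof.
move=> cu; rewrite gamE ttcoordE TJE//=; last exact: chart_at_mem.
by rewrite /jac linear0 derive0 add0r.
Qed.

Lemma pifield_repE X c u : tdom c u -> pifield_rep X c (tch c u) = tcoord c u.1 (X u).
Proof. by move=> cu; rewrite /pifield_rep tchartK. Qed.

Lemma field_repE X c u : tdom c u -> field_rep X c (tch c u) = ttcoord c u (X u).
Proof. by move=> cu; rewrite /field_rep tchartK. Qed.

Lemma fun_repE (f : funTM M) c u : tdom c u -> fun_rep f c (tch c u) = f u.
Proof. by move=> cu; rewrite /fun_rep tchartK. Qed.

Lemma eta_repE c z : overlap tdom tch c c z -> pifield_rep eta c z = z.2.
Proof. by move=> [u [cu _] <-]; rewrite pifield_repE. Qed.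

Lemma fun_near_chart c u (f : funTM M) : tdom c u ->
  smooth_near (tch c u) (fun_rep f c) -> fun_near u f.
Proof.
move=> cu sf d du.
exact: (smooth_near_transition frameZ tchartK tchart_overlap_open
    tchart_transition_smooth du cu sf).
Qed.

(** Smoothness is required in all charts around the point; the transition maps carry
    it from one of them to the others. *)
Lemma pifield_near_chart c u (X : pifield M) : tdom c u ->
  smooth_near (tch c u) (pifield_rep X c) -> pifield_near u X.
Proof.
move=> cu sX d du.
have sX' : smooth_near (tch d u) ((fun u' => tcoord c u'.1 (X u')) \o tinv d).
  exact: (smooth_near_transition frameZ tchartK tchart_overlap_open
      tchart_transition_smooth du cu sX).
have oT := @tchart_overlap_open d c.
have dcu : overlap tdom tch d c (tch d u) by exact: overlap_mem.
pose l (z : Z) v := J c d (cinv d z.1) v.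
have lA v : smooth_on (overlap tdom tch d c) (l ^~ v).
  apply: (@smooth_on_comp _ _ _ _ (frame_rV n) _ (overlap dom ch d c)
      (fun x => J c d (cinv d x) v) (fst : Z -> V) oT).
  - by move=> z; rewrite tchart_overlapE.
  - apply: smooth_on_local => _ [q [dq cq] <-].
    have := smooth_near_jac (@chartK R n M) chart_overlap_open chart_transition_smooth v cq dq.
    exact: (smooth_near_transition (frame_rV n)
        (@chartK R n M) chart_overlap_open chart_transition_smooth (f := fun p => J c d p v) dq cq).
  - exact: fst_smooth.
have ll (z : Z) : overlap tdom tch d c z -> linear (l z) by move=> _; exact: jac_linear.
apply: smooth_near_eq (smooth_near_eval (frame_rV n) oT dcu ll lA sX').
apply: filterS (open_nbhs_nbhs (conj oT dcu)) => _ [q [dq cq] <-].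
rewrite /l /= tchartK// pifield_repE// chartK// !tcoordE Jcomp//.
exact: chart_at_mem.
Qed.

Lemma field_near_chart c u (X : field M) : tdom c u ->
  smooth_near (tch c u) (field_rep X c) -> field_near u X.
Proof.
move=> cu sX d du.
have sX' : smooth_near (tch d u) ((fun u' => ttcoord c u' (X u')) \o tinv d).
  exact: (smooth_near_transition frameZ tchartK tchart_overlap_open
      tchart_transition_smooth du cu sX).
have oT := @tchart_overlap_open d c.
have dcu : overlap tdom tch d c (tch d u) by exact: overlap_mem.
pose l (z : Z) v := TJ c d (tinv d z) v.
have lA v : smooth_on (overlap tdom tch d c) (l ^~ v).
  apply: smooth_on_local => _ [q [dq cq] <-].
  have := smooth_near_jac tchartK tchart_overlap_open tchart_transition_smooth v cq dq.
  exact: (smooth_near_transition frameZ tchartK tchart_overlap_open tchart_transition_smooth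
      (f := fun u => TJ c d u v) dq cq).
have ll (z : Z) : overlap tdom tch d c z -> linear (l z) by move=> _; exact: jac_linear.
apply: smooth_near_eq (smooth_near_eval frameZ oT dcu ll lA sX').
apply: filterS (open_nbhs_nbhs (conj oT dcu)) => _ [q [dq cq] <-].
rewrite /l /= tchartK// field_repE// !ttcoordE TJcomp//.
exact: chart_at_mem.
Qed.

Lemma dfun_chart c u w (f : funTM M) : tdom c u -> differentiable (fun_rep f c) (tch c u) ->
  dfun u w f = 'd (fun_rep f c) (tch c u) (ttcoord c u w).
Proof.
move=> cu df; have au : tdom (tchart_at u) u by exact: chart_at_mem.
have [_ E] := d_transition tchartK tchart_overlap_open tchart_transition_smooth (f := f) w au cu df.
exact: E.
Qed.

Definition pifield_of c (Y : Z -> V) : pifield M := fun u => J c (chart_at u.1) u.1 (Y (tch c u)).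
Definition field_of c (X : Z -> Z) : field M := fun u => TJ c (tchart_at u) u (X (tch c u)).

Lemma pifield_of_rep c Y z : overlap tdom tch c c z -> pifield_rep (pifield_of c Y) c z = Y z.
Proof.
move=> [u [cu _] <-]; rewrite pifield_repE// /pifield_of tcoordE Jcancel//.
exact: chart_at_mem.
Qed.

Lemma field_of_rep c X z : overlap tdom tch c c z -> field_rep (field_of c X) c z = X z.
Proof.
move=> [u [cu _] <-]; rewrite field_repE// /field_of ttcoordE TJcancel//.
exact: chart_at_mem.
Qed.

Lemma pifield_of_near c Y u : tdom c u -> smooth_near (tch c u) Y ->
  pifield_near u (pifield_of c Y).
Proof.
move=> cu sY; apply: (pifield_near_chart cu); apply: smooth_near_eq sY.
by apply: filterS (image_near cu) => z iz; rewrite pifield_of_rep.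
Qed.

Lemma field_of_near c X u : tdom c u -> smooth_near (tch c u) X -> field_near u (field_of c X).
Proof.
move=> cu sX; apply: (field_near_chart cu); apply: smooth_near_eq sX.
by apply: filterS (image_near cu) => z iz; rewrite field_of_rep.
Qed.

Lemma pifield_near_add u (X Y : pifield M) :
  pifield_near u X -> pifield_near u Y -> pifield_near u (fun u' => X u' + Y u').
Proof.
move=> sX sY c cu; have := smooth_near_add (sX c cu) (sY c cu).
congr (smooth_near _ _); apply/funext => z; rewrite /pifield_rep /tcoord.
by rewrite linearD.
Qed.

Lemma pifield_near0 u : pifield_near u (fun _ : TM M => 0).
Proof.
move=> c cu; have := smooth_near_const (tch c u) (0 : V).
congr (smooth_near _ _); apply/funext => z; rewrite /pifield_rep /tcoord.
by rewrite linear0.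
Qed.

Lemma pifield_near_scale u (f : funTM M) (X : pifield M) :
  fun_near u f -> pifield_near u X -> pifield_near u (fun u' => (f u' : R) *: X u').
Proof.
move=> sf sX c cu; have := smooth_near_scale (sf c cu) (sX c cu).
congr (smooth_near _ _); apply/funext => z; rewrite /pifield_rep /tcoord.
by rewrite linearZ.
Qed.

Lemma pifield_near_sum u (I : Type) (s : seq I) (X : I -> pifield M) :
  (forall i, pifield_near u (X i)) -> pifield_near u (fun u' => \sum_(i <- s) X i u').
Proof.
move=> sX; elim: s => [|i s IH].
  rewrite (_ : (fun u' => _) = (fun _ => 0)); first exact: pifield_near0.
  by apply/funext => u'; rewrite big_nil.
rewrite (_ : (fun u' => _) = (fun u' => X i u' + \sum_(i <- s) X i u')).
  exact: pifield_near_add.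
by apply/funext => u'; rewrite big_cons.
Qed.

End Manifold.

(** * Christoffel coefficients of a linear connection *)

Section Connection.
Context {R : realType} {n : nat} {M : manifold R n}.
Local Notation V := 'rV[R]_n.
Local Notation Z := (V * V)%type.
Local Notation dom := (@chart_dom R n M).
Local Notation ch := (@chart R n M).
Local Notation cinv := (@chart_inv R n M).
Local Notation tch := (@tchart R n M).
Local Notation tinv := (@tchart_inv R n M).
Local Notation tdom := tchart_dom.
Local Notation J := (jac ch cinv).
Local Notation TJ := (jac tch tinv).
Implicit Types (c d : chart_index M) (p : M) (u : TM M) (X Y : pifield M).

Lemma tcoord_inj c p : dom c p -> injective (tcoord c p).
Proof.
move=> cp v w E; rewrite -(Jcancel v (chart_at_mem p) cp) -(Jcancel w (chart_at_mem p) cp).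
by rewrite -!tcoordE E.
Qed.

Lemma tcoordK c p v : dom c p -> tcoord c p (J c (chart_at p) p v) = v.
Proof. by move=> cp; rewrite tcoordE Jcancel//; exact: chart_at_mem. Qed.

Lemma ttcoordK c u w : tdom c u -> ttcoord c u (TJ c (tchart_at u) u w) = w.
Proof. by move=> cu; rewrite ttcoordE TJcancel//; exact: chart_at_mem. Qed.

Section OneConnection.
Variable D : connection M.
Hypothesis hD : linear_connection D.

Lemma connD u w w' Y : slit u -> pifield_near u Y -> D u (w + w') Y = D u w Y + D u w' Y.
Proof. by move=> su sY; have := conn_linear hD 1 w w' su sY; rewrite !scale1r. Qed.

Lemma conn_zero u w : slit u -> D u w (fun _ => 0) = 0.
Proof.
move=> su; have s0 : pifield_near u (fun _ : TM M => 0 : V) by exact: pifield_near0.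
have := conn_add hD w su s0 s0.
rewrite (_ : (fun u' : TM M => 0 + 0 : V) = (fun _ => 0)).
  by move=> E; apply: (@addrI _ (D u w (fun _ => 0))); rewrite -E addr0.
by apply/funext => u'; rewrite addr0.
Qed.

Lemma conn_sum u w (I : Type) (s : seq I) (Y : I -> pifield M) : slit u ->
  (forall i, pifield_near u (Y i)) ->
  D u w (fun u' => \sum_(i <- s) Y i u') = \sum_(i <- s) D u w (Y i).
Proof.
move=> su sY; elim: s => [|i s IH].
  rewrite big_nil (_ : (fun u' => _) = (fun _ => 0)) ?conn_zero//.
  by apply/funext => u'; rewrite big_nil.
rewrite big_cons -IH -(conn_add hD w su (sY i) (pifield_near_sum s sY)).
by congr (D u w _); apply/funext => u'; rewrite big_cons.
Qed.

(** The Leibniz rule is applied to the indicator function of a neighbourhood on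
    which the fields agree: it is smooth near the point, with derivative zero
    there, and this is all that the rule requires. *)
Lemma conn_germ c u w X Y : slit u -> tdom c u -> pifield_near u X -> pifield_near u Y ->
  (\forall z \near tch c u, pifield_rep X c z = pifield_rep Y c z) ->
  D u w X = D u w Y.
Proof.
move=> su cu sX sY XY.
pose N := interior [set z | pifield_rep X c z = pifield_rep Y c z] `&` overlap tdom tch c c.
have oN : open N by apply: openI; [exact: open_interior|exact: tchart_overlap_open].
have Nu : N (tch c u) by split => //; exact: overlap_mem.
pose f : funTM M := fun u' => if `[< tdom c u' /\ N (tch c u') >] then 1 else 0.
have f1 z : N z -> 1 = fun_rep f c z.
  move=> Nz; have [q [cq _] qz] := Nz.2; rewrite /fun_rep /f -qz tchartK//.
  by rewrite asboolT// qz.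
have sf : fun_near u f.
  apply: (fun_near_chart cu); exists N; split => //.
  apply: (smooth_on_eq oN (f := fun _ => 1 : R^o)) => //.
  exact: smooth_on_const.
have fu : f u = 1 by rewrite /f asboolT.
have df0 : dfun u w f = 0.
  have E : \forall z \near tch c u, (fun _ => 1 : R^o) z = fun_rep f c z.
    by apply: filterS (open_nbhs_nbhs (conj oN Nu)) => z /f1.
  have d1 := differentiable_cst (1 : R^o) (tch c u).
  rewrite (dfun_chart w cu); last exact: near_eq_differentiable E d1.
  by rewrite (near_eq_d E d1) -deriveE// derive_cst.
have fXY : (fun u' => (f u' : R) *: X u') = (fun u' => (f u' : R) *: Y u').
  apply/funext => u'; rewrite /f; case: asboolP => [[cu' [+ _]]|_]; last by rewrite !scale0r.
  move=> /interior_subset /=; rewrite !pifield_repE// => E.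
  by congr (_ *: _); exact: tcoord_inj cu' _ _ E.
have := conn_leibniz hD w su sf sX; have := conn_leibniz hD w su sf sY.
by rewrite fXY df0 fu !scale0r !add0r !scale1r => -> ->.
Qed.

Definition christoffel c (z w : Z) (a : V) : V :=
  let u := tinv c z in
  tcoord c u.1 (D u (TJ c (tchart_at u) u w) (pifield_of c (fun _ => a))).

Lemma pifield_of_const_near c u (a : V) : tdom c u -> pifield_near u (pifield_of c (fun _ => a)).
Proof. by move=> cu; apply: pifield_of_near => //; exact: smooth_near_const. Qed.

Lemma christoffelE c u w a : tdom c u ->
  christoffel c (tch c u) (ttcoord c u w) a = tcoord c u.1 (D u w (pifield_of c (fun _ => a))).
Proof.
move=> cu; rewrite /christoffel tchartK//= ttcoordE TJcancel//; exact: chart_at_mem.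
Qed.

Lemma christoffel_linear_dir c u a : slit u -> tdom c u ->
  linear (fun w => christoffel c (tch c u) w a).
Proof.
move=> su cu k w w'; rewrite /christoffel tchartK//=.
rewrite jacD jacZ (conn_linear hD _ _ _ su); last exact: pifield_of_const_near.
by rewrite /tcoord linearP.
Qed.

Lemma christoffel_linear_arg c u w : slit u -> tdom c u ->
  linear (christoffel c (tch c u) w).
Proof.
move=> su cu k a b; rewrite /christoffel tchartK//=.
set w' := TJ _ _ _ _.
have sa := pifield_of_const_near a cu; have sb := pifield_of_const_near b cu.
have sk : fun_near u (fun _ : TM M => k : R^o).
  by apply: (fun_near_chart cu); exact: smooth_near_const.
have dk : dfun u w' (fun _ : TM M => k : R^o) = 0.
  have d1 := differentiable_cst (k : R^o) (tch c u).
  by rewrite (dfun_chart _ cu) ?/fun_rep -?deriveE ?derive_cst.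
have := conn_leibniz hD w' su sk sa; rewrite dk scale0r add0r => Ea.
have := conn_add hD w' su (pifield_near_scale sk sa) sb; rewrite Ea.
rewrite (_ : (fun u' => _) = pifield_of c (fun _ => k *: a + b)); last first.
  by apply/funext => u'; rewrite /pifield_of jacD jacZ.
by move=> ->; rewrite /tcoord linearP.
Qed.

(** Near the point the field is a combination of fields with constant
    representatives, to which the Leibniz rule applies; the two fields need not
    agree far away, whence the use of [conn_germ]. *)
Lemma connection_chart c u w X : slit u -> tdom c u -> pifield_near u X ->
  tcoord c u.1 (D u w X) =
  'd (pifield_rep X c) (tch c u) (ttcoord c u w) +
  christoffel c (tch c u) (ttcoord c u w) (tcoord c u.1 (X u)).
Proof.
move=> su cu sX.
pose e i := pifield_of c (fun _ => delta_mx 0 i : V).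
pose f (i : 'I_n) : funTM M := fun u' => coord_linear i (pifield_rep X c (tch c u')).
have dX := smooth_near_differentiable (sX c cu).
have fE i : \forall z \near tch c u, coord_linear i (pifield_rep X c z) = fun_rep (f i) c z.
  by apply: filterS (image_near cu) => _ [q [cq _] <-]; rewrite fun_repE.
have sf i : fun_near u (f i).
  apply: (fun_near_chart cu); apply: smooth_near_eq (fE i) _.
  have [A [oA Ax sA]] := sX c cu; exists A; split => //.
  by apply: smooth_on_linear_comp => //; exact: coord_linear_continuous.
have se i : pifield_near u (e i) by exact: pifield_of_const_near.
have dE i : differentiable (fun z => coord_linear i (pifield_rep X c z)) (tch c u).
  apply: (@differentiable_comp _ _ _ _ (pifield_rep X c) (coord_linear i)) => //.
  by apply: linear_differentiable; exact: coord_linear_continuous.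
have df i : dfun u w (f i) = coord_linear i ('d (pifield_rep X c) (tch c u) (ttcoord c u w)).
  rewrite (dfun_chart w cu); last exact: near_eq_differentiable (fE i) (dE i).
  rewrite (near_eq_d (fE i) (dE i)) -!deriveE// derive_linear_comp//.
  exact: coord_linear_continuous.
have sfe i : pifield_near u (fun u' => (f i u' : R) *: e i u').
  exact: pifield_near_scale.
have germ : D u w X = D u w (fun u' => \sum_i (f i u' : R) *: e i u').
  apply: (conn_germ w su cu sX); first exact: pifield_near_sum.
  apply: filterS (image_near cu) => _ [q [cq _] <-]; rewrite !pifield_repE//.
  rewrite {1}(row_sum_delta (tcoord c q.1 (X q))) /tcoord linear_sum.
  apply: eq_bigr => i _; rewrite linearZ -/(tcoord c q.1 _) -/(tcoord c q.1 _) /f pifield_repE//.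
  by rewrite /e /pifield_of tcoordK.
rewrite germ conn_sum// /tcoord linear_sum -/(tcoord c u.1 _).
have fu i : f i u = coord_linear i (tcoord c u.1 (X u)) by rewrite /f pifield_repE.
transitivity (\sum_i (coord_linear i ('d (pifield_rep X c) (tch c u) (ttcoord c u w)) *:
    (delta_mx 0 i : V) +
   coord_linear i (tcoord c u.1 (X u)) *: christoffel c (tch c u) (ttcoord c u w) (delta_mx 0 i))).
  apply: eq_bigr => i _; rewrite (conn_leibniz hD w su (sf i) (se i)) df fu.
  rewrite linearD !linearZ christoffelE//; congr (_ *: _ + _).
  by rewrite -[LHS]/(tcoord c u.1 (e i u)) tcoordK.
rewrite big_split /= -[X in X + _ = _]/(\sum_i _) -row_sum_delta; congr (_ + _).
pose h : {linear V -> V} := HB.pack (christoffel c (tch c u) (ttcoord c u w))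
  (GRing.isLinear.Build _ _ _ _ _ (christoffel_linear_arg (ttcoord c u w) su cu)).
rewrite [in RHS](row_sum_delta (tcoord c u.1 (X u))) -[RHS]/(h _) linear_sum.
by apply: eq_bigr => i _; rewrite linearZ.
Qed.

End OneConnection.
End Connection.

(** * The metric in coordinates *)

Section MetricChart.
Context {R : realType} {n : nat} {M : manifold R n}.
Local Notation V := 'rV[R]_n.
Local Notation Z := (V * V)%type.
Local Notation dom := (@chart_dom R n M).
Local Notation ch := (@chart R n M).
Local Notation cinv := (@chart_inv R n M).
Local Notation tch := (@tchart R n M).
Local Notation tinv := (@tchart_inv R n M).
Local Notation tdom := tchart_dom.
Local Notation J := (jac ch cinv).
Local Notation TJ := (jac tch tinv).
Implicit Types (c d : chart_index M) (p : M) (u : TM M).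

Definition slit_image c : set Z := [set z | overlap tdom tch c c z /\ z.2 != 0].

Lemma tcoord_eq0 c p v : dom c p -> (tcoord c p v == 0) = (v == 0).
Proof.
move=> cp; apply/eqP/eqP => [E|->]; last by rewrite /tcoord linear0.
by apply: (tcoord_inj cp); rewrite E /tcoord linear0.
Qed.

Lemma slit_image_tchart c u : tdom c u -> slit u -> slit_image c (tch c u).
Proof.
move=> cu su; split; first exact: overlap_mem.
by rewrite /tchart /= tcoord_eq0.
Qed.

Lemma slit_imageP c z : slit_image c z -> exists u, [/\ tdom c u, slit u & tch c u = z].
Proof.
move=> [[u [cu _] <-]] u0; exists u; split => //.
by move: u0; rewrite /tchart /= tcoord_eq0.
Qed.

Lemma nonzero_open : open [set v : V | v != 0].
Proof.
rewrite (_ : [set v | _] = ~` [set 0]).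
  by apply: closed_openC; apply: accessible_closed_set1; apply: hausdorff_accessible;
      exact: norm_hausdorff.
by apply/seteqP; split => v /= /eqP.
Qed.

Lemma slit_image_open c : open (slit_image c).
Proof.
apply: openI; first exact: tchart_overlap_open.
apply: (@open_comp _ _ (snd : Z -> V) [set v : V | v != 0]); last exact: nonzero_open.
by move=> z _; exact: cvg_snd.
Qed.

Lemma slit_image_near c u : tdom c u -> slit u -> \forall z \near tch c u, slit_image c z.
Proof.
by move=> cu su; apply: open_nbhs_nbhs; split; [exact: slit_image_open|exact: slit_image_tchart].
Qed.

Definition vertical_hessian (F : Z -> R^o) (z : Z) (a b : V) : R :=
  2^-1 * ('D_(0, a) (fun z => 'D_(0, b) F z) z : R).

Section Hessian.
Variables (O : set Z) (F : Z -> R^o).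
Hypothesis oO : open O.
Hypothesis sF : smooth_on O F.

Lemma vertical_hessian_sym z a b : O z -> vertical_hessian F z a b = vertical_hessian F z b a.
Proof. by move=> Oz; rewrite /vertical_hessian (derive_swap_scalar _ _ oO sF Oz). Qed.

Lemma vertical_hessian_linear z a : O z -> linear (vertical_hessian F z a : V -> R^o).
Proof.
move=> Oz k b b'; rewrite !(@vertical_hessian_sym z a)// /vertical_hessian.
have dF : differentiable ('D_(0, a) F) z.
  exact: smooth_on_differentiable (smooth_on_derive _ sF) Oz.
rewrite -[(0, k *: b + b')]/(((0, k *: b + b') : Z)).
have -> : ((0, k *: b + b') : Z) = k *: (0, b) + (0, b').
  by congr pair; rewrite /= scaler0 addr0.
rewrite (derive_linear_dir dF).
by rewrite -[RHS]/(k * _ + _) mulrDr mulrCA.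
Qed.

Lemma vertical_hessian_smooth a b : smooth_on O (fun z => vertical_hessian F z a b : R^o).
Proof.
apply: (@smooth_on_scale _ _ _ O (fun _ => 2^-1 : R^o)
    (fun z => 'D_(0, a) (fun z => 'D_(0, b) F z) z)) => //.
  exact: smooth_on_const.
by do 2 apply: smooth_on_derive.
Qed.

Lemma vertical_hessian_third z v a b : O z ->
  'D_(0, v) (fun z => vertical_hessian F z a b : R^o) z =
  'D_(0, a) (fun z => vertical_hessian F z v b : R^o) z.
Proof.
move=> Oz.
have E (u w : V) : 'D_(0, u) (fun z => vertical_hessian F z w b : R^o) z =
    2^-1 *: 'D_(0, u) (fun z => 'D_(0, w) (fun z => 'D_(0, b) F z) z) z.
  apply: (@deriveZ _ _ _ (fun z => 'D_(0, w) (fun z => 'D_(0, b) F z) z) 2^-1).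
  apply: diff_derivable; apply: smooth_on_differentiable Oz.
  by do 2 apply: smooth_on_derive.
have S := derive_swap_scalar (0, a) (0, v) oO (smooth_on_derive (0, b) sF) Oz.
exact: etrans (E v a) (etrans (congr1 (fun r : R^o => (2^-1 : R) *: r) S) (esym (E a v))).
Qed.

End Hessian.

(** A derivative in a fibre direction lowers the degree of homogeneity by one. *)
Lemma derive_slit_homogeneous (O : set Z) (F : Z -> R^o) (k : R -> R) (b : V) :
  open O -> smooth_on O F ->
  (forall (t : R) (z : Z), 0 < t -> O z -> O ((z.1, t *: z.2) : Z)) ->
  (forall (t : R) (z : Z), 0 < t -> O z -> F (z.1, t *: z.2) = k t *: F z) ->
  forall (t : R) (z : Z), 0 < t -> O z ->
    'D_(0, b) F (z.1, t *: z.2) = (k t / t) *: 'D_(0, b) F z.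
Proof.
move=> oO sF ray hom t z t0 Oz.
pose m (z : Z) : Z := (z.1, t *: z.2).
have dsnd := differentiable_scale (differentiable_cst (t : R^o) z) (snd_differentiable z).
have dm : differentiable m z by apply: differentiable_pair => //; exact: fst_differentiable.
have dF y : O y -> differentiable F y by exact: smooth_on_differentiable.
have Dm : 'D_(0, b) m z = t *: ((0, b) : Z).
  rewrite (derive_pair _ (fst_differentiable z) dsnd).
  rewrite derive_linear; last exact: fst_linear_continuous.
  rewrite (derive_scale _ (differentiable_cst _ _) (snd_differentiable z)) derive_cst scale0r add0r.
  rewrite derive_linear /=; last exact: snd_linear_continuous.
  by congr pair; rewrite scaler0.
have E : 'D_(0, b) (fun z => F (m z)) z = 'D_(0, b) (fun z => k t *: F z) z.
  by apply: (open_eq_derive _ oO Oz) => y Oy; rewrite hom.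
move: E; rewrite (derive_comp _ dm (dF _ (ray _ _ t0 Oz))) Dm.
rewrite (derive_dirZ _ _ (dF _ (ray _ _ t0 Oz))) (derive_constZ _ _ (dF _ Oz)) => E.
apply: (scalerI (lt0r_neq0 t0)); rewrite E scalerA; congr (_ *: _).
by rewrite mulrC divfK// gt_eqF.
Qed.

(** The derivative along the ray is that of a constant function of one variable. *)
Lemma derive_ray_constant (G : Z -> R^o) (z : Z) : differentiable G z ->
  (forall t : R, 0 < t -> G (z.1, t *: z.2) = G z) -> 'D_(0, z.2) G z = 0.
Proof.
move=> dG hG; pose v : Z := (0, z.2).
have z0 : z + (0 : R) *: v = z by rewrite scale0r addr0.
have dG0 : differentiable G (z + (0 : R) *: v) by rewrite z0.
have [_] := is_derive_line dG0; rewrite z0 => <-.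
rewrite -[RHS](derive_cst (G z) (0 : R^o) (1 : R^o)); apply: near_eq_derive.
have n0 : \forall t \near (0 : R), -1 < t by apply: lt_nbhsr; rewrite ltrN10.
apply: filterS n0 => t t1.
have -> : z + t *: v = (z.1, (1 + t) *: z.2).
  rewrite scalerDl scale1r /v; case: (z) => x y /=.
  by rewrite -[LHS]/((x + t *: 0, y + t *: y) : Z) scaler0 addr0.
by rewrite hG// -ltrBlDl sub0r.
Qed.

Lemma vertical_hessian_homogeneous (O : set Z) (F : Z -> R^o) (a b : V) :
  open O -> smooth_on O F ->
  (forall (t : R) (z : Z), 0 < t -> O z -> O ((z.1, t *: z.2) : Z)) ->
  (forall (t : R) (z : Z), 0 < t -> O z -> F (z.1, t *: z.2) = (t ^+ 2) *: F z) ->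
  forall z, O z -> 'D_(0, z.2) (fun z => vertical_hessian F z a b : R^o) z = 0.
Proof.
move=> oO sF ray hom z Oz.
have h1 := derive_slit_homogeneous b oO sF ray hom.
have h2 := derive_slit_homogeneous a oO (smooth_on_derive (0, b) sF) ray h1.
pose G z : R^o := vertical_hessian F z a b.
have hG t : 0 < t -> G (z.1, t *: z.2) = G z.
  move=> t0; rewrite /G /vertical_hessian (h2 t z t0 Oz).
  rewrite (_ : t ^+ 2 / t / t = 1) ?scale1r//.
  by rewrite expr2 mulfK ?divff// gt_eqF.
have dG : differentiable G z.
  exact: smooth_on_differentiable (vertical_hessian_smooth oO sF a b) Oz.
exact: derive_ray_constant dG hG.
Qed.

Lemma slit_image_ray c (t : R) (z : Z) : 0 < t -> slit_image c z ->
  slit_image c ((z.1, t *: z.2) : Z).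
Proof.
move=> t0 [+ z0]; rewrite tchart_overlapE => oz; split; first by rewrite tchart_overlapE.
by rewrite /= scaler_eq0 negb_or z0 gt_eqF.
Qed.

Section Metric.
Variables (c : chart_index M) (L : funTM M) (F : Z -> R^o).
Hypothesis FE : forall z, slit_image c z -> L (tinv c z) ^+ 2 = F z.
Hypothesis sF : smooth_on (slit_image c) F.
Let oO := @slit_image_open c.

(** The metric is defined by second derivatives in the preferred coordinates of a
    single tangent space; on it, another chart induces linear coordinates, so that
    the second derivatives transform bilinearly.  The hypotheses bear on the square
    of [L] because this is what is known of the changed energy. *)
Lemma metric_chart u v w : tdom c u -> slit u ->
  metric L u v w = vertical_hessian F (tch c u) (tcoord c u.1 v) (tcoord c u.1 w).
Proof.
case: u => p y /= cp y0.
have dA : differentiable (ch c \o cinv (chart_at p)) (ch (chart_at p) p).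
  by apply: (transition_differentiable chart_transition_smooth) => //; exact: chart_at_mem.
pose l : {linear V -> V} := 'd (ch c \o cinv (chart_at p)) (ch (chart_at p) p).
have cl : continuous l by exact: diff_continuous.
pose i (y : V) : Z := (ch c p, l y).
have di y' : differentiable i y'.
  by apply: differentiable_pair; [exact: differentiable_cst|exact: linear_differentiable].
have Di y' a : 'D_a i y' = (0, l a).
  rewrite (derive_pair _ (differentiable_cst _ _) (linear_differentiable _ cl)).
  by rewrite derive_cst derive_linear.
have Oi (y' : V) : y' != 0 -> slit_image c (i y').
  by move=> y'0; exact: (@slit_image_tchart c (p, y')).
have step (f : V -> R^o) (G : Z -> R^o) (a : V) : smooth_on (slit_image c) G ->
    (forall y', y' != 0 -> f y' = G (i y')) ->
    forall y', y' != 0 -> 'D_a f y' = 'D_(0, l a) G (i y').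
  move=> sG fG y' y'0; rewrite (open_eq_derive a nonzero_open y'0 fG).
  rewrite (derive_comp _ (di y') (smooth_on_differentiable sG (Oi _ y'0))).
  by rewrite Di.
have fF (y' : V) : y' != 0 -> (L (p, y') ^+ 2 : R^o) = F (i y').
  by move=> y'0; rewrite -FE ?(@tchartK _ _ _ c (p, y'))//; exact: Oi.
have coefE a b : metric_coef L (p, y) a b =
    vertical_hessian F (i y) (l (delta_mx 0 a)) (l (delta_mx 0 b)).
  apply: (congr1 (fun r : R => 2^-1 * r)).
  exact: (step _ _ _ (smooth_on_derive _ sF) (step _ _ _ sF fF) y y0).
have iO := Oi _ y0.
pose h z : {linear V -> R^o} := HB.pack (vertical_hessian F (i y) z)
  (GRing.isLinear.Build _ _ _ _ _ (vertical_hessian_linear oO sF z iO)).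
have hE a b : vertical_hessian F (i y) a b = h a b by [].
have hC a b : h a b = h b a by rewrite -!hE; exact: (vertical_hessian_sym oO sF).
have sumE a (b : V) : h a (l b) = \sum_j b 0 j * h a (l (delta_mx 0 j)).
  rewrite {1}(row_sum_delta b) !linear_sum; apply: eq_bigr => j _.
  by rewrite !linearZ.
rewrite -[tch c (p, y)]/(i y) -[tcoord c p v]/(l v) -[tcoord c p w]/(l w) hE.
rewrite hC sumE /metric; apply: eq_bigr => a _.
rewrite hC sumE big_distrr /=; apply: eq_bigr => b _.
by rewrite coefE hE mulrC mulrA [RHS]mulrC mulrC -!mulrA; congr (_ * _); rewrite mulrC.
Qed.

End Metric.
Definition square_rep (L : funTM M) c (z : Z) : R^o := (fun_rep L c z : R) ^+ 2.

Lemma smooth_on_slit_image (W : normedModType R) c (f : Z -> W) :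
  (forall u, tdom c u -> slit u -> smooth_near (tch c u) f) -> smooth_on (slit_image c) f.
Proof. by move=> H; apply: smooth_on_local => _ /slit_imageP[u [cu su <-]]; exact: H. Qed.

Lemma square_rep_smooth (L : funTM M) c : smooth_fun L -> smooth_on (slit_image c) (square_rep L c).
Proof.
move=> sL; have sr : smooth_on (slit_image c) (fun_rep L c).
  by apply: smooth_on_slit_image => u cu su; exact: sL.
apply: (smooth_on_eq (@slit_image_open c) _ (smooth_on_scale (@slit_image_open c) sr sr)).
by move=> z _; rewrite /square_rep expr2.
Qed.

Definition metric_rep (L : funTM M) c := vertical_hessian (square_rep L c).

Lemma finsler_coefficients_chart (L : funTM M) c : finsler L ->
  finsler_coefficients (slit_image c) (metric_rep L c).
Proof.
move=> hL; have oO := @slit_image_open c.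
have sF := square_rep_smooth c (finsler_smooth hL).
split.
- exact: oO.
- by move=> z a Oz; exact: (vertical_hessian_linear oO sF).
- by move=> z a b Oz; exact: (vertical_hessian_sym oO sF).
- move=> _ a /slit_imageP[u [cu su <-]] a0.
  have := finsler_posdef hL (v := J c (chart_at u.1) u.1 a) su.
  rewrite (@metric_chart c L (square_rep L c))// tcoordK//; apply.
  by rewrite -(tcoord_eq0 _ cu) tcoordK.
- by move=> a b; exact: (vertical_hessian_smooth oO sF).
- by move=> z v a b Oz; exact: (vertical_hessian_third oO sF).
- move=> z a b Oz; apply: (vertical_hessian_homogeneous a b oO sF _ _ Oz).
    by move=> t y t0; exact: slit_image_ray.
  move=> t _ t0 /slit_imageP[u [cu su <-]].
  have E : tch c (u.1, t *: u.2) = ((tch c u).1, t *: (tch c u).2).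
    by rewrite /tchart /= /tcoord linearZ.
  rewrite -E /square_rep !fun_repE// (finsler_homog hL su t0) exprMn.
  by [].
Qed.

End MetricChart.

(** * Smoothness of matrix inverses *)

Section MatrixInverse.
Context {R : realType} {U : normedModType R}.
Variables (O : set U).
Hypothesis oO : open O.

Lemma smooth_det k (A : U -> 'M[R]_k) :
  (forall i j, smooth_on O (fun z => A z i j : R^o)) ->
  smooth_on O (fun z => \det (A z) : R^o).
Proof.
move=> sA; rewrite /determinant; apply: smooth_on_bigsum => // s.
apply: smooth_on_mul => //; first exact: smooth_on_const.
by apply: smooth_on_bigprod => // i; exact: sA.
Qed.

Lemma smooth_invmx k (A : U -> 'M[R]_k) :
  (forall z, O z -> A z \in unitmx) ->
  (forall i j, smooth_on O (fun z => A z i j : R^o)) ->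
  forall i j, smooth_on O (fun z => invmx (A z) i j : R^o).
Proof.
move=> uA sA i j.
have sdet := smooth_det sA.
have det0 z : O z -> \det (A z) != 0 by move=> /uA; rewrite unitmxE unitfE.
have E z : O z -> (\det (A z))^-1 * ((-1) ^+ (j + i) * \det (row' j (col' i (A z)))) =
    invmx (A z) i j.
  by move=> Oz; rewrite /invmx uA// !mxE.
apply: (smooth_on_eq oO E).
apply: smooth_on_mul => //; first exact: smooth_on_inv.
apply: smooth_on_mul => //; first exact: smooth_on_const.
apply: smooth_det => a b.
rewrite (_ : (fun z => _) = (fun z => A z (lift j a) (lift i b) : R^o)); first exact: sA.
by apply/funext => z; rewrite !mxE.
Qed.

Lemma unitmx_injective k (A : 'M[R]_k) : (forall v : 'rV_k, v *m A = 0 -> v = 0) -> A \in unitmx.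
Proof.
move=> inj; rewrite -row_free_unit -kermx_eq0; apply/eqP/row_matrixP => i.
by rewrite row0; apply: inj; rewrite -row_mul mulmx_ker row0.
Qed.

End MatrixInverse.

(** * The horizontal map and the torsion in coordinates *)

Section CartanChart.
Context {R : realType} {n : nat} {M : manifold R n}.
Local Notation V := 'rV[R]_n.
Local Notation Z := (V * V)%type.
Local Notation dom := (@chart_dom R n M).
Local Notation ch := (@chart R n M).
Local Notation cinv := (@chart_inv R n M).
Local Notation tch := (@tchart R n M).
Local Notation tinv := (@tchart_inv R n M).
Local Notation tdom := tchart_dom.
Local Notation J := (jac ch cinv).
Local Notation TJ := (jac tch tinv).
Implicit Types (c d : chart_index M) (p : M) (u : TM M).

Section Linear.
Variable D : connection M.
Hypothesis hD : linear_connection D.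
Local Notation G c := (christoffel D c).

Lemma christoffel_smooth c w a : smooth_on (slit_image c) (fun z => G c z w a).
Proof.
apply: smooth_on_slit_image => u cu su.
have sw : field_near u (field_of c (fun _ => w)) by apply: field_of_near => //;
    exact: smooth_near_const.
have sa : pifield_near u (pifield_of c (fun _ => a)) by exact: pifield_of_const_near.
exact: (conn_smooth hD su sw sa cu).
Qed.

Lemma eta_near u : pifield_near u (@eta R n M).
Proof.
have au : tdom (tchart_at u) u by exact: chart_at_mem.
apply: (pifield_near_chart au); apply: (@smooth_near_eq _ _ _ _ (snd : Z -> V)).
  by apply: filterS (image_near au) => z /eta_repE ->.
by exists setT; split; [exact: openT| |exact: snd_smooth].
Qed.

Lemma conn_map_chart c u w : slit u -> tdom c u ->
  tcoord c u.1 (conn_map D u w) =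
  (ttcoord c u w).2 + G c (tch c u) (ttcoord c u w) (tch c u).2.
Proof.
move=> su cu; rewrite /conn_map (connection_chart hD w su cu (@eta_near u)); congr (_ + _).
have E : \forall z \near tch c u, (z : Z).2 = pifield_rep eta c z.
  by apply: filterS (image_near cu) => z /eta_repE ->.
by rewrite (near_eq_d E (snd_differentiable _)) diff_lin//; exact: snd_linear_continuous.
Qed.

Lemma conn_mapB u w w' : slit u -> conn_map D u (w - w') = conn_map D u w - conn_map D u w'.
Proof.
move=> su; rewrite /conn_map addrC -scaleN1r (conn_linear hD _ _ _ su (@eta_near u)).
by rewrite scaleN1r addrC.
Qed.

Section Regular.
Hypothesis hR : regular D.

Lemma hmap_spec u v : slit u -> conn_map D u (hmap D u v) = 0 /\ rho u (hmap D u v) = v.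
Proof.
move=> su; have := @xgetPex _ 0 [set w : Z | conn_map D u w = 0 /\ rho u w = v].
apply; have [H _] := hR su; have [a [h [E a0 h0]]] := H (v, 0).
exists h; split => //; rewrite rhoE.
by move: a0; rewrite rhoE => a0; have := congr1 fst E; rewrite /= a0 add0r.
Qed.

Lemma hmap_unique u w v : slit u -> conn_map D u w = 0 -> rho u w = v -> hmap D u v = w.
Proof.
move=> su w0 wv; have [_ H] := hR su; have [h0 hv] := hmap_spec v su.
apply/subr0_eq/H; last by rewrite conn_mapB// h0 w0 subrr.
by move: hv wv; rewrite !rhoE /= => -> ->; rewrite subrr.
Qed.

(** Regularity says that the connection map is injective on vertical vectors, which
    in coordinates is a condition on the matrix below. *)
Lemma vertical_conn_map_inj c z v : slit_image c z -> v + G c z (0, v) z.2 = 0 -> v = 0.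
Proof.
move=> /slit_imageP[u [cu su <-]] E.
pose w := TJ c (tchart_at u) u (0, v).
have wE : ttcoord c u w = (0, v) by rewrite ttcoordK.
have w0 : w = 0.
  have [_ H] := hR su; apply: H.
    apply: (tcoord_inj cu); rewrite -ttcoord_fst// wE /=.
    by rewrite /tcoord linear0.
  by apply: (tcoord_inj cu); rewrite conn_map_chart// wE /= E /tcoord linear0.
have : (ttcoord c u w).2 = 0 by rewrite w0 /ttcoord linear0.
by rewrite wE.
Qed.

Definition vertical_conn_mx c (z : Z) : 'M[R]_n :=
  \matrix_(i < n) ((delta_mx 0 i : V) + G c z (0, delta_mx 0 i) z.2).

(** The horizontal lift of [a] is [(a, v)] with [v] solving a linear system with
    matrix [vertical_conn_mx]. *)
Definition hmap_rep c (z : Z) (a : V) : V :=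
  - (G c z (a, 0) z.2) *m invmx (vertical_conn_mx c z).

Lemma christoffelD1 c z w w' a : slit_image c z -> G c z (w + w') a = G c z w a + G c z w' a.
Proof.
move=> /slit_imageP[u [cu su <-]].
by have := christoffel_linear_dir hD a su cu 1 w w'; rewrite !scale1r.
Qed.

Lemma vertical_conn_mxE c z v : slit_image c z ->
  v *m vertical_conn_mx c z = v + G c z (0, v) z.2.
Proof.
move=> Oz; have [u [cu su uz]] := slit_imageP Oz.
have lin : linear (fun v : V => G c z (0, v) z.2).
  move=> k a b; rewrite -uz -(christoffel_linear_dir hD (tch c u).2 su cu).
  congr (G c _ _ _); congr pair; by rewrite /= scaler0 addr0.
pose h : {linear V -> V} := HB.pack (fun v : V => G c z (0, v) z.2)
  (GRing.isLinear.Build _ _ _ _ _ lin).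
rewrite -[G c z (0, v) z.2]/(h v) mulmx_sum_row.
rewrite {2 3}(row_sum_delta v) linear_sum -big_split; apply: eq_bigr => i _.
by rewrite rowK linearZ scalerDr.
Qed.

Lemma vertical_conn_mx_unit c z : slit_image c z -> vertical_conn_mx c z \in unitmx.
Proof.
move=> Oz; apply: unitmx_injective => v; rewrite vertical_conn_mxE//.
exact: vertical_conn_map_inj.
Qed.

Lemma hmap_chart c u v : slit u -> tdom c u ->
  ttcoord c u (hmap D u v) = (tcoord c u.1 v, hmap_rep c (tch c u) (tcoord c u.1 v)).
Proof.
move=> su cu; have Oz := slit_image_tchart cu su.
have [h0 hv] := hmap_spec v su.
have E1 : (ttcoord c u (hmap D u v)).1 = tcoord c u.1 v by rewrite ttcoord_fst// hv.
have := conn_map_chart (hmap D u v) su cu; rewrite h0.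
case: (ttcoord c u (hmap D u v)) E1 => a b /= ->.
set x := tcoord c u.1 v; rewrite [tcoord _ _ 0]linear0.
have sp : ((x, b) : Z) = (x, 0) + (0, b) by congr pair; rewrite ?addr0 ?add0r.
rewrite {1}sp christoffelD1// addrCA -vertical_conn_mxE// => /esym/eqP.
rewrite addrC addr_eq0 => /eqP E; congr pair.
by rewrite /hmap_rep -E mulmxK// vertical_conn_mx_unit.
Qed.

Lemma snd_of_smooth (W : normedModType R) (O : set Z) (l : Z -> V -> W) : open O ->
  (forall z, O z -> linear (l z)) -> (forall v, smooth_on O (l ^~ v)) ->
  smooth_on O (fun z => l z z.2).
Proof.
by move=> oO ll lO; apply: (smooth_on_eval (frame_rV n) oO ll lO); exact: snd_smooth.
Qed.

Lemma christoffel_eta_smooth c w : smooth_on (slit_image c) (fun z => G c z w z.2).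
Proof.
apply: (snd_of_smooth (l := fun z => G c z w) (@slit_image_open _ _ _ c))
    => [z /slit_imageP[u [cu su <-]]|a].
  exact: christoffel_linear_arg.
exact: christoffel_smooth.
Qed.

Lemma coord_smooth (O : set Z) (f : Z -> V) i : open O -> smooth_on O f ->
  smooth_on O (fun z => f z 0 i : R^o).
Proof.
by move=> oO sf; apply: smooth_on_linear_comp oO (@coord_linear_continuous _ _ i) sf.
Qed.

Lemma hmap_rep_smooth c a : smooth_on (slit_image c) (fun z => hmap_rep c z a).
Proof.
have oO := @slit_image_open _ _ _ c.
apply: (smooth_on_coef (F := frame_rV n)) => // j /=.
rewrite (_ : (fun z => _) = (fun z => \sum_i ((- G c z (a, 0) z.2) 0 i : R^o) *:
    (invmx (vertical_conn_mx c z) i j : R^o))); last first.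
  by apply/funext => z; rewrite /coord_linear /hmap_rep mxE.
apply: smooth_on_bigsum => // i; apply: smooth_on_scale => //.
  by apply: coord_smooth => //; apply: smooth_on_opp => //; exact: christoffel_eta_smooth.
apply: smooth_invmx => // [z|k l]; first exact: vertical_conn_mx_unit.
rewrite (_ : (fun z => _) = (fun z => ((delta_mx 0 k : V) + G c z (0, delta_mx 0 k) z.2) 0 l : R^o)).
  apply: coord_smooth => //; apply: smooth_on_add => //; first exact: smooth_on_const.
  exact: christoffel_eta_smooth.
by apply/funext => z; rewrite mxE.
Qed.

Lemma hmap_rep_linear c z (a b : V) (k : R) : slit_image c z ->
  hmap_rep c z (k *: a + b) = k *: hmap_rep c z a + hmap_rep c z b.
Proof.
move=> Oz; rewrite /hmap_rep scalemxAl -mulmxDl; congr (_ *m _).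
have [u [cu su uz]] := slit_imageP Oz.
have -> : ((k *: a + b, 0) : Z) = k *: (a, 0) + (b, 0).
  by congr pair; rewrite /= scaler0 addr0.
by rewrite -uz (christoffel_linear_dir hD _ su cu) opprD scalerN.
Qed.

(** The torsion involves the bracket of horizontal fields, whose derivatives make
    sense only once these fields are known to be smooth. *)
Lemma hmapf_near c u X : slit u -> tdom c u -> pifield_near u X -> field_near u (hmapf D X).
Proof.
move=> su cu sX; apply: (field_near_chart cu).
have oO := @slit_image_open _ _ _ c; have Oz := slit_image_tchart cu su.
apply: (@smooth_near_eq _ _ _ _ (fun z => (pifield_rep X c z, hmap_rep c z (pifield_rep X c z)))).
  apply: filterS (slit_image_near cu su) => _ /slit_imageP[q [cq sq <-]].
  by rewrite field_repE// hmap_chart// pifield_repE.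
have [A [oA Ax sA]] := sX c cu.
have sh : smooth_near (tch c u) (fun z => hmap_rep c z (pifield_rep X c z)).
  apply: (smooth_near_eval (frame_rV n) oO Oz _ (hmap_rep_smooth c)) (sX c cu).
  by move=> z Oz' k a b; exact: hmap_rep_linear.
have [B [oB Bx sB]] := sh; have oAB := openI oA oB.
exists (A `&` B); split => //; apply: smooth_on_pair => //.
  by apply: smooth_on_sub sA => z [].
by apply: smooth_on_sub sB => z [].
Qed.

End Regular.
End Linear.
End CartanChart.

(** * Torsion and curvature in coordinates *)

Section TorsionCurvature.
Context {R : realType} {n : nat} {M : manifold R n}.
Local Notation V := 'rV[R]_n.
Local Notation Z := (V * V)%type.
Local Notation dom := (@chart_dom R n M).
Local Notation ch := (@chart R n M).
Local Notation cinv := (@chart_inv R n M).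
Local Notation tch := (@tchart R n M).
Local Notation tinv := (@tchart_inv R n M).
Local Notation tdom := tchart_dom.
Local Notation J := (jac ch cinv).
Local Notation TJ := (jac tch tinv).
Implicit Types (c d : chart_index M) (p : M) (u : TM M).

Lemma rhof_near u (X : field M) : field_near u X -> pifield_near u (rhof X).
Proof.
move=> sX; have au : tdom (tchart_at u) u by exact: chart_at_mem.
apply: (pifield_near_chart au).
apply: (@smooth_near_eq _ _ _ _ (fun z => (field_rep X (tchart_at u) z).1)).
  apply: filterS (image_near au) => _ [q [aq _] <-].
  by rewrite field_repE// ttcoord_fst// pifield_repE.
have [A [oA Ax sA]] := sX _ au; exists A; split => //.
by apply: (@smooth_on_fst _ _ _ _ _ (field_rep X (tchart_at u)) oA sA).
Qed.

Lemma gamf_near u (X : pifield M) : pifield_near u X -> field_near u (gamf X).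
Proof.
move=> sX; have au : tdom (tchart_at u) u by exact: chart_at_mem.
apply: (field_near_chart au).
apply: (@smooth_near_eq _ _ _ _ (fun z => (0 : V, pifield_rep X (tchart_at u) z))).
  apply: filterS (image_near au) => _ [q [aq _] <-].
  by rewrite field_repE// ttcoord_gam// pifield_repE.
have [A [oA Ax sA]] := sX _ au; exists A; split => //.
by apply: smooth_on_pair => //; exact: smooth_on_const.
Qed.

Lemma tcoordB c p v w : tcoord c p (v - w) = tcoord c p v - tcoord c p w.
Proof. exact: linearB. Qed.

Lemma tcoord_at u v : tcoord (tchart_at u) u.1 v = v.
Proof. by rewrite tcoordE Jid//; exact: chart_at_mem. Qed.

Lemma ttcoord_at u w : ttcoord (tchart_at u) u w = w.
Proof. by rewrite ttcoordE TJid//; exact: chart_at_mem. Qed.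

Section Linear.
Variable D : connection M.
Hypothesis hD : linear_connection D.
Local Notation G c := (christoffel D c).

Lemma connection_at u w X : slit u -> pifield_near u X ->
  D u w X = 'd (pifield_rep X (tchart_at u)) (zat u) w + G (tchart_at u) (zat u) w (X u).
Proof.
move=> su sX; have au : tdom (tchart_at u) u by exact: chart_at_mem.
by have := connection_chart hD w su au sX; rewrite !tcoord_at ttcoord_at.
Qed.

(** The derivatives of the representatives cancel between the connection and the
    bracket; in the preferred chart at [u] all changes of coordinates are trivial. *)
Lemma torsion_at u (X Y : field M) : slit u -> field_near u X -> field_near u Y ->
  torsion D X Y u = G (tchart_at u) (zat u) (X u) (rho u (Y u)) -
                    G (tchart_at u) (zat u) (Y u) (rho u (X u)).
Proof.
move=> su sX sY; have au : tdom (tchart_at u) u by exact: chart_at_mem.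
rewrite /torsion !connection_at//; try exact: rhof_near.
rewrite [rho u (bracket X Y u)]rhoE /bracket.
have rep (W : field M) : \forall z \near zat u,
    (field_rep W (tchart_at u) z).1 = pifield_rep (rhof W) (tchart_at u) z.
  apply: filterS (image_near au) => _ [q [aq _] <-].
  by rewrite field_repE// ttcoord_fst// pifield_repE.
have proj (W : field M) w : field_near u W ->
    ('d (field_rep W (tchart_at u)) (zat u) w).1 =
    'd (pifield_rep (rhof W) (tchart_at u)) (zat u) w.
  move=> sW; have dW : differentiable (field_rep W (tchart_at u)) (zat u).
    exact: (smooth_near_differentiable (sW _ au)).
  exact: (d_fst w dW (rep W)).
rewrite -[(_ - _).1]/((('d (field_rep Y (tchart_at u)) (zat u) (X u)).1) -
  (('d (field_rep X (tchart_at u)) (zat u) (Y u)).1)).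
rewrite (proj X _ sX) (proj Y _ sY) /rhof.
by apply/rowP => i; rewrite !mxE; ring.
Qed.

(** A change of charts adds to the coefficients a second derivative of the transition
    map, which is symmetric and drops out of the torsion.  The torsion is defined
    in the preferred chart of each point, while its vanishing has to be
    differentiated in a fixed chart. *)
Lemma christoffel_torsion_change c u w w' : slit u -> tdom c u ->
  tcoord c u.1 (G (tchart_at u) (zat u) w w'.1 - G (tchart_at u) (zat u) w' w.1) =
  G c (tch c u) (ttcoord c u w) (ttcoord c u w').1 -
  G c (tch c u) (ttcoord c u w') (ttcoord c u w).1.
Proof.
move=> su cu; have au : tdom (tchart_at u) u by exact: chart_at_mem.
set a := tchart_at u; pose psi := ch a \o cinv c; pose phi := ch c \o cinv a.
have spsi := @chart_transition_smooth _ _ M c a.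
have oc := @chart_overlap_open _ _ M c a.
have cp : overlap dom ch c a (ch c u.1) by exact: overlap_mem.
have phiu : phi (zat u).1 = ch c u.1 by rewrite /phi /= chartK.
have change (x : TTM) b : 'd (pifield_rep (pifield_of c (fun _ => b)) a) (zat u) x =
    'D_(ttcoord c u x).1 ('D_b psi) (ch c u.1).
  have near_rep : \forall z \near zat u, ('D_b psi) (phi z.1) =
      pifield_rep (pifield_of c (fun _ => b)) a z.
    have := overlap_near (@tchart_overlap_open _ _ M) au cu.
    apply: filterS => _ [q [aq cq] <-]; rewrite pifield_repE// /pifield_of tcoordE.
    rewrite Jcomp//; last exact: chart_at_mem.
    rewrite /phi /= chartK// /jac deriveE//.
    exact: (transition_differentiable (@chart_transition_smooth _ _ M)).
  have dphi : differentiable phi (zat u).1.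
    exact: (transition_differentiable (@chart_transition_smooth _ _ M)).
  have dD : differentiable ('D_b psi) (phi (zat u).1).
    by rewrite phiu; apply: smooth_on_differentiable cp; exact: smooth_on_derive.
  have dpf : differentiable (fun z : Z => phi z.1) (zat u).
    exact: (@differentiable_comp _ _ _ _ (fst : Z -> V) phi _ (fst_differentiable _) dphi).
  have dall : differentiable (fun z : Z => 'D_b psi (phi z.1)) (zat u).
    exact: (@differentiable_comp _ _ _ _ (fun z : Z => phi z.1) ('D_b psi) _ dpf dD).
  have E1 := congr1 (fun f : Z -> V => f x) (near_eq_d near_rep dall).
  have E2 : 'D_x (fun z : Z => phi z.1) (zat u) = (ttcoord c u x).1.
    have D1 : 'D_x (fst : Z -> V) (zat u) = x.1.
      exact: (derive_linear _ _ (@fst_linear_continuous _ V V)).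
    rewrite (derive_comp x (fst_differentiable _) dphi) D1.
    rewrite (etrans (ttcoord_fst x cu) (congr1 (tcoord c u.1) (rhoE u x))).
    exact: (deriveE x.1 dphi).
  have E3 := derive_comp x dpf dD.
  apply: (etrans E1); apply: (etrans (esym (deriveE x dall))); apply: (etrans E3).
  exact: (f_equal2 (fun v y => 'D_v ('D_b psi) y) E2 phiu).
have key (x x' : TTM) : G c (tch c u) (ttcoord c u x) (ttcoord c u x').1 =
    tcoord c u.1 ('D_(ttcoord c u x).1 ('D_(ttcoord c u x').1 psi) (ch c u.1) + G a (zat u) x x'.1).
  rewrite christoffelE// connection_at//; last exact: pifield_of_const_near.
  rewrite change; congr (tcoord _ _ (_ + G _ _ _ _)).
  rewrite /pifield_of ttcoord_fst// rhoE tcoordE Jcancel//; exact: chart_at_mem.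
have aux (A B p q : V) : A = B -> p - q = (A + p) - (B + q).
  by move=> ->; rewrite opprD addrACA subrr add0r.
have E := derive_swap (frame_rV n) (ttcoord c u w').1 (ttcoord c u w).1 oc spsi cp.
rewrite (key w w') (key w' w) -tcoordB; apply: (congr1 (tcoord c u.1)).
exact: (aux _ _ _ _ E).
Qed.

Lemma torsion_chart c u (X Y : field M) : slit u -> tdom c u -> field_near u X -> field_near u Y ->
  tcoord c u.1 (torsion D X Y u) =
  G c (tch c u) (ttcoord c u (X u)) (ttcoord c u (Y u)).1 -
  G c (tch c u) (ttcoord c u (Y u)) (ttcoord c u (X u)).1.
Proof.
by move=> su cu sX sY; rewrite torsion_at// !rhoE christoffel_torsion_change.
Qed.

Lemma pifield_near_open c u (X : pifield M) : tdom c u -> pifield_near u X ->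
  \forall z \near tch c u, forall q, tdom c q -> tch c q = z -> pifield_near q X.
Proof.
move=> cu sX; have [A [oA Ax sA]] := sX c cu.
apply: filterS (open_nbhs_nbhs (conj oA Ax)) => z Az q cq qz.
by apply: (pifield_near_chart cq); exists A; split; rewrite ?qz.
Qed.

Lemma christoffel_form_derive c z0 w (X : Z -> Z) (Y : Z -> V) x0 y0 : slit_image c z0 ->
  differentiable X z0 -> differentiable Y z0 -> X z0 = x0 -> Y z0 = y0 ->
  differentiable (fun z => G c z (X z) (Y z)) z0 /\
  'D_w (fun z => G c z (X z) (Y z)) z0 =
  'D_w (fun z => G c z x0 y0) z0 + G c z0 ('D_w X z0) y0 + G c z0 x0 ('D_w Y z0).
Proof.
move=> Oz dX dY <- <-.
have nO : \forall z \near z0, slit_image c z.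
  exact: open_nbhs_nbhs (conj (@slit_image_open _ _ _ c) Oz).
have dG x y : differentiable (fun z => G c z x y) z0.
  exact: smooth_on_differentiable (christoffel_smooth hD c x y) Oz.
have l1 y : \forall z \near z0, linear (fun x => G c z x y).
  by apply: filterS nO => _ /slit_imageP[q [cq sq <-]]; exact: christoffel_linear_dir.
have l2 : \forall z \near z0, linear (G c z (X z)).
  by apply: filterS nO => _ /slit_imageP[q [cq sq <-]]; exact: christoffel_linear_arg.
have d2 y : differentiable (fun z => G c z (X z) y) z0.
  exact: (differentiable_eval frameZ (l1 y) (fun x => dG x y) dX).
split; first exact: (differentiable_eval (frame_rV n) l2 d2 dY).
rewrite (derive_eval (frame_rV n) w l2 d2 dY).
by rewrite (derive_eval frameZ w (l1 _) (fun x => dG x _) dX).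
Qed.

(** The second derivatives of the representative of [W] cancel by Schwarz, its first
    derivatives against those of the bracket. *)
Lemma curvature_at u (X Y : field M) (W : pifield M) : slit u ->
  field_near u X -> field_near u Y -> pifield_near u W ->
  curvature D X Y W u =
  curvature_coef (G (tchart_at u)) (zat u) (X u) (Y u) (W u).
Proof.
move=> su sX sY sW; have au : tdom (tchart_at u) u by exact: chart_at_mem.
move: au; set a := tchart_at u => au; set z0 := zat u.
have Wu : pifield_rep W a z0 = W u by rewrite pifield_repE// tcoord_at.
have Fu (T : field M) : field_rep T a z0 = T u by rewrite field_repE// ttcoord_at.
have [A [oA Az sA]] := sW a au.
have dW v : differentiable ('D_v (pifield_rep W a)) z0.
  exact: smooth_on_differentiable (smooth_on_derive _ sA) Az.
have dW0 : differentiable (pifield_rep W a) z0 by exact: smooth_on_differentiable sA Az.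
have nA : \forall z \near z0, A z by exact: open_nbhs_nbhs.
have lW : \forall z \near z0, linear (fun v => 'D_v (pifield_rep W a) z).
  by apply: filterS nA => z Az'; apply: derive_linear_dir; exact: smooth_on_differentiable sA Az'.
(* the derivative along S of the representative of the derivative of W along T *)
have second (S T : field M) : field_near u S -> field_near u T ->
    D u (S u) (fun u' => D u' (T u') W) =
    'D_(S u) ('D_(T u) (pifield_rep W a)) z0 +
    'D_('D_(S u) (field_rep T a) z0) (pifield_rep W a) z0 +
    ('D_(S u) (fun z => G a z (T u) (W u)) z0 + G a z0 ('D_(S u) (field_rep T a) z0) (W u) +
     G a z0 (T u) ('D_(S u) (pifield_rep W a) z0)) +
    G a z0 (S u) ('D_(T u) (pifield_rep W a) z0 + G a z0 (T u) (W u)).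
  move=> sS sT; have dT : differentiable (field_rep T a) z0.
    exact: (smooth_near_differentiable (sT a au)).
  rewrite connection_at//; last exact: (conn_smooth hD su sT sW).
  rewrite connection_at// -/a -/z0; congr (_ + _); last by rewrite deriveE.
  have Oz : slit_image a z0 by exact: slit_image_tchart.
  have [dG DG] := christoffel_form_derive (S u) Oz dT dW0 (Fu T) Wu.
  have dE := differentiable_eval frameZ lW dW dT.
  have near_rep : \forall z \near z0, 'D_(field_rep T a z) (pifield_rep W a) z +
      G a z (field_rep T a z) (pifield_rep W a z) = pifield_rep (fun u' => D u' (T u') W) a z.
    apply: filterS3 nA (slit_image_near au su) (pifield_near_open au sW).
    move=> z + /slit_imageP[q [aq sq qz]] nW; rewrite -qz => Aq; rewrite -qz in nW.
    have C := connection_chart hD (T q) sq aq (nW q aq erefl).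
    apply: esym; apply: (etrans (pifield_repE (fun u' => D u' (T u') W) aq)).
    apply: (etrans C); rewrite (field_repE T aq) (pifield_repE W aq).
    by rewrite (deriveE _ (smooth_on_differentiable sA Aq)).
  have dsum := differentiable_add dE dG.
  apply: (etrans (congr1 (fun f : Z -> V => f (S u)) (near_eq_d near_rep dsum))).
  apply: (etrans (esym (deriveE (S u) dsum))).
  apply: (etrans (derive_add (S u) dE dG)).
  have E := derive_eval frameZ (S u) lW dW dT; rewrite Fu in E.
  exact: (f_equal2 +%R E DG).
have dX : differentiable (field_rep X a) z0.
  exact: (smooth_near_differentiable (sX a au)).
have dY : differentiable (field_rep Y a) z0.
  exact: (smooth_near_differentiable (sY a au)).
pose xY := 'D_(X u) (field_rep Y a) z0; pose yX := 'D_(Y u) (field_rep X a) z0.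
have br : bracket X Y u = xY - yX.
  exact: (f_equal2 (fun v w : Z => v - w) (esym (deriveE (X u) dY)) (esym (deriveE (Y u) dX))).
have DW v : 'd (pifield_rep W a) z0 v = 'D_v (pifield_rep W a) z0 by rewrite deriveE.
have swap := derive_swap (frame_rV n) (Y u) (X u) oA sA Az.
have l1 w w' : G a z0 (w - w') (W u) = G a z0 w (W u) - G a z0 w' (W u).
  by rewrite -scaleN1r addrC (christoffel_linear_dir hD _ su au) addrC scaleN1r.
have l2 w b b' : G a z0 w (b + b') = G a z0 w b + G a z0 w b'.
  by have := christoffel_linear_arg hD w su au 1 b b'; rewrite !scale1r.
have l3 : 'd (pifield_rep W a) z0 (xY - yX) =
    'D_xY (pifield_rep W a) z0 - 'D_yX (pifield_rep W a) z0.
  exact: (etrans (linearB _ xY yX) (f_equal2 (fun v w : V => v - w) (DW xY) (DW yX))).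
have third : D u (bracket X Y u) W =
    'D_xY (pifield_rep W a) z0 - 'D_yX (pifield_rep W a) z0 +
    (G a z0 xY (W u) - G a z0 yX (W u)).
  rewrite (connection_at _ su sW) br; exact: (f_equal2 +%R l3 (l1 _ _)).
have aux (s s' p1 p2 q1 q2 g1 g2 k1 k2 m1 m2 : V) : s = s' ->
    - (s + p1 + (q1 + g1 + k1) + (k2 + m1)) + (s' + p2 + (q2 + g2 + k2) + (k1 + m2)) +
    (p1 - p2 + (g1 - g2)) = - q1 + q2 - m1 + m2.
  by move=> ->; apply/rowP => i; rewrite !mxE; ring.
rewrite /curvature (second X Y sX sY) (second Y X sY sX) third !l2.
exact: (aux _ _ _ _ _ _ _ _ _ _ _ _ swap).
Qed.

End Linear.
End TorsionCurvature.

(** * The energy change *)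

Section LocalEnergy.
Context {R : realType} {n : nat}.
Local Notation V := 'rV[R]_n.
Local Notation Z := (V * V)%type.
Variables (O : set Z) (F : Z -> R^o) (g : Z -> V -> V -> R) (G : Z -> Z -> V -> V) (zc : Z -> V).
Hypothesis H : cartan_coefficients O g G.
Hypothesis sF : smooth_on O F.
Hypothesis hessF : forall z a b, O z -> vertical_hessian F z a b = g z a b.
Hypothesis zeta_chart_smooth : smooth_on O zc.
Hypothesis zeta_chart_concurrent : forall z w, O z -> 'D_w zc z = - w.1 - G z w (zc z).
Let oO : open O := fc_open H.

Definition energy_rep (z : Z) : R^o := F z + (g z (zc z) z.2 : R) ^+ 2.

Let B (z : Z) : R^o := g z (zc z) z.2.

Lemma B_smooth : smooth_on O B.
Proof.
by apply: (smooth_form H); [exact: zeta_chart_smooth|exact: snd_smooth].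
Qed.

Lemma lower_zeta_smooth b : smooth_on O (fun z => g z b (zc z) : R^o).
Proof.
by apply: (smooth_form H); [exact: smooth_on_const|exact: zeta_chart_smooth].
Qed.

Lemma energy_rep_smooth : smooth_on O energy_rep.
Proof.
apply: smooth_on_add => //.
exact: (smooth_on_mul oO B_smooth B_smooth).
Qed.

(** Only the factor [z.2] of [B] contributes: [zeta] is parallel in vertical
    directions. *)
Lemma derive_B z b : O z -> 'D_(0, b) B z = g z b (zc z).
Proof.
move=> Oz; have dz := smooth_on_differentiable zeta_chart_smooth Oz.
rewrite (derive_form H (0, b) Oz dz (snd_differentiable z)) zeta_chart_concurrent//=.
rewrite oppr0 add0r addNr (gC H 0)// (g0r H)// add0r.
rewrite derive_linear /=; last exact: snd_linear_continuous.
by rewrite (vertical_eta H b Oz) addr0 (gC H _ _ Oz).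
Qed.

(** The vertical derivative of [B] is [g(b, zeta)], which has no vertical derivative;
    so the Hessian of [B ^+ 2] is the product of two first derivatives. *)
Lemma energy_hessian z a b : O z ->
  vertical_hessian energy_rep z a b = g z a b + g z a (zc z) * g z b (zc z).
Proof.
move=> Oz; have dB y : O y -> differentiable B y := smooth_on_differentiable B_smooth.
have dF y : O y -> differentiable F y := smooth_on_differentiable sF.
have first y : O y -> 'D_(0, b) energy_rep y =
    'D_(0, b) (F) y + (2 : R) *: ((B y) *: (g y b (zc y) : R^o)).
  move=> Oy; have dBB := differentiable_scale (dB y Oy) (dB y Oy).
  apply: (etrans (derive_add (0, b) (dF y Oy) dBB)); congr (_ + _).
  apply: (etrans (derive_scale (0, b) (dB y Oy) (dB y Oy))).
  rewrite derive_B//; set s : R := g y b (zc y); set t : R := B y.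
  by rewrite -[LHS]/(s * t + t * s) -[RHS]/(2 * (t * s)); ring.
have dl := smooth_on_differentiable (lower_zeta_smooth b) Oz.
have dBl := differentiable_scale (dB z Oz) dl.
have dDF : differentiable ('D_(0, b) (F)) z.
  exact: smooth_on_differentiable (smooth_on_derive _ sF) Oz.
have d2 : differentiable (fun y => (2 : R) *: (B y *: (g y b (zc y) : R^o))) z.
  by apply: differentiableZ.
have second : 'D_(0, a) ('D_(0, b) energy_rep) z =
    'D_(0, a) ('D_(0, b) (F)) z + (2 : R) *: ((g z a (zc z) : R^o) *: (g z b (zc z) : R^o)).
  apply: (etrans (open_eq_derive (0, a) oO Oz first)).
  apply: (etrans (derive_add (0, a) dDF d2)); congr (_ + _).
  apply: (etrans (derive_constZ (0, a) 2 dBl)); congr (_ *: _).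
  apply: (etrans (derive_scale (0, a) (dB z Oz) dl)); rewrite derive_B//.
  rewrite (derive_lower_zeta H zeta_chart_smooth zeta_chart_concurrent)//=.
  rewrite (vertical_lower_zeta H zeta_chart_smooth zeta_chart_concurrent)//.
  by rewrite (gC H 0)// (g0r H)// subrr scaler0 addr0.
apply: (etrans (congr1 (fun r : R => 2^-1 * r) second)).
rewrite mulrDr -[X in X + _]/(vertical_hessian F z a b) hessF//; congr (_ + _).
by rewrite -[_ *: _]/(2 * (g z a (zc z) * g z b (zc z))) mulKf// pnatr_eq0.
Qed.

Let gt := vertical_hessian energy_rep.

Lemma energy_finsler_coefficients : finsler_coefficients O gt.
Proof.
have sE := energy_rep_smooth; split.
- exact: oO.
- by move=> z a Oz; exact: (vertical_hessian_linear oO sE).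
- by move=> z a b Oz; exact: (vertical_hessian_sym oO sE).
- move=> z a Oz a0; rewrite /gt energy_hessian//.
  by rewrite ltr_pwDl ?(fc_pos H)// -expr2 sqr_ge0.
- by move=> a b; exact: (vertical_hessian_smooth oO sE).
- by move=> z v a b Oz; exact: (vertical_hessian_third oO sE).
- move=> z a b Oz.
  rewrite (derive_changed_form H zeta_chart_smooth zeta_chart_concurrent energy_hessian)//=.
  have V0 u e := vertical_lower_zeta H zeta_chart_smooth zeta_chart_concurrent u e Oz.
  rewrite !V0 (gC H 0 a)// (gC H 0 b)// !(g0r H)// subrr mulr0 mul0r !addr0.
  by rewrite -(cc_metric H)// (fc_homogeneous H).
Qed.

End LocalEnergy.

Section Final.
Context {R : realType} {n : nat} {M : manifold R n}.
Local Notation V := 'rV[R]_n.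
Local Notation Z := (V * V)%type.
Local Notation dom := (@chart_dom R n M).
Local Notation ch := (@chart R n M).
Local Notation cinv := (@chart_inv R n M).
Local Notation tch := (@tchart R n M).
Local Notation tinv := (@tchart_inv R n M).
Local Notation tdom := tchart_dom.
Local Notation J := (jac ch cinv).
Local Notation TJ := (jac tch tinv).
Implicit Types (c d : chart_index M) (p : M) (u : TM M).

Lemma tcoord_pifield_of c u (a : V) : tdom c u ->
  tcoord c u.1 (pifield_of c (fun _ => a) u) = a.
Proof. by move=> cu; rewrite /pifield_of tcoordK. Qed.

Lemma tcoord0 c p : tcoord c p 0 = 0.
Proof. exact: linear0. Qed.

Section CartanChart.
Variables (c : chart_index M) (L : funTM M) (D : connection M) (g : Z -> V -> V -> R).
Hypothesis hD : cartan L D.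
Hypothesis hg : finsler_coefficients (slit_image c) g.
Hypothesis gE : forall u v w, slit u -> tdom c u ->
  metric L u v w = g (tch c u) (tcoord c u.1 v) (tcoord c u.1 w).
Let lD := cartan_linear hD.
Let rD := cartan_regular hD.

Lemma cartan_metric_chart z w a b : slit_image c z ->
  'D_w (fun z => g z a b : R^o) z =
  g z (christoffel D c z w a) b + g z a (christoffel D c z w b).
Proof.
move=> Oz; have [u [cu su uz]] := slit_imageP Oz; rewrite -uz in Oz *.
have sa := pifield_of_const_near (M := M) a cu.
have sb := pifield_of_const_near (M := M) b cu.
pose w' := TJ c (tchart_at u) u w.
have cE e : tcoord c u.1 (D u w' (pifield_of c (fun _ => e))) =
    christoffel D c (tch c u) w e.
  exact: (etrans (esym (christoffelE D w' e cu))
    (congr1 (fun x => christoffel D c (tch c u) x e) (ttcoordK w cu))).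
have := cartan_metric hD w' su sa sb.
rewrite (gE (D u w' _) _ su cu) (gE _ (D u w' _) su cu) (cE a) (cE b) !tcoord_pifield_of//.
have near_rep : \forall z \near tch c u, (g z a b : R^o) =
    fun_rep (fun u' => metric L u' (pifield_of c (fun _ => a) u')
        (pifield_of c (fun _ => b) u')) c z.
  apply: filterS (slit_image_near cu su) => _ /slit_imageP[q [cq sq <-]].
  by rewrite fun_repE// gE// !tcoord_pifield_of.
have dg : differentiable (fun z => g z a b : R^o) (tch c u).
  exact: smooth_on_differentiable (fc_smooth hg a b) Oz.
have drep := near_eq_differentiable near_rep dg.
move=> <-; rewrite (dfun_chart w' cu drep) ttcoordK//.
exact: (etrans (deriveE w dg) (esym (congr1 (fun f : Z -> R^o => f w) (near_eq_d near_rep dg)))).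
Qed.

Lemma torsionT_chart u X Y : slit u -> tdom c u -> pifield_near u X -> pifield_near u Y ->
  tcoord c u.1 (torsionT D X Y u) =
  christoffel D c (tch c u) (0, tcoord c u.1 (X u)) (tcoord c u.1 (Y u)).
Proof.
move=> su cu sX sY.
have sh := hmapf_near lD rD su cu sY.
rewrite /torsionT (torsion_chart lD su cu (gamf_near sX) sh).
rewrite /gamf /hmapf ttcoord_gam// (hmap_chart lD rD)//=.
suff -> : christoffel D c (tch c u)
   (tcoord c u.1 (Y u), hmap_rep D c (tch c u) (tcoord c u.1 (Y u))) 0 = 0 by rewrite subr0.
have := christoffel_linear_arg lD (tcoord c u.1 (Y u), hmap_rep D c (tch c u)
    (tcoord c u.1 (Y u))) su cu 1 0 0.
by rewrite !scale1r addr0 => E; apply: (@addrI _ (christoffel D c (tch c u)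
   (tcoord c u.1 (Y u), hmap_rep D c (tch c u) (tcoord c u.1 (Y u))) 0)); rewrite -E addr0.
Qed.

(** Each axiom, at a point of the domain, is an axiom of [D] for fields with constant
    representatives. *)
Lemma cartan_coefficients_chart :
  cartan_coefficients (slit_image c) g (christoffel D c).
Proof.
split.
- exact: hg.
- by move=> _ a /slit_imageP[u [cu su <-]]; exact: (christoffel_linear_dir lD).
- by move=> _ w /slit_imageP[u [cu su <-]]; exact: (christoffel_linear_arg lD).
- by move=> w a; exact: (christoffel_smooth lD).
- by move=> z w a b; exact: cartan_metric_chart.
- move=> _ v a b /slit_imageP[u [cu su <-]].
  have sv := pifield_of_const_near (M := M) v cu.
  have sa := pifield_of_const_near (M := M) a cu.
  have sb := pifield_of_const_near (M := M) b cu.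
  have := cartan_T hD su sv sa sb.
  by rewrite !gE// !torsionT_chart// !tcoord_pifield_of.
- move=> _ x v x' v' /slit_imageP[u [cu su <-]] hv hv'.
  have sx := pifield_of_const_near (M := M) x cu.
  have sx' := pifield_of_const_near (M := M) x' cu.
  have hor y b : b + christoffel D c (tch c u) (y, b) (tch c u).2 = 0 ->
      ttcoord c u (hmap D u (pifield_of c (fun _ => y) u)) = (y, b).
    move=> E; rewrite (@hmap_unique _ _ _ _ lD rD u (TJ c (tchart_at u) u (y, b)))//.
    - by rewrite ttcoordK.
    - apply: (tcoord_inj cu); rewrite (conn_map_chart lD)// ttcoordK//= E.
      by rewrite tcoord0.
    - by apply: (tcoord_inj cu); rewrite -ttcoord_fst// ttcoordK// tcoord_pifield_of.
  have := cartan_Q hD su sx sx' => /(congr1 (tcoord c u.1)).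
  rewrite /torsionQ (torsion_chart lD su cu (hmapf_near lD rD su cu sx)
      (hmapf_near lD rD su cu sx')).
  rewrite /hmapf (hor _ _ hv) (hor _ _ hv')/= tcoord0 => /eqP.
  by rewrite subr_eq0 => /eqP.
Qed.

End CartanChart.

Section EnergyChange.
Variables (c : chart_index M) (L : funTM M) (nabla nablat : connection M) (zeta : pifield M).
Hypothesis hL : finsler L.
Hypothesis hnabla : cartan L nabla.
Hypothesis hzeta : concurrent nabla zeta.
Hypothesis hnablat : cartan (energy_change L zeta) nablat.

Let O := slit_image c.
Let oO : open O := @slit_image_open _ _ _ c.
Let g := metric_rep L c.
Let G := christoffel nabla c.
Let Gt := christoffel nablat c.
Let zc := pifield_rep zeta c.

Lemma metric_rep_chart u v w : slit u -> tdom c u ->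
  metric L u v w = g (tch c u) (tcoord c u.1 v) (tcoord c u.1 w).
Proof.
move=> su cu; apply: metric_chart => //; exact: square_rep_smooth (finsler_smooth hL).
Qed.

Lemma cartan_chart : cartan_coefficients O g G.
Proof.
apply: (cartan_coefficients_chart hnabla); first exact: finsler_coefficients_chart.
exact: metric_rep_chart.
Qed.
Let H := cartan_chart.

Lemma zeta_chart_smooth : smooth_on O zc.
Proof.
apply: smooth_on_slit_image => u cu su; have [sz _ _] := hzeta; exact: sz su c cu.
Qed.

(** Every vector is the sum of a horizontal and a vertical one. *)
Lemma conn_zeta u w : slit u -> nabla u w zeta = - rho u w.
Proof.
move=> su; have [sz hh hv] := hzeta; have lD := cartan_linear hnabla.
have [_ hr] := hmap_spec (cartan_regular hnabla) (rho u w) su.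
have E : w = hmap nabla u (rho u w) + gam u (w - hmap nabla u (rho u w)).2.
  apply/eqP; rewrite eq_sym -subr_eq0; apply/eqP; rewrite gamE.
  move: hr; rewrite !rhoE; case: (hmap nabla u w.1) => a b /= ->; case: w => w1 w2 /=.
  by congr pair; rewrite /= ?addr0 ?subrr// addrCA subrr addr0 subrr.
by rewrite {1}E (connD lD _ _ su (sz u su)) hh// hv// addr0.
Qed.

Lemma zeta_chart_concurrent z w : O z -> 'D_w zc z = - w.1 - G z w (zc z).
Proof.
move=> Oz; have [u [cu su uz]] := slit_imageP Oz; have [sz _ _] := hzeta.
have C := connection_chart (cartan_linear hnabla) (TJ c (tchart_at u) u w) su cu (sz u su).
move: C; rewrite ttcoordK// conn_zeta// -(pifield_repE zeta cu) uz -/zc.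
rewrite [tcoord _ _ (- _)]linearN -[X in - X]/(tcoord c u.1 _) -ttcoord_fst// ttcoordK//.
rewrite -deriveE; last exact: smooth_on_differentiable zeta_chart_smooth Oz.
by move=> ->; rewrite addrK.
Qed.

Let Ft := energy_rep (square_rep L c) g zc.
Let gt := vertical_hessian Ft.

Lemma energy_rep_square z : O z -> energy_change L zeta (tinv c z) ^+ 2 = Ft z.
Proof.
move=> /slit_imageP[u [cu su <-]]; rewrite tchartK// /energy_change.
rewrite sqr_sqrtr; last by rewrite addr_ge0 ?sqr_ge0.
have E1 : fun_rep L c (tch c u) = L u := fun_repE L cu.
have E2 : metric L u (zeta u) (eta u) = g (tch c u) (zc (tch c u)) (tch c u).2.
  exact: (etrans (metric_rep_chart _ _ su cu)
    (congr1 (fun v => g (tch c u) v (tch c u).2) (esym (pifield_repE zeta cu)))).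
exact: (f_equal2 (fun r s : R => r ^+ 2 + s ^+ 2) (esym E1) E2).
Qed.

Let sq := square_rep_smooth c (finsler_smooth hL).

Lemma energy_gt z a b : O z -> gt z a b = g z a b + g z a (zc z) * g z b (zc z).
Proof.
exact: (energy_hessian H sq (fun _ _ _ _ => erefl) zeta_chart_smooth zeta_chart_concurrent).
Qed.

Lemma energy_metric_chart u v w : slit u -> tdom c u ->
  metric (energy_change L zeta) u v w = gt (tch c u) (tcoord c u.1 v) (tcoord c u.1 w).
Proof.
move=> su cu; apply: metric_chart => //; first exact: energy_rep_square.
exact: (energy_rep_smooth H sq zeta_chart_smooth).
Qed.

Lemma energy_cartan_chart : cartan_coefficients O gt Gt.
Proof.
apply: (cartan_coefficients_chart hnablat); last exact: energy_metric_chart.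
exact: (energy_finsler_coefficients H sq
    (fun _ _ _ _ => erefl) zeta_chart_smooth zeta_chart_concurrent).
Qed.

End EnergyChange.

Section Conclusion.
Variables (L : funTM M) (nabla nablat : connection M) (zeta : pifield M).
Hypothesis hL : finsler L.
Hypothesis hnabla : cartan L nabla.
Hypothesis hzeta : concurrent nabla zeta.
Hypothesis hnablat : cartan (energy_change L zeta) nablat.
Let lD := cartan_linear hnabla.
Let rD := cartan_regular hnabla.
Let lDt := cartan_linear hnablat.
Let rDt := cartan_regular hnablat.

Section AtPoint.
Variable u : TM M.
Hypothesis su : slit u.
Let c := tchart_at u.
Let z := zat u.
Let g := metric_rep L c.
Let G := christoffel nabla c.
Let Gt := christoffel nablat c.
Let zc := pifield_rep zeta c.

Lemma at_chart : tdom c u. Proof. exact: chart_at_mem. Qed.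
Lemma at_slit : slit_image c z. Proof. exact: slit_image_tchart at_chart su. Qed.
Let H : cartan_coefficients (slit_image c) g G := cartan_chart c hL hnabla.
Let zs := zeta_chart_smooth c hzeta.
Let zcc : forall z w, slit_image c z -> 'D_w zc z = - w.1 - G z w (zc z) :=
  @zeta_chart_concurrent c L nabla zeta hnabla hzeta.
Let Ht := energy_cartan_chart c hL hnabla hzeta hnablat.
Let gtE := @energy_gt c L nabla zeta hL hnabla hzeta.

Lemma metric_at v w : metric L u v w = g z v w.
Proof. by have := metric_rep_chart hL v w su at_chart; rewrite !tcoord_at. Qed.

Lemma zeta_at : zc z = zeta u.
Proof. exact: (etrans (pifield_repE zeta at_chart) (tcoord_at u (zeta u))). Qed.

Lemma hmap_at D (lE : linear_connection D) (rE : regular D) (K : Z -> Z -> V -> V) k v :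
  cartan_coefficients (slit_image c) k K -> K = christoffel D c ->
  hmap D u v = (v, - K z (v, 0) z.2).
Proof.
move=> HK KE; apply: (hmap_unique lE rE su); last by rewrite rhoE.
apply: (tcoord_inj at_chart); rewrite (conn_map_chart lE _ su at_chart) ttcoord_at -KE tcoord0.
exact: (horizontal_lift_conn_map HK v at_slit).
Qed.

Lemma curvature_change (X Y : field M) (W : pifield M) :
  field_near u X -> field_near u Y -> pifield_near u W ->
  curvature nablat X Y W u =
    curvature nabla X Y W u
    + (metric L u (torsion nabla X Y u) (W u)
       / (1 + metric L u (zeta u) (zeta u))) *: zeta u
    + tensorH L zeta u (rho u (X u)) (rho u (Y u)) (W u).
Proof.
move=> sX sY sW.
rewrite (curvature_at lDt su sX sY sW) (curvature_at lD su sX sY sW) (torsion_at lD su sX sY).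
rewrite /tensorH /Defs.skew !metric_at !rhoE.
have := changed_curvature H Ht zs zcc gtE (X u) (Y u) (W u) at_slit.
by rewrite -/zc zeta_at.
Qed.

Lemma tensorH0l y w : tensorH L zeta u 0 y w = 0.
Proof.
rewrite /tensorH /Defs.skew !metric_at !(gC H 0 _ at_slit) !(g0r H _ at_slit).
by rewrite !(mulr0, mul0r, scaler0, scale0r, addr0, subrr).
Qed.

Lemma tensorH0r x w : tensorH L zeta u x 0 w = 0.
Proof.
rewrite /tensorH /Defs.skew -opprB; apply/eqP; rewrite oppr_eq0; apply/eqP.
exact: tensorH0l.
Qed.

Lemma hmap_change v :
  hmap nablat u v = hmap nabla u v +
    (g z v z.2 / (1 + g z (zc z) (zc z))) *: ((0, zc z) : Z).
Proof.
rewrite (hmap_at lDt rDt v Ht erefl) (hmap_at lD rD v H erefl).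
have := changed_connection H Ht zs zcc gtE (v, 0) z.2 at_slit.
rewrite -/G -/Gt -/zc -/g /= => ->; congr pair; first by rewrite /= scaler0 addr0.
by rewrite opprB addrC.
Qed.

Lemma torsion_at_G (X Y : field M) : field_near u X -> field_near u Y ->
  torsion nabla X Y u = G z (X u) (Y u).1 - G z (Y u) (X u).1.
Proof. by move=> sX sY; rewrite (torsion_at lD su sX sY) !rhoE. Qed.

Lemma metric0l w : metric L u 0 w = 0.
Proof. by rewrite metric_at (gC H _ _ at_slit) (g0r H _ at_slit). Qed.

Lemma curvatureS_change X Y W :
  pifield_near u X -> pifield_near u Y -> pifield_near u W ->
  curvatureS nablat X Y W u = curvatureS nabla X Y W u.
Proof.
move=> sX sY sW; have gX := gamf_near sX; have gY := gamf_near sY.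
have T0 : torsion nabla (gamf X) (gamf Y) u = 0.
  by rewrite torsion_at_G// /gamf !gamE /= !(G02 H _ at_slit) subrr.
have r0 : rho u (gamf X u) = 0 by rewrite rhoE /gamf gamE.
apply: (etrans (curvature_change gX gY sW)).
by rewrite T0 metric0l mul0r scale0r addr0 r0 tensorH0l addr0.
Qed.

(** Two changes are involved, that of the connection and that of the horizontal map;
    the second one has no effect by [curvature_shift]. *)
Lemma curvatureP_change X Y W :
  pifield_near u X -> pifield_near u Y -> pifield_near u W ->
  curvatureP nablat X Y W u =
    curvatureP nabla X Y W u
    - (metric L u (torsionT nabla Y X u) (W u)
       / (1 + metric L u (zeta u) (zeta u))) *: zeta u.
Proof.
move=> sX sY sW; have gY := gamf_near sY.
have hX := hmapf_near lD rD su at_chart sX; have hXt := hmapf_near lDt rDt su at_chart sX.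
have rh : (hmap nablat u (X u)).1 = X u by rewrite (hmap_at lDt rDt _ Ht erefl).
have rh0 : (hmap nabla u (X u)).1 = X u by rewrite (hmap_at lD rD _ H erefl).
have r0 : rho u (gamf Y u) = 0 by rewrite rhoE /gamf gamE.
have T : torsion nabla (hmapf nablat X) (gamf Y) u = - torsionT nabla Y X u.
  rewrite /torsionT !torsion_at_G// /hmapf /gamf gamE rh rh0 /=.
  by rewrite !(G02 H _ at_slit) sub0r subr0.
have K : curvature nabla (hmapf nablat X) (gamf Y) W u = curvatureP nabla X Y W u.
  rewrite /curvatureP (curvature_at lD su hXt gY sW) (curvature_at lD su hX gY sW).
  rewrite /hmapf hmap_change /gamf gamE.
  have := curvature_shift H zs zcc (hmap nabla u (X u)) (0, Y u) (W u)
    (g z (X u) z.2 / (1 + g z (zc z) (zc z))) 0 at_slit.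
  by rewrite scale0r addr0.
have gN' v w : metric L u (- v) w = - metric L u v w.
  by rewrite !metric_at (gC H (- v) w at_slit) (gN H _ _ at_slit) (gC H w v at_slit).
apply: (etrans (curvature_change hXt gY sW)); rewrite K T r0 tensorH0r addr0.
by rewrite gN' mulNr scaleNr.
Qed.

Lemma curvatureR_change X Y W :
  pifield_near u X -> pifield_near u Y -> pifield_near u W ->
  curvatureR nablat X Y W u = curvatureR nabla X Y W u + tensorH L zeta u (X u) (Y u) (W u).
Proof.
move=> sX sY sW.
have hX := hmapf_near lD rD su at_chart sX; have hXt := hmapf_near lDt rDt su at_chart sX.
have hY := hmapf_near lD rD su at_chart sY; have hYt := hmapf_near lDt rDt su at_chart sY.
have rh T : (hmap nablat u T).1 = T by rewrite (hmap_at lDt rDt _ Ht erefl).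
have rh0 T : (hmap nabla u T).1 = T by rewrite (hmap_at lD rD _ H erefl).
have VZ b := vertical_zeta_dir H zs zcc b at_slit.
(* moving a direction by a multiple of (0, zeta) does not change the coefficients *)
have GS w b k : G z (w + k *: ((0, zc z) : Z)) b = G z w b.
  by rewrite (GD1 H _ _ _ at_slit) (GZ1 H _ _ _ at_slit) VZ scaler0 addr0.
have GH v b : G z (hmap nablat u v) b = G z (hmap nabla u v) b.
  exact: (etrans (congr1 (fun w => G z w b) (hmap_change v)) (GS _ _ _)).
have GE (S T : pifield M) :
    G z (hmapf nablat S u) (hmapf nablat T u).1 = G z (hmapf nabla S u) (hmapf nabla T u).1.
  exact: (etrans (congr1 (G z _) (rh (T u)))
    (etrans (GH (S u) (T u)) (esym (congr1 (G z _) (rh0 (T u)))))).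
have Q0 : torsion nabla (hmapf nablat X) (hmapf nablat Y) u = 0.
  rewrite -(cartan_Q hnabla su sX sY) /torsionQ (torsion_at_G hXt hYt) (torsion_at_G hX hY).
  exact: (f_equal2 (fun a b : V => a - b) (GE X Y) (GE Y X)).
apply: (etrans (curvature_change hXt hYt sW)); rewrite Q0 metric0l mul0r scale0r addr0.
rewrite !rhoE /curvatureR /hmapf !rh; congr (_ + _).
rewrite (curvature_at lD su hXt hYt sW) (curvature_at lD su hX hY sW) /hmapf !hmap_change.
exact: (curvature_shift H zs zcc _ _ _ _ _ at_slit).
Qed.

End AtPoint.
End Conclusion.

End Final.

Theorem theorem5p6 (R : realType) (n : nat) (M : manifold R n)
  (L : funTM M) (hL : finsler L)
  (nabla : connection M) (hnabla : cartan L nabla)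
  (zeta : pifield M) (hzeta : concurrent nabla zeta)
  (nablat : connection M) (hnablat : cartan (energy_change L zeta) nablat) :
  (forall (X Y : field M) (Z : pifield M),
     smooth_field X -> smooth_field Y -> smooth_pifield Z ->
     forall u : TM M, slit u ->
     curvature nablat X Y Z u =
       curvature nabla X Y Z u
       + (metric L u (torsion nabla X Y u) (Z u)
          / (1 + metric L u (zeta u) (zeta u))) *: zeta u
       + tensorH L zeta u (rho u (X u)) (rho u (Y u)) (Z u))
  /\
  (forall X Y Z : pifield M,
     smooth_pifield X -> smooth_pifield Y -> smooth_pifield Z ->
     forall u : TM M, slit u ->
     [/\ curvatureS nablat X Y Z u = curvatureS nabla X Y Z u,
         curvatureP nablat X Y Z u =
           curvatureP nabla X Y Z u
           - (metric L u (torsionT nabla Y X u) (Z u)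
              / (1 + metric L u (zeta u) (zeta u))) *: zeta u
       & curvatureR nablat X Y Z u =
           curvatureR nabla X Y Z u + tensorH L zeta u (X u) (Y u) (Z u)]).
Proof.
split=> X Y Z sX sY sZ u su.
  exact: (curvature_change hL hnabla hzeta hnablat su (sX u su) (sY u su) (sZ u su)).
split.
- exact: (curvatureS_change hL hnabla hzeta hnablat su (sX u su) (sY u su) (sZ u su)).
- exact: (curvatureP_change hL hnabla hzeta hnablat su (sX u su) (sY u su) (sZ u su)).
- exact: (curvatureR_change hL hnabla hzeta hnablat su (sX u su) (sY u su) (sZ u su)).
Qed.
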